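(* Let $q$ be a prime power. For $i\in\{1,2\}$ let $m_i\ge2$ be a divisor of $q-1$, let $s_i$ be an integer with $0\le s_i<m_i$, and let $f_i\in\mathbb F_q[x]$ be a separable polynomial of degree $d_i\ge1$ with $f_i(0)\ne0$, such that $\gcd(f_i,f_i^* )=1$ for $i=1,2$ and $\gcd(f_1f_1^*,f_2f_2^* )=1$. Then the curve $\mathcal X$ defined by the affine equations $$y_1^{m_1}=\frac{x^{s_1}f_1(x)}{f_1^*(x)},\qquad y_2^{m_2}=\frac{x^{s_2}f_2(x)}{f_2^*(x)}$$ has genus $$g=m_1m_2(d_1+d_2)-d_1m_2-d_2m_1+1-\kappa,$$ where $\kappa=(m_1m_2,s_1m_2,s_2m_1)$. Further, if $\mathbb F_{q^2}$ is the full constant field of $\mathbb F_{q^2}(\mathcal X)=\mathbb F_{q^2}(x,y_1,y_2)$, $[\mathbb F_{q^2}(\mathcal X):\mathbb F_{q^2}(x)]=m_1m_2$, and $\gcd(f_i,x^{q+1}-1)=1$ for $i\in\{1,2\}$, then $\#\mathcal X(\mathbb F_{q^2})\ge m_1m_2(q+1)$.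
   Context: $f^*(x)=x^{\deg f}f(1/x)$ is the reciprocal polynomial. $(a,b,c)$ denotes the gcd of integers. $\#\mathcal X(\mathbb F_{q^2})$ is the number of $\mathbb F_{q^2}$-rational points (degree-one places of $\mathbb F_{q^2}(x,y_1,y_2)$) of the nonsingular projective model of the curve. *)

(* Defs.v *)
From HB Require Import structures.
From mathcomp Require Import all_boot all_order all_algebra.
From mathcomp Require Import separable.
Set Implicit Arguments. Unset Strict Implicit. Unset Printing Implicit Defensive.
Import Order.TTheory GRing.Theory Num.Theory.
Local Open Scope ring_scope.

(* reciprocal polynomial f^*(x) = x^{deg f} f(1/x): reverse coefficient list *)
Definition recip (R : nzRingType) (f : {poly R}) : {poly R} := Poly (rev f).

Section FunctionFields.
Variable F : fieldType.

Definition generated_by (k : fieldType) (iota : {rmorphism k -> F}) (gens : seq F) :=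
  forall S : F -> Prop,
    (forall c, S (iota c)) -> (forall z, z \in gens -> S z) ->
    (forall a b, S a -> S b -> S (a + b)) -> (forall a, S a -> S (- a)) ->
    (forall a b, S a -> S b -> S (a * b)) -> (forall a, S a -> S a^-1) ->
    forall z, S z.

Definition algebraic_over (k : fieldType) (iota : {rmorphism k -> F}) (z : F) :=
  exists p : {poly k}, p != 0 /\ root (map_poly iota p) z.

Definition transcendental_over (k : fieldType) (iota : {rmorphism k -> F}) (x : F) :=
  forall p : {poly k}, (map_poly iota p).[x] = 0 -> p = 0.

Definition indep_mod (K P : F -> Prop) (e : seq F) :=
  forall c : seq F, size c = size e -> (forall a, a \in c -> K a) ->
    P (\sum_(i < size e) c`_i * e`_i) -> forall a, a \in c -> a = 0.

Definition has_dim (K P S : F -> Prop) (n : nat) :=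
  (exists e : seq F, size e = n /\ (forall z, z \in e -> S z) /\ indep_mod K P e) /\
  (forall e : seq F, (forall z, z \in e -> S z) -> indep_mod K P e -> (size e <= n)%N).

Definition maxideal (O : F -> Prop) (z : F) := O z /\ (z = 0 \/ ~ O z^-1).

Definition uniformizer (O : F -> Prop) (t : F) :=
  t != 0 /\ maxideal O t /\ forall z, maxideal O z -> O (z / t).

(* a place of F/K, given by its valuation ring O (a discrete valuation ring
   of F containing K, different from F) *)
Definition is_place (K O : F -> Prop) :=
  (forall c, K c -> O c) /\ O 1 /\
  (forall a b, O a -> O b -> O (a + b) /\ O (- a) /\ O (a * b)) /\
  (forall z, z != 0 -> O z \/ O z^-1) /\
  (exists z, ~ O z) /\ (exists t, uniformizer O t).

Definition same_place (O1 O2 : F -> Prop) := forall z, O1 z <-> O2 z.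

Definition ord (O : F -> Prop) (z : F) (n : int) :=
  z != 0 /\ exists t, uniformizer O t /\ O (z * t ^ (- n)) /\ O (z * t ^ (- n))^-1.

Definition place_deg (K O : F -> Prop) (d : nat) := has_dim K (maxideal O) O d.

(* a divisor: finitely many pairwise distinct places with multiplicities,
   each entry also recording the degree of its place *)
Definition divisor k := 'I_k -> (F -> Prop) * int * nat.

Definition valid_divisor (K : F -> Prop) k (A : divisor k) :=
  (forall i, is_place K (A i).1.1 /\ place_deg K (A i).1.1 (A i).2) /\
  (forall i j, i != j -> ~ same_place (A i).1.1 (A j).1.1).

Definition div_deg k (A : divisor k) : int := \sum_(i < k) (A i).1.2 * ((A i).2)%:Z.

Definition LRR (K : F -> Prop) k (A : divisor k) (z : F) :=
  z = 0 \/
  forall O, is_place K O -> forall v, ord O z v ->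
    (forall i, same_place (A i).1.1 O -> - (A i).1.2 <= v) /\
    ((forall i, ~ same_place (A i).1.1 O) -> 0 <= v).

Definition is_genus (K : F -> Prop) (g : int) :=
  (forall k (A : divisor k) (l : nat), valid_divisor K A ->
     has_dim K (fun z => z = 0) (LRR K A) l -> div_deg A - l%:Z + 1 <= g) /\
  (exists k (A : divisor k) (l : nat), valid_divisor K A /\
     has_dim K (fun z => z = 0) (LRR K A) l /\ div_deg A - l%:Z + 1 = g).

Definition ratfield (k : fieldType) (iota : {rmorphism k -> F}) (x : F) (z : F) :=
  exists a b : {poly k}, (map_poly iota b).[x] != 0 /\
    z = (map_poly iota a).[x] / (map_poly iota b).[x].

Definition rational_place (K O : F -> Prop) := is_place K O /\ place_deg K O 1.

End FunctionFields.

(* Main.v *)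
(** Let k be the field of constants and N = m1 m2. Since m1 and m2 divide #|k| - 1, F is a Kummer
    extension of k(x). A shortest linear relation among the monomials y1^a y2^b over k(x) would be
    shortened by the Frobenius map (the #|k|-1-st powers of the monomials lie in k(x)), so they form a
    basis, and the Galois group acts on it diagonally. Multiplying y1^a y2^b by a suitable element of
    k(x) gives W_ab such that W_ab^N is a polynomial whose roots have multiplicity less than N. A
    function without poles over the finite places (or with bounded poles at infinity) has all its
    Galois conjugates of the same kind, hence so are its components, and W is therefore an integral
    basis over k[x] with known pole orders delta_ab at infinity.

    For a nonconstant polynomial p put h = p + 1/p, whose poles are the zeros of p and the places at
    infinity. The space L(n (h)_oo) is then explicit and has dimension
    2 n N deg p + N - \sum delta for large n. A place in the support of a given divisor is a pole of h
    for suitable p. Counting the conditions imposed at the poles of h, whose degrees add up to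
    2 N deg p by weak approximation, yields Riemann's inequality with g = 1 - N + \sum delta, and
    equality for the divisor n (h)_oo itself. Finally \sum delta is computed by counting the pairs
    (a, b) with N dividing a s1 m2 + b s2 m1: there are kappa of them.

    If alpha^(q+1) = 1 then f*(alpha) = alpha^d f(alpha)^q, so alpha^s f(alpha)/f*(alpha) is an m-th
    power in the field with q^2 elements. The residues of y1 and y2 at a place over x = alpha are then
    constants, and the Galois conjugates of this place are N distinct places over x = alpha. By the
    fundamental inequality all of them have degree one. *)

Require Import Defs.
From HB Require Import structures.
From mathcomp Require Import all_boot all_order all_algebra.
From mathcomp Require Import separable.
From mathcomp Require Import finfield cyclic mxpoly generic_quotient ring zify.
From mathcomp Require boolp classical_sets.
Set Implicit Arguments. Unset Strict Implicit. Unset Printing Implicit Defensive.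
Import Order.TTheory GRing.Theory Num.Theory.
Local Open Scope ring_scope.

(** * Linear independence over a subfield *)

(** Places are handled as bare valuation rings over k ([vring]). Discreteness, finiteness of residue
    degrees, finiteness of the set of poles and the bound for the sum of the e f all come from one
    count, [count_bound]: a family independent modulo h^-1 R has at most N deg h members. The shape
    h = p + 1/p makes one explicit family of spaces serve every divisor: all places at infinity are
    among the poles, p may be chosen to vanish at any finite places, and multiplication by p^n turns
    L(n (h)_oo) into a degree condition on coordinates in W. Riemann's inequality asks for the pole
    degrees only from above; equality, which attains the bound, follows by imposing so many
    conditions on L(n (h)_oo) that only the fixed space L(0) is left, and letting n grow. Regularity
    at all places carries information only if there are enough places: Zorn's lemma provides one
    over each nonconstant polynomial and one at infinity. Since delta_ab > 0 away from (0, 0), k is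
    the exact field of constants, so the genus over the algebraic elements is the genus over k. *)

Lemma left_kernel (k : fieldType) (I J : finType) (c : I -> J -> k) :
  exists a : 'I_(#|I| - #|J|) -> I -> k,
    (forall l j, \sum_i a l i * c i j = 0) /\
    (forall b : 'I_(#|I| - #|J|) -> k,
       (forall i, \sum_l b l * a l i = 0) -> forall l, b l = 0).
Proof.
pose M := \matrix_(i < #|I|, j < #|J|) c (enum_val i) (enum_val j).
have rk : (#|I| - #|J| <= \rank (kermx M))%N.
  by rewrite mxrank_ker leq_sub2l // rank_leq_col.
pose B := row_base (kermx M).
have BM : B *m M = 0 by apply/sub_kermxP; rewrite eq_row_base.
have fB : row_free B by rewrite row_base_free.
exists (fun l i => B (widen_ord rk l) (enum_rank i)); split=> [l j|b Hb l].
  have /matrixP/(_ (widen_ord rk l) (enum_rank j)) := BM.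
  rewrite !mxE => {2}<-; rewrite (reindex (fun i : 'I_#|I| => enum_val i)) /=; last exact/onW_bij/enum_val_bij.
  by apply: eq_bigr => i _; rewrite !mxE enum_valK enum_rankK.
(* Only the first |I| - |J| basis rows were kept; [b] is extended by zero to the whole basis so that
   row freeness applies. *)
pose b' := \row_(l < \rank (kermx M)) (if insub (l : nat) is Some l' then b l' else 0).
have b'B : b' *m B = 0.
  apply/rowP => i; rewrite !mxE -[RHS](Hb (enum_val i)).
  rewrite (bigID (fun l : 'I_(\rank (kermx M)) => (l < #|I| - #|J|)%N)) /= [X in _ + X]big1 ?addr0.
    rewrite (big_ord_narrow rk); apply: eq_bigr => j _.
    by rewrite !mxE /= valK enum_valK.
  by move=> j nj; rewrite !mxE insubF ?mul0r //; apply/negbTE.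
have b'0 : b' = 0 by apply: (row_free_inj fB); rewrite b'B mul0mx.
have /rowP/(_ (widen_ord rk l)) := b'0.
by rewrite !mxE /= valK.
Qed.

Section Lin.
Variables (k F : fieldType) (iota : {rmorphism k -> F}).

Definition cst (z : F) := exists c, z = iota c.

Definition subsp (P : F -> Prop) :=
  [/\ P 0, forall a b, P a -> P b -> P (a + b) & forall c a, P a -> P (iota c * a)].

Definition lind (P : F -> Prop) (I : finType) (v : I -> F) :=
  forall c : I -> k, P (\sum_i iota (c i) * v i) -> forall i, c i = 0.

(** The lower half of [has_dim]. Since [m] is a natural number, truncated subtraction makes the
    claim void once more conditions than dimensions have been imposed. *)
Definition dim_ge (P : F -> Prop) (m : nat) :=
  exists2 v : 'I_m -> F, forall i, P (v i) & lind (fun z => z = 0) v.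

Lemma subsp0 : subsp (fun z => z = 0).
Proof. by split=> [|a b -> ->|c a ->]; rewrite ?addr0 ?mulr0. Qed.

Lemma subsp_sum P (I : Type) (r : seq I) (Q : pred I) (f : I -> F) :
  subsp P -> (forall i, Q i -> P (f i)) -> P (\sum_(i <- r | Q i) f i).
Proof. by case=> P0 PD _ Pf; elim/big_rec: _ => // i z Qi; apply: PD; apply: Pf. Qed.

Lemma subspB P a b : subsp P -> P a -> P b -> P (a - b).
Proof.
case=> P0 PD PZ Pa Pb; apply: PD => //.
by have := PZ (-1) b Pb; rewrite rmorphN1 mulN1r.
Qed.

Lemma lind_sub (P Q : F -> Prop) (I : finType) (v : I -> F) :
  (forall z, Q z -> P z) -> lind P v -> lind Q v.
Proof. by move=> QP Hv c /QP/Hv. Qed.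

Lemma lind_indep P (S : F -> Prop) (I : finType) (v : I -> F) : lind P v -> (forall i, S (v i)) ->
  exists e, size e = #|I| /\ (forall z, z \in e -> S z) /\ indep_mod cst P e.
Proof.
move=> Hv Sv; exists [seq v i | i <- enum I]; split; first by rewrite size_map -cardE.
split=> [z /mapP [i _ ->] //|c sc Kc Pc a ac].
have sc' : size c = #|I| by rewrite sc size_map -cardE.
have /boolp.choice [d Hd] : forall i : I, exists d, c`_(enum_rank i) = iota d.
  by move=> i; apply: Kc; rewrite mem_nth // sc'.
have d0 : forall i, d i = 0.
  apply: Hv; move: Pc; rewrite size_map -cardE.
  rewrite (reindex enum_rank) /=; last exact/onW_bij/enum_rank_bij.
  congr P; apply: eq_bigr => i _; rewrite Hd; congr (_ * _).
  by rewrite (nth_map i) ?nth_enum_rank // -cardE.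
have /(nthP 0) [j jc <-] := ac; rewrite sc' in jc.
by rewrite -[j]/(nat_of_ord (Ordinal jc)) -(enum_valK (Ordinal jc)) Hd d0 rmorph0.
Qed.

Lemma indep_lind P (e : seq F) : indep_mod cst P e -> lind P (fun i : 'I_(size e) => e`_i).
Proof.
move=> He c Pc i.
have /eqP : iota (c i) = 0; last by rewrite fmorph_eq0 => /eqP.
pose s := [seq iota (c j) | j <- enum 'I_(size e)].
have ss : size s = size e by rewrite size_map size_enum_ord.
have sE (j : 'I_(size e)) : s`_j = iota (c j).
  by rewrite (nth_map j) ?size_enum_ord // nth_ord_enum.
apply: (He s) => //; last by rewrite -sE mem_nth // ss.
- by move=> a /mapP [j _ ->]; exists (c j).
- by under eq_bigr => j _ do rewrite sE.
Qed.

(** Imposing |J| linear conditions on a span costs at most |J| dimensions. *)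
Lemma lind_kernel (I J : finType) (v : I -> F) (c : I -> J -> k) P :
  lind P v -> exists a : 'I_(#|I| - #|J|) -> I -> k,
    (forall l j, \sum_i a l i * c i j = 0) /\
    lind P (fun l => \sum_i iota (a l i) * v i).
Proof.
move=> Hv; have [a [ac ai]] := left_kernel c; exists a; split=> // b Pb l.
apply: ai => {l}; apply: Hv; move: Pb; congr P.
under eq_bigr => l _ do rewrite mulr_sumr.
rewrite exchange_big /=; apply: eq_bigr => i _.
by rewrite rmorph_sum mulr_suml; apply: eq_bigr => l _; rewrite rmorphM mulrA.
Qed.

(** If |I| exceeded |J|, [lind_kernel] would give a nontrivial combination of the [v i] whose
    [w]-part vanishes, hence one lying in [P]. *)
Lemma steinitz P (I J : finType) (v : I -> F) (w : J -> F) : subsp P -> lind P v ->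
  (forall i, exists c : J -> k, P (v i - \sum_j iota (c j) * w j)) -> (#|I| <= #|J|)%N.
Proof.
move=> [P0 PD PZ] Hv /boolp.choice [c Hc].
have [a [ac Ha]] := lind_kernel c Hv.
rewrite -subn_eq0; case: (#|I| - #|J|)%N a ac Ha => // n a ac Ha; exfalso.
suff /Ha/(_ ord0)/eqP : P (\sum_l iota (l == ord0)%:R * \sum_i iota (a l i) * v i).
  by rewrite eqxx oner_eq0.
rewrite (bigD1 ord0) //= [X in _ + X]big1 ?addr0 ?rmorph1 ?mul1r; last first.
  by move=> i /negbTE->; rewrite rmorph0 mul0r.
have -> : \sum_i iota (a ord0 i) * v i =
          \sum_i iota (a ord0 i) * (v i - \sum_j iota (c i j) * w j).
  under [RHS]eq_bigr => i _ do rewrite mulrBr mulr_sumr.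
  rewrite sumrB exchange_big /= [X in _ - X]big1 ?subr0 // => j _.
  under eq_bigr => i _ do rewrite mulrA -rmorphM.
  by rewrite -mulr_suml -rmorph_sum ac rmorph0 mul0r.
by apply: subsp_sum => // i _; apply: PZ.
Qed.

Lemma has_dim_le P S (I : finType) (v : I -> F) n :
  has_dim cst P S n -> lind P v -> (forall i, S (v i)) -> (#|I| <= n)%N.
Proof. by case=> _ Hn Hv Sv; have [e [<- [Se He]]] := lind_indep Hv Sv; apply: Hn. Qed.

(** A maximal independent sequence spans: an element outside its span could be adjoined to it. *)
Lemma has_dim_basis P S n : subsp P -> (forall a b, S a -> S b -> S (a - b)) ->
  (forall c a, S a -> S (iota c * a)) -> has_dim cst P S n ->
  exists w : 'I_n -> F, [/\ forall i, S (w i), lind P w &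
    forall z, S z -> exists c : 'I_n -> k, P (z - \sum_i iota (c i) * w i)].
Proof.
move=> sP SB SZ [[e [<- [Se He]]] Hmax].
have He' := indep_lind He.
exists (fun i => e`_i); split=> // [i|z Sz]; first by apply: Se; rewrite mem_nth.
case: (boolp.pselect (exists c : 'I_(size e) -> k, P (z - \sum_i iota (c i) * e`_i))) => // nP.
pose v (i : 'I_(size e).+1) := oapp (fun j : 'I_(size e) => e`_j) z (unlift ord0 i).
have Hv : lind P v.
  move=> c; rewrite big_ord_recl /v /= unlift_none /=.
  under eq_bigr => i _ do rewrite liftK /=.
  move=> Pc; have cN : c ord0 = 0.
    apply/eqP/negPn/negP => cN; apply: nP.
    exists (fun i => - (c ord0)^-1 * c (lift ord0 i)).
    have [_ _ PZ] := sP; have := PZ (c ord0)^-1 _ Pc; congr P.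
    rewrite mulrDr mulrA -rmorphM mulVf // rmorph1 mul1r; congr (_ + _).
    rewrite mulr_sumr -sumrN; apply: eq_bigr => i _.
    by rewrite !rmorphM rmorphN mulrA !mulNr opprK.
  rewrite cN rmorph0 mul0r add0r in Pc.
  by move=> i; case: (unliftP ord0 i) => [j|] -> //; apply: (He' (fun j => c (lift ord0 j))).
have := has_dim_le (conj (ex_intro _ e (conj erefl (conj Se He))) Hmax) Hv.
rewrite card_ord ltnn => H; have : false; last by [].
by apply: H => i; rewrite /v; case: (unlift ord0 i) => [j|] //=; apply: Se; rewrite mem_nth.
Qed.

Lemma basis_has_dim P S (I : finType) (v : I -> F) : subsp P -> lind P v -> (forall i, S (v i)) ->
  (forall z, S z -> exists c : I -> k, P (z - \sum_i iota (c i) * v i)) -> has_dim cst P S #|I|.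
Proof.
move=> sP Hv Sv Hs; split; first exact: lind_indep Hv Sv.
move=> e Se /indep_lind He; rewrite -[size e]card_ord; apply: (steinitz (w := v) sP He) => i.
by apply: Hs; apply: Se; rewrite mem_nth.
Qed.

Lemma has_dim_bounded P S B :
  (forall n (v : 'I_n -> F), lind P v -> (forall i, S (v i)) -> (n <= B)%N) ->
  exists n, has_dim cst P S n.
Proof.
move=> HB.
pose Q n := boolp.asbool (exists e, size e = n /\ (forall z, z \in e -> S z) /\ indep_mod cst P e).
have Q0 : exists n, Q n.
  exists 0%N; apply/boolp.asboolP; exists [::]; split=> //; split=> // c /size0nil -> _ _ a.
  by rewrite in_nil.
have QB n : Q n -> (n <= B)%N.
  move=> /boolp.asboolP [e [<- [Se /indep_lind He]]]; apply: HB He _ => i.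
  by apply: Se; rewrite mem_nth.
case: (ex_maxnP Q0 QB) => n /boolp.asboolP Qn nmax; exists n; split=> // e Se He.
by apply: nmax; apply/boolp.asboolP; exists e.
Qed.

End Lin.

(** * Valuation rings *)

Lemma size_mul_bound (R : nzRingType) (p q : {poly R}) m n :
  (size p <= m.+1)%N -> (size q <= n.+1)%N -> (size (p * q)%R <= (m + n).+1)%N.
Proof. by move=> Hp Hq; have := size_polyMleq p q; lia. Qed.

Lemma size_exp_bound (R : nzRingType) (p : {poly R}) d n :
  (size p <= d.+1)%N -> (size (p ^+ n)%R <= (d * n).+1)%N.
Proof.
move=> Hp; elim: n => [|n IH]; first by rewrite expr0 size_poly1.
by rewrite exprS mulnS; apply: size_mul_bound.
Qed.

Section ValuationRings.
Variables (k F : fieldType) (iota : {rmorphism k -> F}).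

(** Subalgebras in general, because [count_bound] is also applied to finite intersections of
    valuation rings, and Zorn's lemma to subrings. *)
Definition algring (R : F -> Prop) :=
  [/\ forall c, R (iota c), forall a b, R a -> R b -> R (a + b) & forall a b, R a -> R b -> R (a * b)].

(** Discreteness is left out; for function fields it is recovered in [uniformizer_exists]. *)
Definition vring (O : F -> Prop) :=
  [/\ algring O, forall z, O z \/ O z^-1 & exists z, ~ O z].

Lemma place_vring O : is_place (cst iota) O -> vring O.
Proof.
move=> [HK [O1 [HOp [Hinv [Hne _]]]]]; split=> //.
  split=> [c|a b Oa Ob|a b Oa Ob]; first by apply: HK; exists c.
    by case: (HOp _ _ Oa Ob).
  by case: (HOp _ _ Oa Ob) => _ [].
move=> z; have [->|/Hinv //] := eqVneq z 0; left.
by rewrite -(rmorph0 iota); apply: HK; exists 0.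
Qed.

Section Ring.
Variables (R : F -> Prop) (HR : algring R).

Lemma algring0 : R 0. Proof. by have [/(_ 0)] := HR; rewrite rmorph0. Qed.
Lemma algring1 : R 1. Proof. by have [/(_ 1)] := HR; rewrite rmorph1. Qed.
Lemma algringC c : R (iota c). Proof. by case: HR. Qed.
Lemma algringD a b : R a -> R b -> R (a + b). Proof. by case: HR => _ + _; apply. Qed.
Lemma algringM a b : R a -> R b -> R (a * b). Proof. by case: HR => _ _; apply. Qed.
Lemma algringN a : R a -> R (- a).
Proof. by move=> Ra; rewrite -mulN1r -(rmorphN1 iota); apply: algringM => //; apply: algringC. Qed.
Lemma algringB a b : R a -> R b -> R (a - b).
Proof. by move=> Ra Rb; apply: algringD => //; apply: algringN. Qed.
Lemma algringX a n : R a -> R (a ^+ n).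
Proof. by move=> Ra; elim: n => [|n IH]; rewrite ?expr0 ?exprS; [apply: algring1|apply: algringM]. Qed.
Lemma algring_sum (I : Type) (r : seq I) (Q : pred I) (f : I -> F) :
  (forall i, Q i -> R (f i)) -> R (\sum_(i <- r | Q i) f i).
Proof. by move=> Rf; elim/big_rec: _ => [|i z Qi]; [apply: algring0|apply: algringD; apply: Rf]. Qed.
Lemma algring_prod (I : Type) (r : seq I) (Q : pred I) (f : I -> F) :
  (forall i, Q i -> R (f i)) -> R (\prod_(i <- r | Q i) f i).
Proof. by move=> Rf; elim/big_rec: _ => [|i z Qi]; [apply: algring1|apply: algringM; apply: Rf]. Qed.
Lemma algring_subsp_mul h : subsp iota (fun z => R (z * h)).
Proof.
split=> [|a b|c a]; rewrite ?mul0r ?mulrDl -?mulrA; first exact: algring0.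
- exact: algringD.
- by apply: algringM; apply: algringC.
Qed.
End Ring.

Section VRing.
Variables (O : F -> Prop) (HO : vring O).

Lemma vring_ring : algring O. Proof. by case: HO. Qed.
Local Notation RO := vring_ring.

Lemma vring_inv z : ~ O z -> O z^-1. Proof. by case: HO => _ /(_ z) []. Qed.

(** The instance of integral closedness that suffices for radicals: if z is not in O then 1/z is,
    and z = z^(n+1) (1/z)^n. *)
Lemma vring_X z n : (0 < n)%N -> O (z ^+ n) -> O z.
Proof.
case: n => // n _ Oz; case: (boolp.pselect (O z)) => // /[dup] nOz /vring_inv Ozi.
have [z0|z0] := eqVneq z 0; first by case: nOz; rewrite z0; apply: (algring0 RO).
have -> : z = z ^+ n.+1 * z^-1 ^+ n by rewrite exprS exprVn mulfK // expf_neq0.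
by apply: (algringM RO) => //; apply: (algringX RO).
Qed.

Lemma maxideal0 : maxideal O 0.
Proof. by split; [apply: (algring0 RO)|left]. Qed.

Lemma maxidealVP z : z != 0 -> (maxideal O z <-> ~ O z^-1).
Proof.
move=> z0; split=> [[_ [/eqP|//]]|nO]; first by rewrite (negbTE z0).
by split; [rewrite -[z]invrK; apply: vring_inv|right].
Qed.

Lemma maxidealV z : ~ O z -> maxideal O z^-1.
Proof.
move=> nO; apply/maxidealVP; rewrite ?invrK // invr_eq0; apply/eqP => z0.
by apply: nO; rewrite z0; apply: (algring0 RO).
Qed.

Lemma maxidealP z : maxideal O z \/ O z^-1.
Proof.
have [->|z0] := eqVneq z 0; first by left; apply: maxideal0.
by case: (boolp.pselect (O z^-1)); [right|left; apply/maxidealVP].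
Qed.

Lemma maxideal_nunit z : z != 0 -> O z^-1 -> ~ maxideal O z.
Proof. by move=> z0 Oz /(maxidealVP z0). Qed.

Lemma maxideal_ring z : maxideal O z -> O z. Proof. by case. Qed.

Lemma maxidealMr a b : maxideal O a -> O b -> maxideal O (a * b).
Proof.
move=> ma Ob; have [->|a0] := eqVneq a 0; first by rewrite mul0r; apply: maxideal0.
have [->|b0] := eqVneq b 0; first by rewrite mulr0; apply: maxideal0.
apply/maxidealVP; first by rewrite mulf_neq0.
move=> H; case/(maxidealVP a0): ma.
have -> : a^-1 = b * (a * b)^-1 by rewrite invfM mulrC mulfVK.
exact: (algringM RO).
Qed.

Lemma maxidealMl a b : O a -> maxideal O b -> maxideal O (a * b).
Proof. by move=> Oa mb; rewrite mulrC; apply: maxidealMr. Qed.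

Lemma maxideal_1 : ~ maxideal O 1.
Proof. by apply: maxideal_nunit; rewrite ?oner_eq0 ?invr1 //; apply: (algring1 RO). Qed.

Lemma maxidealD a b : maxideal O a -> maxideal O b -> maxideal O (a + b).
Proof.
move=> ma mb.
have [->|a0] := eqVneq a 0; first by rewrite add0r.
have [->|b0] := eqVneq b 0; first by rewrite addr0.
case: (boolp.pselect (O (a / b))) => [Oab|/vring_inv Oba].
  have -> : a + b = (a / b + 1) * b by rewrite mulrDl mulfVK // mul1r.
  by apply: maxidealMl => //; apply: (algringD RO) => //; apply: (algring1 RO).
have -> : a + b = a * (1 + (a / b)^-1) by rewrite invf_div mulrDr mulr1 mulrC mulfVK // mulrC.
by apply: maxidealMr => //; apply: (algringD RO) => //; apply: (algring1 RO).
Qed.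

Lemma maxideal_subsp : subsp iota (maxideal O).
Proof.
split; [exact: maxideal0|exact: maxidealD|move=> c a; apply: maxidealMl].
exact: (algringC RO).
Qed.

Lemma maxideal_sum (I : Type) (r : seq I) (Q : pred I) (f : I -> F) :
  (forall i, Q i -> maxideal O (f i)) -> maxideal O (\sum_(i <- r | Q i) f i).
Proof. exact: subsp_sum maxideal_subsp. Qed.

Lemma maxidealB a b : maxideal O a -> maxideal O b -> maxideal O (a - b).
Proof. exact: subspB maxideal_subsp. Qed.

Lemma maxidealX a n : (0 < n)%N -> maxideal O a -> maxideal O (a ^+ n).
Proof.
case: n => // n _ ma; rewrite exprS; apply: maxidealMr => //.
by apply: (algringX RO); apply: maxideal_ring.
Qed.

Lemma maxideal_cst c : maxideal O (iota c) -> c = 0.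
Proof.
move=> mc; apply/eqP/negPn/negP => c0; case/maxidealVP: mc; first by rewrite fmorph_eq0.
by rewrite -fmorphV; apply: (algringC RO).
Qed.

Lemma maxideal1D a : maxideal O a -> O (1 + a)^-1 /\ 1 + a != 0.
Proof.
move=> ma.
have a0 : 1 + a != 0.
  apply/eqP => /eqP; rewrite addr_eq0 => /eqP a1; case: maxideal_1.
  by rewrite a1 -sub0r; apply: maxidealB => //; apply: maxideal0.
split=> //; case: (maxidealP (1 + a)) => // m1; case: maxideal_1.
by rewrite -(addrK a 1); apply: maxidealB.
Qed.

Lemma maxideal_prod (I : eqType) (r : seq I) (f : I -> F) : (forall i, O (f i)) ->
  maxideal O (\prod_(i <- r) f i) -> exists2 i, i \in r & maxideal O (f i).
Proof.
move=> Of; elim: r => [|j r IH]; first by rewrite big_nil => /maxideal_1.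
rewrite big_cons => m1; case: (maxidealP (f j)) => [mj|Oj].
  by exists j; rewrite ?mem_head.
have [fj0|fj0] := eqVneq (f j) 0.
  by exists j; rewrite ?mem_head // fj0; apply: maxideal0.
case: IH => [|i ir mi]; last by exists i; rewrite // in_cons ir orbT.
by have := maxidealMl Oj m1; rewrite mulKf.
Qed.

(* [s 0] is the element of smallest absolute value. *)
Lemma chain_lt (s : nat -> F) M : (forall i, (i <= M)%N -> s i != 0) ->
  (forall i, (i < M)%N -> maxideal O (s i / s i.+1)) ->
  forall i j, (i < j)%N -> (j <= M)%N -> maxideal O (s i / s j).
Proof.
move=> s0 sm i; elim=> // j IH; rewrite ltnS leq_eqVlt => /orP [/eqP->|ij] jM; first exact: sm.
have -> : s i / s j.+1 = (s i / s j) * (s j / s j.+1).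
  by rewrite mulrA mulfVK // s0 // ltnW.
by apply: maxidealMr; [apply: IH => //; apply: ltnW|apply: maxideal_ring; apply: sm].
Qed.

(** The absolute values of the [s i] strictly increase with [i]. Dividing a relation by its largest
    surviving term leaves a constant that lies in the maximal ideal, hence is 0; so coefficients
    vanish from the top down. *)
Lemma chain_lind (s : nat -> F) M : (forall i, (i <= M)%N -> s i != 0) ->
  (forall i, (i < M)%N -> maxideal O (s i / s i.+1)) ->
  lind iota (fun y => O (y / s 0%N)) (fun i : 'I_M => s i.+1).
Proof.
move=> s0 sm; have slt := chain_lt s0 sm => c Oc.
suff H n : forall i : 'I_M, (M - n <= i)%N -> c i = 0 by move=> i; apply: (H M); rewrite subnn.
elim: n => [|n IH] i; first by rewrite subn0 leqNgt ltn_ord.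
have [/IH //|in1 in2] := leqP (M - n) i.
apply: maxideal_cst.
have iM : (i.+1 <= M)%N by [].
have -> : iota (c i) = (\sum_j iota (c j) * s j.+1) / s 0%N * (s 0%N / s i.+1)
    - \sum_(j | j != i) iota (c j) * s j.+1 / s i.+1.
  rewrite mulrA mulfVK ?s0 // mulr_suml (bigD1 i) //= mulfK ?s0 //.
  by rewrite addrK.
apply: maxidealB; first by apply: maxidealMl => //; apply: slt.
apply: maxideal_sum => j ji; rewrite -mulrA.
have [ij|ij] := ltnP i j.
  by rewrite (IH j) ?rmorph0 ?mul0r; [apply: maxideal0|lia].
by apply: maxidealMl; [apply: (algringC RO)|apply: slt; rewrite // ltnS ltn_neqAle ij andbT].
Qed.

End VRing.
End ValuationRings.

(** * Places of a finite extension of k(x) *)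

Lemma sum_pair (R : nmodType) (I J : finType) (G : I * J -> R) :
  \sum_u G u = \sum_i \sum_j G (i, j).
Proof. by rewrite pair_bigA; apply: eq_bigr => -[]. Qed.

Definition ev (k F : fieldType) (iota : {rmorphism k -> F}) (x : F) (p : {poly k}) : F :=
  (map_poly iota p).[x].
Arguments ev : simpl never.

HB.instance Definition _ (k F : fieldType) (iota : {rmorphism k -> F}) (x : F) :=
  GRing.RMorphism.copy (ev iota x) (horner_eval x \o map_poly iota).

Section FunctionField.
Variables (k F : fieldType) (iota : {rmorphism k -> F}) (x : F) (T : finType) (w : T -> F).
Hypothesis x_tr : transcendental_over iota x.
Hypothesis w_span : forall z, exists (b : {poly k}) (a : T -> {poly k}),
  b != 0 /\ z * ev iota x b = \sum_i ev iota x (a i) * w i.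
(** Replaces integral dependence: a valuation ring containing k(x) contains each [w i] by
    [vring_X]. *)
Hypothesis w_pow : forall i, exists n (a b : {poly k}), [/\ (0 < n)%N, b != 0 & w i ^+ n * ev iota x b = ev iota x a].

Local Notation ev := (ev iota x).
Local Notation vring := (vring iota).

Lemma ev_eq0 p : (ev p == 0) = (p == 0).
Proof. by apply/eqP/eqP => [/x_tr|->]; rewrite ?rmorph0. Qed.

Lemma evC c : ev c%:P = iota c.
Proof. by rewrite /ev map_polyC hornerC. Qed.

Lemma evX : ev 'X = x.
Proof. by rewrite /ev map_polyX hornerX. Qed.

Lemma evE (p : {poly k}) n : (size p <= n)%N -> ev p = \sum_(i < n) iota p`_i * x ^+ i.
Proof.
move=> sp; rewrite /ev (@horner_coef_wide _ n) ?size_map_poly //.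
by apply: eq_bigr => i _; rewrite coef_map.
Qed.

Lemma ev_ring R p : algring iota R -> R x -> R (ev p).
Proof.
move=> HR Rx; rewrite (evE (leqnn _)); apply: (algring_sum HR) => i _.
by apply: (algringM HR); [apply: (algringC HR)|apply: (algringX HR)].
Qed.

(** For nonconstant h this bounds [k(x) : k(h)] by [d], so [#|T| * d] bounds [F : k(h)], the degree
    of the pole divisor of h. *)
Definition ratx (h : F) (d : nat) :=
  exists A B : {poly k}, [/\ B != 0, (size A <= d.+1)%N, (size B <= d.+1)%N & h * ev B = ev A].

Lemma common_denominator (I : finType) (z : I -> F) :
  exists (b : {poly k}) (a : I -> T -> {poly k}), b != 0 /\ forall i, z i * ev b = \sum_t ev (a i t) * w t.
Proof.
have /boolp.choice [b /boolp.choice [a Hab]] := fun i => w_span (z i).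
exists (\prod_i b i), (fun i t => a i t * \prod_(j | j != i) b j); split.
  by apply/prodf_neq0 => i _; case: (Hab i).
move=> i; rewrite (bigD1 i) //= rmorphM mulrA; have [_ ->] := Hab i.
by rewrite mulr_suml; apply: eq_bigr => t _; rewrite rmorphM mulrAC.
Qed.

(* The elements [z i * h ^+ l], l < L, are independent over k and lie in a space of dimension
   #|T| * (C + D L + 1); let L tend to infinity. *)
Lemma count_bound R h D (I : finType) (z : I -> F) : algring iota R -> h != 0 -> R h^-1 -> ratx h D ->
  (forall i, R (z i)) -> lind iota (fun y => R (y * h)) z -> (#|I| <= #|T| * D)%N.
Proof.
move=> HR h0 Rh [A [B [B0 sA sB hB]]] Rz Hz.
have [b [a [b0 zb]]] := common_denominator z.
pose C := (\max_i \max_t size (a i t))%N.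
have sa i t : (size (a i t) <= C.+1)%N.
  by apply: leqW; apply: leq_trans (leq_bigmax i); apply: (leq_bigmax (F := fun t => size (a i t)) t).
have key L : (#|I| * L <= #|T| * (C + D * L).+1)%N.
  have -> : (#|I| * L)%N = #|{: I * 'I_L}| by rewrite card_prod card_ord.
  have -> : (#|T| * (C + D * L).+1)%N = #|{: T * 'I_(C + D * L).+1}| by rewrite card_prod card_ord.
  have eB : ev B != 0 by rewrite ev_eq0.
  have eb : ev b != 0 by rewrite ev_eq0.
  apply: (@steinitz _ _ iota (fun y => y = 0) (I * 'I_L)%type (T * 'I_(C + D * L).+1)%type (fun u => z u.1 * h ^+ u.2)
     (fun v => ev 'X^(v.2) * w v.1 / (ev b * ev B ^+ L))); first exact: subsp0.
  - move=> c; rewrite sum_pair exchange_big /= => Hc.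
    (* Descending induction on the power of h. After division by h^(l-1) the lower powers contribute
       elements of R, and the coefficients of the higher ones are already 0. *)
    suff H n : forall (l : 'I_L), (L - n <= l)%N -> forall i, c (i, l) = 0.
      by case=> i l; apply: (H L); rewrite subnn.
    elim: n => [|n IH] l; first by rewrite subn0 leqNgt ltn_ord.
    have [/IH //|ln1 ln2] := leqP (L - n) l.
    apply: Hz; have -> : (\sum_i iota (c (i, l)) * z i) * h =
        - \sum_(l' < L | l' != l) \sum_i iota (c (i, l')) * (z i * h ^+ l') / h ^+ l * h.
      under [in RHS]eq_bigr => l' _ do rewrite -!mulr_suml.
      rewrite -!mulr_suml; move/eqP: Hc; rewrite (bigD1 l) //= addrC addr_eq0 => /eqP->.
      rewrite !mulNr opprK; congr (_ * _); rewrite mulr_suml; apply: eq_bigr => i _.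
      by rewrite mulrA mulfK // expf_neq0.
    apply: (algringN HR); apply: (algring_sum HR) => l' l'l; apply: (algring_sum HR) => i _.
    have [ll'|ll'] := ltnP l l'.
      by rewrite (IH l') ?rmorph0 ?mul0r; [apply: algring0 HR|lia].
    have {}ll' : (l' < l)%N by rewrite ltn_neqAle ll' andbT.
    rewrite -!mulrA; apply: (algringM HR); first exact: (algringC HR).
    apply: (algringM HR) => //.
    have -> : h ^+ l' * (h ^- l * h) = h^-1 ^+ (l - l').-1.
      have : nat_of_ord l = (l' + (l - l').-1.+1)%N by lia.
      move: (l - l').-1 => m ->; rewrite exprD exprS exprVn.
      by field; rewrite h0 !expf_neq0.
    exact: (algringX HR).
  (* Over the common denominator b B^L, the element z_i h^l has the numerators a_it A^l B^(L-l), of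
     degree at most C + D L. *)
  - case=> i l; exists (fun v : T * 'I_(C + D * L).+1 => (a i v.1 * (A ^+ l * B ^+ (L - l)))`_(v.2)) => /=.
    apply/eqP; rewrite subr_eq0; apply/eqP.
    apply: (mulIf (mulf_neq0 eb (expf_neq0 L eB))).
    rewrite [RHS]mulr_suml.
    rewrite sum_pair /=.
    have -> : z i * h ^+ l * (ev b * ev B ^+ L) =
       \sum_t ev (a i t * (A ^+ l * B ^+ (L - l))) * w t.
      have -> : ev B ^+ L = ev B ^+ l * ev B ^+ (L - l) by rewrite -exprD subnKC // ltnW.
      rewrite mulrACA zb [h ^+ l * _]mulrA -exprMn hB mulr_suml; apply: eq_bigr => t _.
      by rewrite rmorphM mulrAC rmorphM !rmorphXn.
    apply: eq_bigr => t _; rewrite (@evE _ (C + D * L).+1); last first.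
      apply: size_mul_bound => //.
      have -> : (D * L = D * l + D * (L - l))%N by rewrite -mulnDr subnKC // ltnW.
      by apply: size_mul_bound; apply: size_exp_bound.
    rewrite mulr_suml; apply: eq_bigr => s _.
    rewrite -[RHS]mulrA mulfVK ?mulf_neq0 ?expf_neq0 // rmorphXn /= evX.
    by rewrite [RHS]mulrA.
(* If |I| > |T| D, the count forces L <= |T| (C + 1); the next integer contradicts this. *)
rewrite leqNgt; apply/negP => lt; have := key (#|T| * C.+1).+1; nia.
Qed.

(** If O contained k(x), it would contain the [w i] by [vring_X], and then all of F. *)
Lemma vring_pole O : vring O -> exists h d, ratx h d /\ ~ O h.
Proof.
move=> HO; have RO := vring_ring HO; apply: boolp.contrapT => nex.
have Oh h d : ratx h d -> O h.
  by move=> Hh; apply: boolp.contrapT => nO; apply: nex; exists h, d.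
have Oab a b : b != 0 -> O (ev a / ev b).
  move=> b0; apply: (Oh _ (maxn (size a) (size b))); exists a, b.
  by rewrite mulfVK ?ev_eq0 // b0 !leqW // ?leq_maxl ?leq_maxr.
have Ow i : O (w i).
  have [n [a [b [n0 b0 wab]]]] := w_pow i; apply: (vring_X HO n0).
  have -> : w i ^+ n = ev a / ev b by rewrite -wab mulfK // ev_eq0.
  exact: Oab.
have [_ _ [z []]] := HO; have [b [a [b0 zb]]] := w_span z.
have -> : z = \sum_i ev (a i) / ev b * w i.
  under eq_bigr => i _ do rewrite mulrAC.
  by rewrite -mulr_suml -zb mulfK // ev_eq0.
by apply: (algring_sum RO) => i _; apply: (algringM RO); [exact: Oab|exact: Ow].
Qed.

(** Starting the chain at 1/h gives independence modulo h^-1 O, the form that [count_bound]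
    takes. *)
Lemma chain_bound O h D (s : nat -> F) M : vring O -> ratx h D -> h != 0 -> s 0%N = h^-1 ->
  (forall i, (i <= M)%N -> s i != 0) -> (forall i, (i <= M)%N -> O (s i)) ->
  (forall i, (i < M)%N -> maxideal O (s i / s i.+1)) -> (M <= #|T| * D)%N.
Proof.
move=> HO Hh h0 sh s0 Os sm; rewrite -[M]card_ord.
apply: (@count_bound O h D _ (fun i : 'I_M => s i.+1)) => //.
- exact: vring_ring HO.
- by rewrite -sh; apply: Os.
- by move=> i; apply: Os.
- have := chain_lind HO s0 sm; rewrite sh invrK; exact.
Qed.

(** Without a uniformizer, each nonzero element of the maximal ideal is followed by one of strictly
    larger absolute value. Iterating from 1/h builds a chain longer than [chain_bound] allows. *)
Lemma uniformizer_exists O : vring O -> exists t, uniformizer O t.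
Proof.
move=> HO; have RO := vring_ring HO; have [h [D [Hh nOh]]] := vring_pole HO.
have h0 : h != 0 by apply/eqP => E; apply: nOh; rewrite E; apply: algring0 RO.
apply: boolp.contrapT => nex.
have Hnx t : exists z, t != 0 -> maxideal O t -> maxideal O z /\ ~ O (z / t).
  have [t0|t0] := eqVneq t 0; first by exists 0; rewrite t0.
  case: (boolp.pselect (maxideal O t)) => mt; last by exists 0.
  apply: boolp.contrapT => nz; apply: nex; exists t; split=> //; split=> // z mz.
  by apply: boolp.contrapT => nO; apply: nz; exists z.
have [nx Hn] := boolp.choice Hnx.
pose s i := iter i nx h^-1.
have Hs i : s i != 0 /\ maxideal O (s i).
  elim: i => [|i [s0 ms]]; first by split; rewrite /s /= ?invr_eq0 //; apply: maxidealV HO _ _.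
  have [mz nO] := Hn _ s0 ms; split=> //=; apply/eqP => E; apply: nO; rewrite /s /= in E; rewrite E mul0r.
  exact: algring0 RO.
suff : ((#|T| * D).+1 <= #|T| * D)%N by rewrite ltnn.
apply: (@chain_bound O h D s) => // i _; try by case: (Hs i).
- by apply: maxideal_ring; case: (Hs i).
- have [s0 ms] := Hs i; have [_ nO] := Hn _ s0 ms.
  by have := maxidealV HO nO; rewrite invf_div.
Qed.

Lemma vring_place O : vring O <-> is_place (cst iota) O.
Proof.
split=> [HO|]; last exact: place_vring.
have RO := vring_ring HO; split=> [_ [c ->]|]; first exact: (algringC RO).
split; first exact: algring1 RO.
split; first by move=> a b Oa Ob; split; [apply: (algringD RO)|split; [apply: (algringN RO)|apply: (algringM RO)]].
split; first by move=> z _; case: HO.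
by split; [case: HO|apply: uniformizer_exists].
Qed.

Section Place.
Variables (O : F -> Prop) (HO : vring O) (t : F) (Ht : uniformizer O t).

Lemma uniformizer_neq0 : t != 0. Proof. by case: Ht. Qed.
Lemma uniformizer_max : maxideal O t. Proof. by case: Ht => _ []. Qed.
Lemma uniformizer_ring : O t. Proof. exact: maxideal_ring uniformizer_max. Qed.
Lemma uniformizer_div z : maxideal O z -> O (z / t).
Proof. by case: Ht => _ [_]; apply. Qed.

(** If no power of t cleared the pole of c, then 1/c, t^(M-1), ..., t, 1 would be a chain too long
    for [chain_bound]. *)
Lemma uniformizer_ratx c d : ratx c d -> exists n, O (t ^+ n * c).
Proof.
have RO := vring_ring HO; move=> Hc.
apply: boolp.contrapT => nex.
have nO n : ~ O (t ^+ n * c) by move=> H; apply: nex; exists n.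
have c0 : c != 0 by apply/eqP => E; apply: (nO 0%N); rewrite E mulr0; apply: algring0 RO.
pose M := (#|T| * d).+1.
pose s i := if i is 0%N then c^-1 else t ^+ (M - i).
suff : (M <= #|T| * d)%N by rewrite /M ltnn.
have t0 := uniformizer_neq0.
apply: (@chain_bound O c d s) => // [[|i] _|[|i] _|[|i] iM] //=.
- by rewrite invr_eq0.
- by rewrite expf_neq0.
- by apply: (vring_inv HO); have := nO 0%N; rewrite expr0 mul1r.
- by apply: (algringX RO); apply: uniformizer_ring.
- have := maxidealV HO (nO (M - 1)%N); rewrite invfM mulrC; exact.
- have -> : (M - i.+1 = (M - i.+2).+1)%N by lia.
  by rewrite exprS mulfK ?expf_neq0 //; apply: uniformizer_max.
Qed.

Lemma uniformizer_arch z : exists n, O (t ^+ n * z).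
Proof.
have RO := vring_ring HO.
have up n m z' : (n <= m)%N -> O (t ^+ n * z') -> O (t ^+ m * z').
  move=> nm On; rewrite -(subnK nm) exprD -mulrA.
  by apply: (algringM RO) => //; apply: (algringX RO); apply: uniformizer_ring.
have Hw i : exists n, O (t ^+ n * w i).
  have [n [a [b [n0 b0 wab]]]] := w_pow i.
  have [] := @uniformizer_ratx (w i ^+ n) (maxn (size a) (size b)).
    by exists a, b; rewrite wab b0 !leqW // ?leq_maxl ?leq_maxr.
  move=> m /(@up _ (m * n)%N) H; exists m; apply: (vring_X HO n0).
  by rewrite exprMn -exprM; apply: H; rewrite leq_pmulr.
have [b [a [b0 zb]]] := w_span z.
have Ha i : exists n, O (t ^+ n * (ev (a i) / ev b)).
  apply: (@uniformizer_ratx _ (maxn (size (a i)) (size b))); exists (a i), b.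
  by rewrite mulfVK ?ev_eq0 // b0 !leqW // ?leq_maxl ?leq_maxr.
have [n Hn] := boolp.choice Hw; have [m Hm] := boolp.choice Ha.
exists (\max_i (n i + m i))%N.
have -> : z = \sum_i ev (a i) / ev b * w i.
  under eq_bigr => i _ do rewrite mulrAC.
  by rewrite -mulr_suml -zb mulfK // ev_eq0.
rewrite mulr_sumr; apply: (algring_sum RO) => i _.
apply: (@up (n i + m i)%N); first exact: leq_bigmax.
by rewrite exprD [t ^+ n i * _]mulrC mulrACA; apply: (algringM RO).
Qed.

Lemma uniformizer_exp_unit (n : int) : O (t ^ n) -> 0 <= n.
Proof.
case: n => // n; rewrite NegzE -exprnN => Ot.
case: (maxideal_nunit HO (expf_neq0 n.+1 uniformizer_neq0) Ot).
exact: (maxidealX HO) uniformizer_max.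
Qed.

Lemma uniformizer_exp_ring (n : int) : 0 <= n -> O (t ^ n).
Proof.
have RO := vring_ring HO.
by case: n => // n _; apply: (algringX RO); apply: uniformizer_ring.
Qed.

Lemma uniformizer_ord z : z != 0 -> exists n : int, O (z * t ^ (- n)) /\ O (z * t ^ (- n))^-1.
Proof.
move=> z0; have RO := vring_ring HO; have t0 := uniformizer_neq0.
have [p Op] := uniformizer_arch z; have [q Oq] := uniformizer_arch z^-1.
(* The order of z is sought as n - p: the shift by p, which clears the pole of z, makes n a natural
   number, and q, which clears the pole of 1/z, bounds it. *)
pose Q n := boolp.asbool (O (z * t ^ (p%:Z - n%:Z))).
have Q0 : exists n, Q n by exists 0%N; apply/boolp.asboolP; rewrite subr0 mulrC.
have QB n : Q n -> (n <= p + q)%N.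
  move/boolp.asboolP => Oz; have := algringM RO Oz Oq.
  have -> : z * t ^ (p%:Z - n%:Z) * (t ^+ q * z^-1) = t ^ (p%:Z - n%:Z + q%:Z).
    by rewrite [t ^+ q * _]mulrC mulrACA mulfV // mul1r [RHS]expfzDr.
  by move/uniformizer_exp_unit; lia.
case: (ex_maxnP Q0 QB) => n /boolp.asboolP On nmax.
exists (n%:Z - p%:Z); rewrite opprB; split=> //.
case: (maxidealP HO (z * t ^ (p%:Z - n%:Z))) => // /uniformizer_div H.
suff /nmax : Q n.+1 by rewrite ltnn.
apply/boolp.asboolP; move: H; rewrite -mulrA -[t^-1]/(t ^ (-1)) -expfzDr //.
by have -> : p%:Z - n%:Z + -1 = p%:Z - n.+1%:Z by lia.
Qed.

Lemma pole_order h : ~ O h -> exists2 e : nat, (0 < e)%N & O (h * t ^+ e) /\ O (h * t ^+ e)^-1.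
Proof.
move=> nh; have RO := vring_ring HO; have t0 := uniformizer_neq0.
have h0 : h != 0 by apply/eqP => E; apply: nh; rewrite E; apply: (algring0 RO).
have [n [On On']] := uniformizer_ord h0.
case: n On On' => n On On'; last by exists n.+1; rewrite // NegzE opprK in On On'.
case: nh; have := algringM RO On (algringX RO n uniformizer_ring).
by rewrite -mulrA -exprnN mulVf ?mulr1 // expf_neq0.
Qed.

Lemma unit_exp u (n : int) : u != 0 -> O u^-1 -> O u -> (O (u * t ^ n) <-> 0 <= n).
Proof.
move=> u0 Ou Ou'; have RO := vring_ring HO; split=> [H|/uniformizer_exp_ring H].
  by apply: uniformizer_exp_unit; have := algringM RO Ou H; rewrite mulKf.
exact: (algringM RO).
Qed.

End Place.

(** [ord] brings its own uniformizer; it differs from the fixed [t] by a unit, so orders become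
    membership conditions in terms of [t]. *)
Lemma ord_ge O t z (v n : int) : vring O -> uniformizer O t -> ord O z v ->
  (O (z * t ^ (- n)) <-> n <= v).
Proof.
move=> HO Ht [z0 [t' [Ht' [Ov Ov']]]]; have RO := vring_ring HO.
have t0 := uniformizer_neq0 Ht; have t'0 := uniformizer_neq0 Ht'.
have tt' : O (t / t') by apply: (uniformizer_div Ht'); apply: uniformizer_max Ht.
have t't : O (t' / t) by apply: (uniformizer_div Ht); apply: uniformizer_max Ht'.
have expO (a b : F) : a != 0 -> O (a / b) -> O (b / a) -> forall m : int, O ((a / b) ^ m).
  move=> a0 Oab Oba [] m; first exact: (algringX RO).
  by rewrite NegzE -exprnN -exprVn invf_div; apply: (algringX RO).
have -> : z * t ^ (- n) = z * t' ^ (- v) * (t' / t) ^ v * t ^ (v - n).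
  rewrite expfzMl exprz_inv [t ^ (v - n)]expfzDr // -[t ^ (- v)]invr_expz -[t' ^ (- v)]invr_expz.
  by field; rewrite !expfz_neq0.
rewrite (unit_exp HO Ht); first by rewrite subr_ge0.
- by rewrite mulf_neq0 ?expfz_neq0 ?mulf_neq0 ?expfz_neq0 ?invr_neq0.
- rewrite invfM; apply: (algringM RO) => //.
  by rewrite invr_expz -exprz_inv invf_div; apply: expO.
- by apply: (algringM RO) => //; apply: expO.
Qed.

End FunctionField.

(** * Weak approximation and the inequality between the ramification, residue and field degrees *)

Section Approximation.
Variables (k F : fieldType) (iota : {rmorphism k -> F}) (x : F) (T : finType) (w : T -> F).
Hypothesis x_tr : transcendental_over iota x.
Hypothesis w_span : forall z, exists (b : {poly k}) (a : T -> {poly k}),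
  b != 0 /\ z * ev iota x b = \sum_i ev iota x (a i) * w i.
Hypothesis w_pow : forall i, exists n (a b : {poly k}), [/\ (0 < n)%N, b != 0 & w i ^+ n * ev iota x b = ev iota x a].

Local Notation ev := (ev iota x).
Local Notation vring := (vring iota).

(** A discrete valuation ring is a maximal proper subring: any z outside O1 generates 1/t over O1,
    and powers of 1/t clear into every element of F. *)
Lemma vring_incl O1 O2 : vring O1 -> vring O2 -> (forall z, O1 z -> O2 z) -> same_place O1 O2.
Proof.
move=> H1 H2 sub z; split=> [|O2z]; first exact: sub.
have R1 := vring_ring H1; have R2 := vring_ring H2.
apply: boolp.contrapT => nO1z.
have [t Ht] := uniformizer_exists x_tr w_span w_pow H1.
have [_ _ [y]] := H2; apply.
have [n On] := uniformizer_arch x_tr w_span w_pow H1 Ht y.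
have t0 := uniformizer_neq0 Ht.
have z0 : z != 0 by apply/eqP => E; apply: nO1z; rewrite E; apply: (algring0 R1).
have Ot : O2 t^-1.
  have /sub := uniformizer_div Ht (maxidealV H1 nO1z); move/(algringM R2 O2z).
  by rewrite mulrA mulfV // mul1r.
have -> : y = t^-1 ^+ n * (t ^+ n * y) by rewrite mulrA -exprMn mulVf // expr1n mul1r.
by apply: (algringM R2); [apply: (algringX R2)|apply: sub].
Qed.

Lemma maxideal_arch O u y : vring O -> maxideal O u ->
  exists n, forall m, (n <= m)%N -> maxideal O (u ^+ m * y).
Proof.
move=> HO mu; have RO := vring_ring HO.
have [t Ht] := uniformizer_exists x_tr w_span w_pow HO.
have [n On] := uniformizer_arch x_tr w_span w_pow HO Ht y.
exists n.+1 => m nm; rewrite -(subnK nm) exprD -mulrA.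
apply: (maxidealMl HO); first by apply: (algringX RO); case: mu.
rewrite exprS -mulrA; apply: (maxidealMr HO) => //.
have -> : u ^+ n * y = (u / t) ^+ n * (t ^+ n * y).
  by rewrite mulrA -exprMn mulfVK // (uniformizer_neq0 Ht).
by apply: (algringM RO) => //; apply: (algringX RO); apply: (uniformizer_div Ht).
Qed.

Lemma vring_mul_nring O a b : vring O -> ~ O a -> ~ O b -> ~ O (a * b).
Proof.
move=> HO na nb Oab; have RO := vring_ring HO.
have nz c : ~ O c -> c != 0.
  by move=> nc; apply/eqP => E; apply: nc; rewrite E; apply: (algring0 RO).
apply: (maxideal_1 HO); have := maxidealMr HO (maxidealMr HO (maxidealV HO na) (vring_inv HO nb)) Oab.
by rewrite -invfM mulVf // mulf_neq0 // nz.
Qed.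

Lemma unit_mul_nring O a b : vring O -> a != 0 -> O a^-1 -> ~ O b -> ~ O (a * b).
Proof.
move=> HO a0 Oa nb Oab; apply: nb; have := algringM (vring_ring HO) Oa Oab.
by rewrite mulKf.
Qed.

(* [u ^+ n / (1 + u ^+ n)] tends to 1 where u has a pole and to 0 where u has a zero. *)
Lemma damp_pole O u n : vring O -> (0 < n)%N -> ~ O u ->
  let d := u ^+ n / (1 + u ^+ n) in [/\ d != 0, O d & O d^-1].
Proof.
move=> HO n0 nu; have RO := vring_ring HO.
have u0 : u != 0 by apply/eqP => E; apply: nu; rewrite E; apply: (algring0 RO).
have mu := maxidealX HO n0 (maxidealV HO nu).
have [O1 N1] := maxideal1D HO mu.
have E : 1 + u ^+ n = u ^+ n * (1 + u^-1 ^+ n).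
  by rewrite mulrDr mulr1 -exprMn mulfV // expr1n addrC.
have dE : u ^+ n / (1 + u ^+ n) = (1 + u^-1 ^+ n)^-1.
  by rewrite E invfM mulrA mulfV ?mul1r // expf_neq0.
rewrite /= dE invr_eq0 invrK; split=> //.
by apply: (algringD RO); [apply: (algring1 RO)|case: mu].
Qed.

Lemma damp_zero O u n y : vring O -> (0 < n)%N -> maxideal O u -> maxideal O (u ^+ n * y) ->
  maxideal O (u ^+ n / (1 + u ^+ n) * y).
Proof.
move=> HO n0 mu muy; rewrite mulrAC; apply: (maxidealMr HO) => //.
by have [] := maxideal1D HO (maxidealX HO n0 mu).
Qed.

Section Family.
Variables (I : finType) (O : I -> F -> Prop).
Hypothesis HO : forall i, vring (O i).
Hypothesis O_distinct : forall i j, i != j -> ~ same_place (O i) (O j).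

(** Neither ring contains the other, so there are a in O_i outside O_j and b in O_j outside O_i;
    take a/b. *)
Lemma separate2 i j : i != j -> exists v, ~ O j v /\ maxideal (O i) v.
Proof.
move=> ij; have Ri := vring_ring (HO i); have Rj := vring_ring (HO j).
have nincl l m : l != m -> exists a, O l a /\ ~ O m a.
  move=> lm; apply: boolp.contrapT => nex; apply: (O_distinct lm); apply: vring_incl => // z Olz.
  by apply: boolp.contrapT => nO; apply: nex; exists z.
have [a [Oa na]] := nincl _ _ ij.
have [b [Ob nb]] : exists a, O j a /\ ~ O i a by apply: nincl; rewrite eq_sym.
have b0 : b != 0 by apply/eqP => E; apply: nb; rewrite E; apply: (algring0 Ri).
exists (a / b); split; last by apply: (maxidealMl (HO i)) => //; apply: (maxidealV (HO i)).
by move=> Oab; apply: na; have := algringM Rj Oab Ob; rewrite mulfVK.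
Qed.

Lemma maxideal_arch_family (J : finType) (u : F) (P : pred I) (y : J -> F) :
  (forall i, P i -> maxideal (O i) u) ->
  exists2 n, (0 < n)%N & forall i j, P i -> maxideal (O i) (u ^+ n * y j).
Proof.
move=> Hu.
have /boolp.choice [n Hn] (p : I * J) : exists n, P p.1 ->
    forall m, (n <= m)%N -> maxideal (O p.1) (u ^+ m * y p.2).
  case: (boolP (P p.1)) => [/Hu mu|nP]; last by exists 0%N.
  by have [n Hn] := maxideal_arch (y p.2) (HO p.1) mu; exists n.
exists (\max_p n p).+1 => // i j Pi; apply: (Hn (i, j)) => //.
by apply: leqW; apply: (leq_bigmax (F := n)).
Qed.

(** Induction on the places to be avoided. If u is integral at the new place i, a function v
    separating j from i is multiplied by a high power of u, which outweighs the poles of v at the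
    earlier places; if u has a pole at i, the damped factor u^n / (1 + u^n), a unit at both i and j,
    is used instead. *)
Lemma separate_seq j (s : seq I) : j \notin s ->
  exists u, ~ O j u /\ forall i, i \in s -> maxideal (O i) u.
Proof.
elim: s => [|i s IH]; first by have [_ _ [u nu]] := HO j; exists u.
rewrite in_cons negb_or => /andP [ji js].
have [u [nu mu]] := IH js.
have [v [nv mv]] : exists v, ~ O j v /\ maxideal (O i) v by apply: separate2; rewrite eq_sym.
have [n n0 Hn] := maxideal_arch_family (fun _ : unit => v) mu.
have u0 : u != 0 by apply/eqP => E; apply: nu; rewrite E; apply: (algring0 (vring_ring (HO j))).
case: (boolp.pselect (O i u)) => Ou.
  exists (u ^+ n * v); split.
    apply: vring_mul_nring => // H; apply: nu; exact: vring_X H.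
  move=> l; rewrite in_cons => /orP [/eqP->|ls]; last exact: (Hn l tt).
  by apply: (maxidealMl (HO i)) => //; apply: (algringX (vring_ring (HO i))).
exists (u ^+ n / (1 + u ^+ n) * v); split.
  by have [? ? ?] := damp_pole (HO j) n0 nu; apply: unit_mul_nring.
move=> l; rewrite in_cons => /orP [/eqP->|ls].
  by have [? ? ?] := damp_pole (HO i) n0 Ou; apply: (maxidealMl (HO i)).
by apply: damp_zero; [exact: HO|exact: n0|exact: mu|exact: (Hn l tt)].
Qed.

(** The form needed below: a unit at one place which is small enough at the others to outweigh the
    poles of finitely many given functions. *)
Lemma weak_approximation j (J : finType) (y : J -> F) : exists u, [/\ u != 0, O j u, O j u^-1 &
  forall i l, i != j -> maxideal (O i) (u * y l)].
Proof.
have [U [nU mU]] : exists u, ~ O j u /\ forall i, i \in rem j (enum I) -> maxideal (O i) u.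
  by apply: separate_seq; rewrite mem_rem_uniq ?enum_uniq // inE eqxx.
have {}mU i : i != j -> maxideal (O i) U.
  by move=> ij; apply: mU; rewrite mem_rem_uniq ?enum_uniq // inE ij mem_enum.
have [n n0 Hn] := maxideal_arch_family (P := fun i => i != j) y mU.
exists (U ^+ n / (1 + U ^+ n)); have [? ? ?] := damp_pole (HO j) n0 nU; split=> // i l ij.
by apply: damp_zero; [exact: HO|exact: n0|exact: mU|exact: Hn].
Qed.

Variables (t : I -> F) (e f : I -> nat) (omega : forall i, 'I_(f i) -> F) (h : F) (D : nat).
Arguments omega : clear implicits.
Hypothesis Ht : forall i, uniformizer (O i) (t i).
Hypothesis h_ratx : ratx iota x h D.
Hypothesis h_neq0 : h != 0.
Hypothesis h_ord : forall i, O i (h * t i ^+ e i) /\ O i (h * t i ^+ e i)^-1.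
Hypothesis omega_ring : forall i b, O i (omega i b).
Hypothesis omega_lind : forall i, lind iota (maxideal (O i)) (omega i).

(** The lowest power of t with a nonzero coefficient would, after division by it, give a relation
    among the residues of the [omega i b]. *)
Lemma local_lind i (c : 'I_(e i) -> 'I_(f i) -> k) :
  O i ((\sum_a \sum_b iota (c a b) * (t i ^+ a * omega i b)) / t i ^+ e i) -> forall a b, c a b = 0.
Proof.
have Ri := vring_ring (HO i); have t0 := uniformizer_neq0 (Ht i); have mt := uniformizer_max (Ht i).
move=> Oc; suff H n : forall a : 'I_(e i), (a < n)%N -> forall b, c a b = 0.
  by move=> a; apply: (H (e i)).
elim: n => // n IH a; rewrite ltnS leq_eqVlt => /orP [/eqP an|]; last exact: IH.
apply: (@omega_lind i).
have Et (m : nat) : (a < m)%N -> t i ^+ m / t i ^+ a = t i * t i ^+ (m - a.+1).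
  move=> am; by rewrite -{1}(subnK am) exprD exprS mulrA mulfK ?expf_neq0 // mulrC.
pose S a' := \sum_b iota (c a' b) * omega i b.
have SE a' : \sum_b iota (c a' b) * (t i ^+ a' * omega i b) = t i ^+ a' * S a'.
  by rewrite mulr_sumr; apply: eq_bigr => b _; rewrite mulrCA.
rewrite -/(S a); have -> : S a =
   (\sum_a \sum_b iota (c a b) * (t i ^+ a * omega i b)) / t i ^+ e i * (t i ^+ e i / t i ^+ a)
   - \sum_(a' | a' != a) t i ^+ a' / t i ^+ a * S a'.
  rewrite mulrA mulfVK ?expf_neq0 // mulr_suml (bigD1 a) //= SE mulrAC mulfV ?expf_neq0 // mul1r.
  rewrite [X in _ + X - _](eq_bigr (fun a' : 'I_(e i) => t i ^+ a' / t i ^+ a * S a')) ?addrK // => a' _.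
  by rewrite SE mulrAC.
apply: (maxidealB (HO i)).
  apply: (maxidealMl (HO i)) => //; rewrite Et ?ltn_ord //.
  by apply: (maxidealMr (HO i)) => //; apply: (algringX Ri); case: mt.
apply: (maxideal_sum (HO i)) => a' a'a.
have OS : O i (S a').
  by apply: (algring_sum Ri) => b _; apply: (algringM Ri) => //; apply: (algringC Ri).
have [aa'|aa'] := ltnP a a'.
  rewrite Et //; apply: (maxidealMr (HO i)) => //; apply: (maxidealMr (HO i)) => //.
  by apply: (algringX Ri); case: mt.
rewrite /S big1 ?mulr0; first exact: (maxideal0 (HO i)).
move=> b _; rewrite IH ?rmorph0 ?mul0r //.
by rewrite -an ltn_neqAle aa' andbT.
Qed.

Lemma h_ring i : O i h^-1.
Proof.
have Ri := vring_ring (HO i); have t0 := uniformizer_neq0 (Ht i); have [_ H] := h_ord i.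
have -> : h^-1 = (h * t i ^+ e i)^-1 * t i ^+ e i by rewrite invfM mulfVK // expf_neq0.
by apply: (algringM Ri) => //; apply: (algringX Ri); case: (uniformizer_max (Ht i)).
Qed.

(** [count_bound] for the intersection R of the rings. The elements u_i t_i^a omega_ib lie in R and
    are independent modulo h^-1 R: at place i the terms of all other places are negligible, so a
    relation is read off place by place by [local_lind]. *)
Lemma sum_ef_le : (\sum_i e i * f i <= #|T| * D)%N.
Proof.
(* The factor h is included so that even after multiplication by h these elements vanish at the
   other places. *)
have /boolp.choice [u Hu] j := weak_approximation j
  (fun p : 'I_(e j) * 'I_(f j) => t j ^+ p.1 * omega j p.2 * h).
have -> : (\sum_i e i * f i)%N = #|{: {i : I & 'I_(e i) * 'I_(f i)}%type}|.
  rewrite card_tagged sumnE big_map big_enum /=; apply: eq_bigr => i _.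
  by rewrite card_prod !card_ord.
pose z (p : {i : I & 'I_(e i) * 'I_(f i)}%type) :=
  u (tag p) * (t (tag p) ^+ (tagged p).1 * omega (tag p) (tagged p).2).
have z_oth i p : tag p != i -> maxideal (O i) (z p * h).
  have [_ _ _ H] := Hu (tag p); move=> pi.
  by have := H i (tagged p); rewrite eq_sym mulrA; apply.
have R_ring : algring iota (fun y => forall i, O i y).
  split=> [c i|a b Oa Ob i|a b Oa Ob i]; have Ri := vring_ring (HO i).
  - exact: (algringC Ri).
  - exact: (algringD Ri).
  - exact: (algringM Ri).
apply: (@count_bound _ _ iota x T w x_tr w_span (fun y => forall i, O i y) h D _ z) => //.
- exact: h_ring.
- move=> p i; have Ri := vring_ring (HO i); have [E|pi] := eqVneq (tag p) i.
    subst i; have [_ Ou _ _] := Hu (tag p); apply: (algringM Ri) => //; apply: (algringM Ri) => //.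
    by apply: (algringX Ri); case: (uniformizer_max (Ht (tag p))).
  have := algringM Ri (maxideal_ring (z_oth i p pi)) (h_ring i).
  by rewrite mulfK.
- move=> c Hc [i [a b]]; have Ri := vring_ring (HO i).
  apply: (local_lind (c := fun a b => c (Tagged _ (a, b)))) a b.
  have [u0 Ou Ou' _] := Hu i; have [Oh Oh'] := h_ord i.
  have t0 := uniformizer_neq0 (Ht i).
  have := Hc i; rewrite (bigID (fun p => tag p == i)) /= mulrDl => H.
  have {}H : O i ((\sum_(p | tag p == i) iota (c p) * z p) * h).
    rewrite -[X in O i X](addrK ((\sum_(p | tag p != i) iota (c p) * z p) * h)).
    apply: (algringB Ri) => //; rewrite mulr_suml; apply: (algring_sum Ri) => p pi.
    rewrite -mulrA; apply: (algringM Ri); first exact: (algringC Ri).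
    exact: maxideal_ring (z_oth _ _ pi).
  have E : \sum_(p | tag p == i) iota (c p) * z p =
     u i * \sum_a \sum_b iota (c (Tagged _ (a, b))) * (t i ^+ a * omega i b).
    have -> : \sum_(p | tag p == i) iota (c p) * z p =
       \sum_(i0 | i0 == i) \sum_(q : 'I_(e i0) * 'I_(f i0)) iota (c (Tagged _ q)) * z (Tagged _ q).
      rewrite (sig_big_dep (fun i0 => i0 == i) (fun _ _ => true)
         (fun i0 (q : 'I_(e i0) * 'I_(f i0)) => iota (c (Tagged _ q)) * z (Tagged _ q))) /=.
      by apply: eq_big => [p|[]]; rewrite ?andbT.
    rewrite big_pred1_eq sum_pair mulr_sumr; apply: eq_bigr => a' _.
    rewrite mulr_sumr; apply: eq_bigr => b' _.
    by rewrite /z /= mulrCA.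
  rewrite E in H.
  have := algringM Ri (algringM Ri Ou' H) Oh'; congr (O i).
  by rewrite -!mulrA mulKf // invfM; congr (_ * _); rewrite mulrA mulfV ?mul1r.
Qed.

End Family.
End Approximation.

(** * The genus from a reduced basis *)

Lemma exp_div (F : fieldType) (z : F) i n : z != 0 -> (i <= n)%N -> z ^+ i / z ^+ n = z^-1 ^+ (n - i).
Proof.
by move=> z0 le_in; rewrite -{1}(subnK le_in) exprD invfM mulrCA mulfV ?mulr1 ?exprVn // expf_neq0.
Qed.

Section DimDrop.
Variables (k F : fieldType) (iota : {rmorphism k -> F}).

Lemma dim_ge_le S m n : dim_ge iota S m -> has_dim (cst iota) (fun z => z = 0) S n -> (m <= n)%N.
Proof. by case=> v Sv Hv Sn; rewrite -[m]card_ord; apply: has_dim_le Sn Hv Sv. Qed.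

Lemma dim_ge_sub (S S' : F -> Prop) m : (forall z, S z -> S' z) -> dim_ge iota S m -> dim_ge iota S' m.
Proof. by move=> SS' [v Sv Hv]; exists v => // i; apply: SS'. Qed.

Lemma has_dim_dim_ge S n : has_dim (cst iota) (fun z => z = 0) S n -> dim_ge iota S n.
Proof.
case=> [[e [<- [Se /indep_lind He]]] _]; exists (fun i : 'I_(size e) => e`_i) => // i.
by apply: Se; rewrite mem_nth.
Qed.

Lemma subspI S S' : subsp iota S -> subsp iota S' -> subsp iota (fun z => S z /\ S' z).
Proof.
move=> [S0 SD SZ] [S0' SD' SZ']; split=> // [a b [? ?] [? ?]|c a [? ?]]; split; auto.
Qed.

Section OnePlace.
Variables (O : F -> Prop) (t : F) (f : nat).
Hypothesis HO : vring iota O.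
Hypothesis Ht : uniformizer O t.
Hypothesis Hf : place_deg (cst iota) O f.

(** Raising the order at O by one means that the residue of z t^c vanishes, which is [f] linear
    conditions over k. *)
Lemma dim_drop1 S m c : subsp iota S -> dim_ge iota S m -> (forall z, S z -> O (z * t ^ c)) ->
  dim_ge iota (fun z => S z /\ O (z * t ^ (c - 1))) (m - f).
Proof.
move=> sS [v Sv Hv] SO; have RO := vring_ring HO.
have [om [Oom _ Hom]] := has_dim_basis (maxideal_subsp HO) (algringB RO)
  (fun c a => algringM RO (algringC RO c)) Hf.
have /boolp.choice [d Hd] i := Hom _ (SO _ (Sv i)).
have [a [ad Ha]] := lind_kernel d Hv; rewrite !card_ord in a ad Ha.
exists (fun l => \sum_i iota (a l i) * v i) => // l; split.
  by apply: (subsp_sum _ sS) => i _; have [_ _] := sS; apply.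
rewrite expfzDr ?(uniformizer_neq0 Ht) // mulrA; apply: (uniformizer_div Ht).
have -> : (\sum_i iota (a l i) * v i) * t ^ c =
   \sum_i iota (a l i) * (v i * t ^ c - \sum_j iota (d i j) * om j).
  under [RHS]eq_bigr => i _ do rewrite mulrBr mulr_sumr mulrA.
  rewrite sumrB -mulr_suml exchange_big /= [X in _ - X]big1 ?subr0 // => j _.
  under eq_bigr => i _ do rewrite mulrA -rmorphM.
  by rewrite -mulr_suml -rmorph_sum ad rmorph0 mul0r.
apply: (maxideal_sum HO) => i _; apply: (maxidealMl HO) => //; exact: (algringC RO).
Qed.

Lemma subsp_order c : subsp iota (fun z => O (z * t ^ c)).
Proof. exact: algring_subsp_mul (vring_ring HO) _. Qed.

Lemma dim_drop S m c b : subsp iota S -> dim_ge iota S m -> (forall z, S z -> O (z * t ^ c)) ->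
  dim_ge iota (fun z => S z /\ O (z * t ^ (c - b%:Z))) (m - b * f).
Proof.
move=> sS Sm SO; elim: b => [|b IH].
  by rewrite mul0n subn0 subr0; apply: dim_ge_sub Sm => z Sz; split=> //; apply: SO.
rewrite mulSn addnC subnDA.
have := dim_drop1 (subspI sS (subsp_order (c - b%:Z))) IH (fun z => @proj2 _ _).
apply: dim_ge_sub => z [[Sz _]]; split=> //.
by have -> : c - b.+1%:Z = c - b%:Z - 1 by lia.
Qed.
End OnePlace.

Lemma dim_drop_family (I : finType) (O : I -> F -> Prop) (t : I -> F) (f : I -> nat) S m
    (c : I -> int) (b : I -> nat) :
  (forall i, vring iota (O i)) -> (forall i, uniformizer (O i) (t i)) ->
  (forall i, place_deg (cst iota) (O i) (f i)) ->
  subsp iota S -> dim_ge iota S m -> (forall z i, S z -> O i (z * t i ^ c i)) ->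
  dim_ge iota (fun z => S z /\ forall i, O i (z * t i ^ (c i - (b i)%:Z))) (m - \sum_i b i * f i).
Proof.
move=> HO Ht Hf sS Sm SO.
suff : dim_ge iota (fun z => S z /\ forall i, i \in index_enum I -> O i (z * t i ^ (c i - (b i)%:Z)))
   (m - \sum_i b i * f i).
  by apply: dim_ge_sub => z [Sz H]; split=> // i; apply: H; rewrite mem_index_enum.
elim: (index_enum I) => [|i s IH].
  by rewrite big_nil subn0; apply: dim_ge_sub Sm => z Sz; split.
rewrite big_cons addnC subnDA.
have sp : subsp iota (fun z => S z /\ forall i, i \in s -> O i (z * t i ^ (c i - (b i)%:Z))).
  apply: subspI => //; split=> [j _|x y Hx Hy j js|d x Hx j js];
    have [S0 SD SZ] := subsp_order (t j) (HO j) (c j - (b j)%:Z) => //.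
    by apply: SD; [apply: Hx|apply: Hy].
  by apply: SZ; apply: Hx.
have := dim_drop (HO i) (Ht i) (Hf i) (c := c i) (b i) sp IH.
move=> /(_ (fun z Hz => SO z i (proj1 Hz))).
apply: dim_ge_sub => z [[Sz H] Hi]; split=> // j; rewrite in_cons => /orP [/eqP->|] //.
exact: H.
Qed.

End DimDrop.

(** * Genus of a function field with an integral basis reduced at infinity *)

Section ReducedBasis.
Variables (k F : fieldType) (iota : {rmorphism k -> F}) (x : F) (T : finType) (W : T -> F) (delta : T -> nat).
Hypothesis x_tr : transcendental_over iota x.
Hypothesis W_span : forall z, exists (b : {poly k}) (a : T -> {poly k}),
  b != 0 /\ z * ev iota x b = \sum_i ev iota x (a i) * W i.
Hypothesis W_pow : forall i, exists n (a b : {poly k}),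
  [/\ (0 < n)%N, b != 0 & W i ^+ n * ev iota x b = ev iota x a].

Local Notation ev := (ev iota x).
Local Notation vring := (vring iota).
Local Notation K := (cst iota).

Hypothesis W_fin : forall O i, vring O -> O x -> O (W i).
Hypothesis W_inf : forall O i, vring O -> ~ O x -> O (W i / x ^+ delta i).
Hypothesis W_free : forall a : T -> {poly k}, \sum_i ev (a i) * W i = 0 -> forall i, a i = 0.
Hypothesis W_reg : forall z, (forall O, vring O -> O x -> O z) ->
  exists a : T -> {poly k}, z = \sum_i ev (a i) * W i.
(** Reducedness at infinity: the poles of the summands there do not cancel. *)
Hypothesis W_deg : forall (a : T -> {poly k}) n,
  (forall O, vring O -> ~ O x -> O ((\sum_i ev (a i) * W i) / x ^+ n)) ->
  forall i, (size (a i) <= n.+1 - delta i)%N.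
Variable i0 : T.
Hypothesis W_one : W i0 = 1.
Hypothesis delta_pos : forall i, i != i0 -> (0 < delta i)%N.

Lemma x_neq0 : x != 0.
Proof. by rewrite -(evX iota x) (ev_eq0 x_tr) polyX_eq0. Qed.

Lemma unit_cstD O c m : vring O -> c != 0 -> maxideal O m -> O (iota c + m)^-1 /\ iota c + m != 0.
Proof.
move=> HO c0 mm; have RO := vring_ring HO.
have ic0 : iota c != 0 by rewrite fmorph_eq0.
have -> : iota c + m = iota c * (1 + iota c^-1 * m) by rewrite mulrDr mulr1 mulrA -rmorphM mulfV // rmorph1 mul1r.
have [O1 N1] := maxideal1D HO (maxidealMl HO (algringC RO c^-1) mm).
by split; [rewrite invfM -fmorphV; apply: (algringM RO) => //; apply: (algringC RO)|rewrite mulf_neq0].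
Qed.

Lemma ev_inf_le O (p : {poly k}) n : vring O -> ~ O x -> (size p <= n.+1)%N -> O (ev p / x ^+ n).
Proof.
move=> HO nx sp; have RO := vring_ring HO; rewrite (evE _ _ sp) mulr_suml; apply: (algring_sum RO) => i _.
rewrite -mulrA; apply: (algringM RO); first exact: (algringC RO).
have x0 := x_neq0; have -> : x ^+ i / x ^+ n = x^-1 ^+ (n - i).
  by rewrite exp_div // -ltnS.
by apply: (algringX RO); apply: (vring_inv HO).
Qed.

Lemma ev_inf O (p : {poly k}) : vring O -> ~ O x -> p != 0 ->
  O (ev p / x ^+ (size p).-1) /\ O (x ^+ (size p).-1 / ev p).
Proof.
move=> HO nx p0; split; first by apply: ev_inf_le => //; rewrite leqSpred.
have RO := vring_ring HO; have x0 := x_neq0.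
have [n sp] : exists n, size p = n.+1 by exists (size p).-1; rewrite prednK // size_poly_gt0.
have E : ev p / x ^+ n = iota (lead_coef p) + (\sum_(i < n) iota p`_i * x ^+ i) / x ^+ n.
  rewrite (@evE _ _ _ _ p n.+1) ?sp // big_ord_recr /= mulrDl addrC.
  by rewrite mulfK ?expf_neq0 // lead_coefE sp.
have m : maxideal O ((\sum_(i < n) iota p`_i * x ^+ i) / x ^+ n).
  rewrite mulr_suml; apply: (maxideal_sum HO) => i _; rewrite -mulrA.
  apply: (maxidealMl HO); first exact: (algringC RO).
  have -> : x ^+ i / x ^+ n = x^-1 ^+ (n - i).
    by rewrite exp_div // ltnW.
  by apply: (maxidealX HO); [rewrite subn_gt0|apply: (maxidealV HO)].
have [] := @unit_cstD O (lead_coef p) _ HO _ m; first by rewrite lead_coef_eq0 p0.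
by rewrite -E invf_div sp.
Qed.

(** An algebraic z lies in every valuation ring: at a pole, dividing its equation by the top power
    would make a unit equal to 0. So z has coordinates over k[x] in W, and the degree bound with n =
    0 leaves only a constant multiple of [W i0]. *)
Lemma algebraic_cst z : algebraic_over iota z <-> K z.
Proof.
split=> [[p [p0 /rootP pz]]|[c ->]]; last first.
  exists ('X - c%:P); rewrite polyXsubC_eq0; split=> //.
  by rewrite rmorphB /= map_polyX map_polyC root_XsubC.
have Oz O : vring O -> O z.
  move=> HO; have RO := vring_ring HO; apply: boolp.contrapT => nz.
  have mz := maxidealV HO nz.
  have z0 : z != 0 by apply/eqP => E; apply: nz; rewrite E; apply: (algring0 RO).
  have [n sp] : exists n, size p = n.+1 by exists (size p).-1; rewrite prednK // size_poly_gt0.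
  have : (map_poly iota p).[z] / z ^+ n = 0 by rewrite pz mul0r.
  rewrite (@horner_coef_wide _ n.+1) ?size_map_poly ?sp // big_ord_recr /= mulrDl mulfK ?expf_neq0 //.
  rewrite addrC coef_map /= => E.
  have m : maxideal O ((\sum_(i < n) (map_poly iota p)`_i * z ^+ i) / z ^+ n).
    rewrite mulr_suml; apply: (maxideal_sum HO) => i _; rewrite coef_map -mulrA.
    apply: (maxidealMl HO); first exact: (algringC RO).
    have -> : z ^+ i / z ^+ n = z^-1 ^+ (n - i).
      by rewrite exp_div // ltnW.
    by apply: (maxidealX HO); rewrite ?subn_gt0.
  have [] := @unit_cstD O p`_n _ HO _ m; last by rewrite E eqxx.
  by have := lead_coef_eq0 p; rewrite lead_coefE sp => ->.
have [a za] := W_reg (fun O HO _ => Oz O HO).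
have da : forall i, (size (a i) <= 1 - delta i)%N.
  by apply: (W_deg (n := 0)) => O HO _; rewrite -za expr0 divr1; apply: Oz.
exists (a i0)`_0; rewrite za (bigD1 i0) //= [X in _ + X]big1 ?addr0 => [|i ii0].
  rewrite W_one mulr1 (@evE _ _ _ _ _ 1) ?big_ord1 ?expr0 ?mulr1 //.
  by apply: leq_trans (da i0) _; rewrite leq_subr.
have := da i; have := delta_pos ii0; case: (delta i) => // n _; rewrite subSS sub0n leqn0 size_poly_eq0.
by move=> /eqP->; rewrite rmorph0 mul0r.
Qed.

(** * The spaces L(n (h)_oo) and the pole divisor of h = p + 1/p *)

Section Pole.
Variable p : {poly k}.
Hypothesis p_size : (1 < size p)%N.
Let d := (size p).-1.
(* The poles of [h] are the zeros of [p] together with the places at infinity. *)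
Let h := ev p + (ev p)^-1.

Lemma p_neq0 : p != 0. Proof. by rewrite -size_poly_gt0 ltnW. Qed.
Lemma evp_neq0 : ev p != 0. Proof. by rewrite (ev_eq0 x_tr) p_neq0. Qed.

Lemma p2_size : size (p ^+ 2 + 1) = (2 * d).+1.
Proof.
have p20 : p ^+ 2 != 0 by rewrite expf_neq0 // p_neq0.
have sp2 : size (p ^+ 2) = (2 * d).+1.
  by rewrite -[LHS]prednK ?size_poly_gt0 // size_exp mulnC.
rewrite size_polyDl ?sp2 // size_poly1 /d; lia.
Qed.

Lemma h_mul_p : h * ev p = ev (p ^+ 2 + 1).
Proof. by rewrite /h mulrDl mulVf ?evp_neq0 // rmorphD rmorphXn rmorph1 expr2. Qed.

Lemma h_ratx : ratx iota x h (2 * d).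
Proof.
exists (p ^+ 2 + 1), p; rewrite p_neq0 h_mul_p p2_size; split=> //.
by rewrite /d; lia.
Qed.

Lemma h_neq0 : h != 0.
Proof.
apply: contraTneq isT => h0; have := h_mul_p; rewrite h0 mul0r => /esym/eqP.
by rewrite (ev_eq0 x_tr) -size_poly_eq0 p2_size.
Qed.

Lemma pole_inf O : vring O -> ~ O x -> ~ O h.
Proof.
move=> HO nx Oh; have RO := vring_ring HO.
have [_ Op] := ev_inf HO nx p_neq0.
have x0 := x_neq0.
have mp : maxideal O (ev p)^-1.
  have -> : (ev p)^-1 = x ^+ d / ev p * x^-1 ^+ d by rewrite exprVn mulrAC mulfV ?mul1r // expf_neq0.
  by apply: (maxidealMl HO) => //; apply: (maxidealX HO); [rewrite /d; lia|apply: (maxidealV HO)].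
apply: (maxideal_nunit HO (z := (ev p)^-1)) => //; first by rewrite invr_eq0 evp_neq0.
rewrite invrK -[ev p](addrK (ev p)^-1); apply: (algringB RO) => //.
exact: maxideal_ring mp.
Qed.

Lemma pole_fin O : vring O -> O x -> (O h <-> O (ev p)^-1).
Proof.
move=> HO Ox; have RO := vring_ring HO; have Op := ev_ring p RO Ox.
split=> H; last exact: (algringD RO).
by rewrite -[(ev p)^-1](addKr (ev p)); apply: (algringD RO) => //; apply: (algringN RO).
Qed.

(** The space L(n (h)_oo) written without orders. *)
Definition Lh n z := forall O, vring O -> (O h -> O z) /\ (~ O h -> O (z / h ^+ n)).

(** At a zero of p the product h p = p^2 + 1 is a unit, so z p^n is regular at every finite place;
    at infinity h p grows like x^(2d), which bounds the pole of z p^n by that of x^(2dn). *)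
Lemma LhP n z : Lh n z <-> exists2 a : T -> {poly k},
  forall i, (size (a i) <= (2 * d * n).+1 - delta i)%N & z * ev p ^+ n = \sum_i ev (a i) * W i.
Proof.
have x0 := x_neq0; have h0 := h_neq0; have ep0 := evp_neq0.
have p20 : p ^+ 2 + 1 != 0 by rewrite -size_poly_gt0 p2_size.
have pu O : vring O -> O x -> ~ O h -> O (h * ev p) /\ O (h * ev p)^-1.
  move=> HO Ox nh; have RO := vring_ring HO.
  split; first by rewrite h_mul_p; apply: ev_ring.
  rewrite h_mul_p rmorphD rmorph1 addrC rmorphXn.
  have mp : maxideal O (ev p).
    by case: (maxidealP HO (ev p)) => // /(pole_fin HO Ox).
  by have [] := maxideal1D HO (maxidealX HO (ltn0Sn 1) mp).
have zE O y : vring O -> y / h ^+ n = y * ev p ^+ n / (h * ev p) ^+ n.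
  by move=> _; rewrite exprMn invfM mulrACA mulfV ?mulr1 // expf_neq0.
split=> [Hz|[a sa za] O HO].
  have [a za] : exists a : T -> {poly k}, z * ev p ^+ n = \sum_i ev (a i) * W i.
    apply: W_reg => O HO Ox; have RO := vring_ring HO; have [Hh Hnh] := Hz O HO.
    case: (boolp.pselect (O h)) => [/Hh Oz|nh].
      by apply: (algringM RO) => //; apply: (algringX RO); apply: ev_ring.
    have [Ou Ou'] := pu O HO Ox nh.
    have := algringM RO (Hnh nh) (algringX RO n Ou).
    by rewrite (zE _ _ HO) mulfVK // expf_neq0 // mulf_neq0.
  exists a => //; apply: W_deg => O HO nx; rewrite -za; have RO := vring_ring HO.
  have [_ /(_ (pole_inf HO nx)) Oz] := Hz O HO.
  have [Ou _] := ev_inf HO nx p20; rewrite p2_size /= in Ou.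
  have := algringM RO Oz (algringX RO n Ou).
  rewrite (zE _ _ HO) h_mul_p expr_div_n mulrA mulfVK ?exprM //.
  by rewrite expf_neq0 // (ev_eq0 x_tr).
have RO := vring_ring HO; split=> [Oh|nh].
  have Ox : O x by apply: boolp.contrapT => /(pole_inf HO).
  have Op := (pole_fin HO Ox).1 Oh.
  have -> : z = (\sum_i ev (a i) * W i) * (ev p)^-1 ^+ n.
    by rewrite -za exprVn mulfK // expf_neq0.
  apply: (algringM RO); last exact: (algringX RO).
  by apply: (algring_sum RO) => i _; apply: (algringM RO); [apply: ev_ring|apply: W_fin].
rewrite (zE _ _ HO) za; case: (boolp.pselect (O x)) => [Ox|nx].
  have [_ Ou] := pu O HO Ox nh; apply: (algringM RO).
    by apply: (algring_sum RO) => i _; apply: (algringM RO); [apply: ev_ring|apply: W_fin].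
  by rewrite -exprVn; apply: (algringX RO).
rewrite h_mul_p mulr_suml; apply: (algring_sum RO) => i _.
have [di|di] := leqP (delta i) (2 * d * n)%N; last first.
  have : (size (a i) <= 0)%N by apply: leq_trans (sa i) _; lia.
  by rewrite leqn0 size_poly_eq0 => /eqP->; rewrite rmorph0 !mul0r; apply: (algring0 RO).
have [_ Ou] := ev_inf HO nx p20; rewrite p2_size /= in Ou.
have Oa : O (ev (a i) / x ^+ (2 * d * n - delta i)).
  by apply: ev_inf_le => //; rewrite -subSn.
have := algringM RO (algringM RO Oa (W_inf i HO nx)) (algringX RO n Ou).
rewrite mulrACA -invfM -exprD subnK // expr_div_n -exprM mulrA mulfVK //.
exact: expf_neq0.
Qed.

Lemma Lh_subsp n : subsp iota (Lh n).
Proof.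
split=> [O HO|a b Ha Hb O HO|c a Ha O HO]; have RO := vring_ring HO.
- by rewrite mul0r; split=> _; apply: (algring0 RO).
- have [? ?] := Ha O HO; have [? ?] := Hb O HO.
  by rewrite mulrDl; split=> ?; apply: (algringD RO); auto.
- have [? ?] := Ha O HO.
  by rewrite -mulrA; split=> ?; apply: (algringM RO); auto; apply: (algringC RO).
Qed.

(** By [LhP] the functions x^j W_i / p^n with j < 2dn + 1 - delta_i form a basis. *)
Lemma Lh_dim n : has_dim K (fun z => z = 0) (Lh n) (\sum_i ((2 * d * n).+1 - delta i)).
Proof.
have ep0 := evp_neq0; have epn0 : ev p ^+ n != 0 by rewrite expf_neq0.
pose m i := ((2 * d * n).+1 - delta i)%N.
have -> : (\sum_i m i)%N = #|{: {i : T & 'I_(m i)}}|.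
  by rewrite card_tagged sumnE big_map big_enum /=; apply: eq_bigr => i _; rewrite card_ord.
pose v (u : {i : T & 'I_(m i)}) := ev 'X^(tagged u) * W (tag u) / ev p ^+ n.
have sumE (c : {i : T & 'I_(m i)} -> k) : (\sum_u iota (c u) * v u) * ev p ^+ n =
   \sum_i ev (\poly_(j < m i) (if insub j is Some j' then c (Tagged _ (j' : 'I_(m i))) else 0)) * W i.
  rewrite mulr_suml.
  under eq_bigr => u _ do rewrite /v mulrA mulfVK // mulrA.
  under eq_bigr => u _ do (rewrite (_ : c u = c (Tagged (fun i => 'I_(m i)) (tagged u))); last by case: u).
  rewrite -(sig_big_dep predT (fun _ _ => true)
     (fun i (j : 'I_(m i)) => iota (c (Tagged _ j)) * ev 'X^j * W i)) /=.
  apply: eq_bigr => i _; rewrite poly_def rmorph_sum mulr_suml; apply: eq_bigr => j _.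
  by rewrite valK -mul_polyC rmorphM /= evC.
apply: (basis_has_dim (v := v)) => [|c Hc|u|z /LhP [a sa za]].
- exact: subsp0.
- have /W_free a0 : \sum_i ev (\poly_(j < m i) (if insub j is Some j' then c (Tagged _ (j' : 'I_(m i))) else 0)) * W i = 0.
    by rewrite -sumE Hc mul0r.
  move=> [i j]; have /(congr1 (fun q : {poly k} => q`_j)) := a0 i.
  by rewrite coef_poly ltn_ord valK coef0.
- apply/LhP; exists (fun i => if i == tag u then 'X^(tagged u) else 0) => [i|].
    case: eqP => [->|_]; rewrite ?size_poly0 // size_polyXn.
    exact: (ltn_ord (tagged u)).
  rewrite mulfVK // (bigD1 (tag u)) //= eqxx big1 ?addr0 // => i /negbTE->.
  by rewrite rmorph0 mul0r.
- exists (fun u : {i : T & 'I_(m i)} => (a (tag u))`_(nat_of_ord (tagged u))); apply/eqP; rewrite subr_eq0; apply/eqP.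
  apply: (mulIf epn0); rewrite sumE za; apply: eq_bigr => i _; congr (ev _ * _).
  apply/polyP => j; rewrite coef_poly; case: ltnP => jm.
    by rewrite insubT.
  by rewrite nth_default // (leq_trans (sa i)).
Qed.

Definition poles (I : finType) (O : I -> F -> Prop) :=
  [/\ forall i, vring (O i), forall i j, i != j -> ~ same_place (O i) (O j) & forall i, ~ O i h].

Definition complete_poles (I : finType) (O : I -> F -> Prop) :=
  poles O /\ forall O', vring O' -> ~ O' h -> exists i, same_place (O i) O'.

Lemma lind1 O : vring O -> lind iota (maxideal O) (fun _ : 'I_1 => 1).
Proof. by move=> HO c; rewrite big_ord1 mulr1 => /(maxideal_cst HO) H i; rewrite (ord1 i). Qed.

(** Independence modulo the maximal ideal implies independence modulo h^-1 O, so [count_bound]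
    limits the residue degree. *)
Lemma pole_degree O : vring O -> ~ O h -> exists2 f, (0 < f)%N & place_deg K O f.
Proof.
move=> HO nh; have RO := vring_ring HO; have mh := maxidealV HO nh.
have [f Hf] : exists f, place_deg K O f.
  apply: (has_dim_bounded (B := #|T| * (2 * d))) => n v Hv Ov.
  rewrite -[n]card_ord; apply: (count_bound x_tr W_span RO h_neq0 _ h_ratx Ov); first by case: mh.
  apply: lind_sub Hv => y Oy; rewrite -[y](mulfK h_neq0); exact: (maxidealMl HO).
exists f => //; rewrite -[1%N]card_ord; apply: (has_dim_le Hf (lind1 HO)) => _.
exact: (algring1 RO).
Qed.

Lemma poles_sum_le (I : finType) (O : I -> F -> Prop) (t : I -> F) (e f : I -> nat) : poles O ->
  (forall i, uniformizer (O i) (t i)) -> (forall i, O i (h * t i ^+ e i) /\ O i (h * t i ^+ e i)^-1) ->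
  (forall i, place_deg K (O i) (f i)) -> (\sum_i e i * f i <= #|T| * (2 * d))%N.
Proof.
move=> [HO HOd Hh] Ht He Hf.
have Hom i : exists om : 'I_(f i) -> F, (forall b, O i (om b)) /\ lind iota (maxideal (O i)) om.
  have RO := vring_ring (HO i).
  have [om [H1 H2 _]] := has_dim_basis (maxideal_subsp (HO i)) (algringB RO)
     (fun c a => algringM RO (algringC RO c)) (Hf i).
  by exists om.
pose om i := sval (boolp.cid (Hom i)).
have Hom' i : (forall b, O i (om i b)) /\ lind iota (maxideal (O i)) (om i) := svalP (boolp.cid (Hom i)).
apply: (sum_ef_le x_tr W_span W_pow HO HOd (omega := om) Ht h_ratx h_neq0 He).
  by move=> i; case: (Hom' i).
by move=> i; case: (Hom' i).
Qed.

Lemma poles_card (I : finType) (O : I -> F -> Prop) : poles O -> (#|I| <= #|T| * (2 * d))%N.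
Proof.
move=> PO; have [HO HOd Hh] := PO.
have /boolp.choice [t Ht] i := uniformizer_exists x_tr W_span W_pow (HO i).
have /boolp.choice [e He] i : exists e : nat, (0 < e)%N /\ O i (h * t i ^+ e) /\ O i (h * t i ^+ e)^-1.
  by have [e ? ?] := pole_order x_tr W_span W_pow (HO i) (Ht i) (Hh i); exists e.
have := @sum_ef_le _ _ iota x T W x_tr W_span W_pow I O HO HOd t e (fun=> 1%N) (fun _ _ => 1)
  h (2 * d) Ht h_ratx h_neq0 (fun i => proj2 (He i))
  (fun i _ => algring1 (vring_ring (HO i))) (fun i => lind1 (HO i)).
apply: leq_trans; rewrite -sum1_card; apply: leq_sum => i _; rewrite muln1.
by case: (He i).
Qed.

(** [poles_card] bounds the size of any family of distinct poles, so a maximal extension exists. The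
    sum type keeps the given places apart as [inl]. *)
Lemma poles_complete (I : finType) (O : I -> F -> Prop) : poles O ->
  exists r (O' : 'I_r -> F -> Prop), complete_poles (fun i : I + 'I_r => match i with inl i => O i | inr j => O' j end).
Proof.
move=> PO.
pose Q r := boolp.asbool (exists O' : 'I_r -> F -> Prop,
  poles (fun i : I + 'I_r => match i with inl i => O i | inr j => O' j end)).
have Q0 : exists r, Q r.
  exists 0%N; apply/boolp.asboolP; exists (fun _ _ => True); case: PO => HO HOd Hh.
  by split=> [[i|[]]|[i|[] //] [j|[] //] ij|[i|[]]] //; apply: HOd.
have QB r : Q r -> (r <= #|T| * (2 * d))%N.
  move=> /boolp.asboolP [O' /poles_card]; rewrite card_sum card_ord.
  by apply: leq_trans; rewrite leq_addl.
case: (ex_maxnP Q0 QB) => r /boolp.asboolP [O' PO'] rmax.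
exists r, O'; split=> // P HP nh; apply: boolp.contrapT => nex.
suff /rmax : Q r.+1 by rewrite ltnn.
apply/boolp.asboolP; exists (fun j => if unlift ord_max j is Some j' then O' j' else P).
have [HO HOd Hh] := PO'.
have nex1 i : ~ same_place (O i) P by move=> H; apply: nex; exists (inl i).
have nex2 i : ~ same_place (O' i) P by move=> H; apply: nex; exists (inr i).
have sym A B : ~ same_place A B -> ~ same_place B A.
  by move=> H1 H2; apply: H1 => z; split=> /H2.
split.
- move=> [i|j]; first exact: (HO (inl i)).
  by case: unliftP => [j' _|_] //; apply: (HO (inr j')).
- move=> [i|j] [i'|j'] ij; first exact: (HOd (inl i) (inl i')).
  + case: unliftP => [j1 _|_]; last exact: nex1.
    exact: (HOd (inl i) (inr j1)).
  + case: unliftP => [j1 _|_]; last by apply: sym; apply: nex1.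
    exact: (HOd (inr j1) (inl i')).
  + case: unliftP ij => [j1 ->|->]; case: unliftP => [j2 ->|->] // ij.
    * apply: (HOd (inr j1) (inr j2)); apply: contra ij => /eqP [->]; exact: eqxx.
    * by apply: sym; apply: nex2.
    * by rewrite eqxx in ij.
- move=> [i|j]; first exact: (Hh (inl i)).
  by case: unliftP => [j' _|_] //; apply: (Hh (inr j')).
Qed.

Lemma order_pow O t (e n : nat) z : vring O -> uniformizer O t ->
  O (h * t ^+ e) -> O (h * t ^+ e)^-1 -> O (z / h ^+ n) <-> O (z * t ^ (n * e)%N%:Z).
Proof.
move=> HO Ht He He'; have RO := vring_ring HO; have h0 := h_neq0; have t0 := uniformizer_neq0 Ht.
have E : z * t ^ (n * e)%N%:Z = z / h ^+ n * (h * t ^+ e) ^+ n.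
  by rewrite exprMn -exprM mulnC -exprnP mulrA mulfVK // expf_neq0.
split=> Oz; first by rewrite E; apply: (algringM RO) => //; apply: (algringX RO).
have := algringM RO Oz (algringX RO n He').
by rewrite E exprVn mulfK // expf_neq0 // mulf_neq0 // expf_neq0.
Qed.

Lemma Lh_drop (I : finType) (O : I -> F -> Prop) (t : I -> F) (e f : I -> nat) n (b : I -> nat) : poles O ->
  (forall i, uniformizer (O i) (t i)) -> (forall i, O i (h * t i ^+ e i) /\ O i (h * t i ^+ e i)^-1) ->
  (forall i, place_deg K (O i) (f i)) ->
  dim_ge iota (fun z => Lh n z /\ forall i, O i (z * t i ^ ((n * e i)%N%:Z - (b i)%:Z)))
    (\sum_i ((2 * d * n).+1 - delta i) - \sum_i b i * f i).
Proof.
move=> [HO HOd Hh] Ht He Hf.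
apply: (dim_drop_family (c := fun i => (n * e i)%N%:Z)) => //.
- exact: Lh_subsp.
- exact: has_dim_dim_ge (Lh_dim n).
move=> z i Lz; have [He1 He2] := He i; apply/(order_pow n z (HO i) (Ht i) He1 He2).
by have [_ H] := Lz _ (HO i); apply: H.
Qed.

Lemma dim_lower n : (#|T| * (2 * d * n).+1 <= \sum_i ((2 * d * n).+1 - delta i) + \sum_i delta i)%N.
Proof.
rewrite -big_split /= -sum_nat_const; apply: leq_sum => i _; lia.
Qed.

Lemma dim_large n : (\sum_i delta i <= n)%N ->
  (\sum_i ((2 * d * n).+1 - delta i) + \sum_i delta i = #|T| * (2 * d * n).+1)%N.
Proof.
move=> Hn; rewrite -big_split /= -sum_nat_const; apply: eq_bigr => i _; apply: subnK.
have : (delta i <= \sum_i delta i)%N by rewrite (bigD1 i) //= leq_addr.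
have : (1 <= d)%N by rewrite /d; lia.
nia.
Qed.

(** Removing all poles from L(n (h)_oo) takes n times the sum of the e f conditions and leaves L(0),
    of dimension at most |T|. As the dimension of L(n (h)_oo) grows like 2dn|T|, that sum cannot be
    smaller than 2d|T|. *)
Lemma poles_sum (I : finType) (O : I -> F -> Prop) (t : I -> F) (e f : I -> nat) : complete_poles O ->
  (forall i, uniformizer (O i) (t i)) -> (forall i, O i (h * t i ^+ e i) /\ O i (h * t i ^+ e i)^-1) ->
  (forall i, place_deg K (O i) (f i)) -> (\sum_i e i * f i = #|T| * (2 * d))%N.
Proof.
move=> [PO Hall] Ht He Hf; apply/eqP; rewrite eqn_leq (poles_sum_le PO Ht He Hf) /=.
have [HO HOd Hh] := PO.
have key n : (#|T| * (2 * d * n).+1 <= \sum_i delta i + n * \sum_i e i * f i + #|T|)%N.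
  have H0 : (\sum_i ((2 * d * n).+1 - delta i) - \sum_i n * e i * f i <= \sum_i ((2 * d * 0).+1 - delta i))%N.
    apply: dim_ge_le (Lh_dim 0).
    apply: dim_ge_sub (Lh_drop n (fun i => n * e i)%N PO Ht He Hf) => z [Lz Hz] P HP.
    have [H1 _] := Lz P HP; split=> // nh; rewrite expr0 divr1.
    by have [i Hi] := Hall P HP nh; apply/Hi; have := Hz i; rewrite subrr expr0z mulr1.
  have H1 : (\sum_i ((2 * d * 0).+1 - delta i) <= #|T|)%N.
    by rewrite -sum1_card; apply: leq_sum => i _; rewrite muln0 leq_subr.
  have H2 : (\sum_i n * e i * f i = n * \sum_i e i * f i)%N.
    by rewrite big_distrr /=; apply: eq_bigr => i _; rewrite mulnA.
  have := dim_lower n; rewrite H2 in H0; move: H0 H1.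
  move: (\sum_i ((2 * d * n).+1 - _))%N (\sum_i ((2 * d * 0).+1 - _))%N (\sum_i e i * f i)%N.
  move: (\sum_i delta i)%N #|T| d => s1 N d' s2 s3 s4; clear; nia.
(* A strict inequality would bound every n by the sum of the delta_i. *)
rewrite leqNgt; apply/negP => lt.
have := key (\sum_i delta i).+1; have := leq_mul (leqnn (\sum_i delta i).+1) lt.
move: (\sum_i delta i)%N #|T| (\sum_i e i * f i)%N d => s1 N s2 d'; clear; nia.
Qed.

End Pole.

Lemma same_placeE (O1 O2 : F -> Prop) : same_place O1 O2 -> O1 = O2.
Proof. by move=> H; apply: boolp.funext => z; apply: boolp.propext. Qed.

Lemma algebraic_cstE : algebraic_over iota = K.
Proof. by apply: boolp.funext => z; apply: boolp.propext; apply: algebraic_cst. Qed.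

(** At a finite place, the denominator of an element of k(x) outside O must vanish. At infinity the
    condition is empty and 1 serves. *)
Lemma place_contains_zero O : vring O -> exists2 r : {poly k}, r != 0 & O x -> maxideal O (ev r).
Proof.
move=> HO; have RO := vring_ring HO; case: (boolp.pselect (O x)) => [Ox|nx]; last by exists 1; rewrite ?oner_eq0.
have [h [d [[A [B [B0 _ _ hB]]] nh]]] := vring_pole x_tr W_span W_pow HO.
exists B => // _; case: (maxidealP HO (ev B)) => // OB; case: nh.
have -> : h = ev A * (ev B)^-1 by rewrite -hB mulfK // (ev_eq0 x_tr).
by apply: (algringM RO) => //; apply: ev_ring.
Qed.

Lemma genus_upper m (A : divisor F m) l : valid_divisor K A ->
  has_dim K (fun z => z = 0) (LRR K A) l ->
  div_deg A - l%:Z + 1 <= 1 - #|T|%:Z + (\sum_i delta i)%N%:Z.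
Proof.
move=> [HA HAd] Hl.
have HO i : vring (A i).1.1 by apply/(vring_place x_tr W_span W_pow); case: (HA i).
have /boolp.choice [r Hr] i : exists r : {poly k}, r != 0 /\ ((A i).1.1 x -> maxideal (A i).1.1 (ev r)).
  by have [r r0 Hr] := place_contains_zero (HO i); exists r.
(* The factor X keeps p nonconstant even for an empty divisor. *)
pose p := (\prod_i r i) * 'X.
have r0 : \prod_i r i != 0 by apply/prodf_neq0 => i _; case: (Hr i).
have ps : (1 < size p)%N by rewrite size_mulX // ltnS size_poly_gt0.
have PA : poles p (fun i => (A i).1.1).
  split=> // i Oh; have RO := vring_ring (HO i).
  case: (boolp.pselect ((A i).1.1 x)) => Ox; last exact: (pole_inf ps (HO i) Ox).
  have Op := (pole_fin p (HO i) Ox).1 Oh.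
  apply: (maxideal_nunit (HO i) (evp_neq0 ps) Op).
  rewrite /p rmorphM rmorph_prod /= (bigD1 i) //=; apply: (maxidealMr (HO i)); last by rewrite evX.
  apply: (maxidealMr (HO i)); first by case: (Hr i) => _; apply.
  by apply: (algring_prod RO) => j _; apply: ev_ring.
have [s [O' [PO Hall]]] := poles_complete ps PA.
set O := (fun i : 'I_m + 'I_s => _) in PO Hall.
have [HO' HOd Hh] := PO.
have /boolp.choice [t Ht] i := uniformizer_exists x_tr W_span W_pow (HO' i).
have /boolp.choice [e He] i : exists e : nat, (0 < e)%N /\
    O i ((ev p + (ev p)^-1) * t i ^+ e) /\ O i ((ev p + (ev p)^-1) * t i ^+ e)^-1.
  by have [e ? ?] := pole_order x_tr W_span W_pow (HO' i) (Ht i) (Hh i); exists e.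
have /boolp.choice [f' Hf'] j : exists f, place_deg K (O' j) f.
  by have [f _ ?] := pole_degree ps (HO' (inr j)) (Hh (inr j)); exists f.
pose f i := match i with inl i => (A i).2 | inr j => f' j end.
have Hf i : place_deg K (O i) (f i) by case: i => [i|j] //=; case: (HA i).
(* At the poles of h outside the divisor, regularity must be imposed: multiplicity 0. *)
pose a (i : 'I_m + 'I_s) : int := match i with inl i => (A i).1.2 | inr j => 0 end.
pose n := (\sum_i delta i + \sum_i `|a i|)%N.
have na i : a i <= (n * e i)%N%:Z.
  have : (`|a i| <= n)%N by rewrite /n (bigD1 i) //= addnCA leq_addr.
  have [e0 _] := He i; nia.
(* The number of orders by which L(n (h)_oo) exceeds L(A) at place i; n was chosen so that it is
   nonnegative. *)
pose b i := `|(n * e i)%N%:Z - a i|%N.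
have bE i : (b i)%:Z = (n * e i)%N%:Z - a i by rewrite /b gez0_abs // subr_ge0.
have He2 i := proj2 (He i).
have key : (\sum_i ((2 * (size p).-1 * n).+1 - delta i) - \sum_i b i * f i <= l)%N.
  apply: dim_ge_le Hl; apply: dim_ge_sub (Lh_drop ps n b PO Ht He2 Hf) => z [Lz Hz].
  have [->|z0] := eqVneq z 0; [by left|right] => P /(vring_place x_tr W_span W_pow) HP v ov.
  have [u Hu] := uniformizer_exists x_tr W_span W_pow HP.
  have Hi i : O i (z * t i ^ a i) by have := Hz i; rewrite bE opprB addrC subrK.
  split=> [i /same_placeE AP|nA].
    subst P; apply/(ord_ge _ HP (Ht (inl i)) ov).
    by rewrite opprK; apply: (Hi (inl i)).
  apply/(ord_ge _ HP Hu ov); rewrite oppr0 expr0z mulr1.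
  have [Lh1 _] := Lz P HP.
  case: (boolp.pselect (P (ev p + (ev p)^-1))) => [/Lh1 //|nh].
  have [[i|j] Hij] := Hall P HP nh; first by case: (nA i).
  by apply/Hij; have := Hi (inr j); rewrite /= expr0z mulr1.
have sumle := poles_sum_le ps PO Ht He2 Hf.
have dE : div_deg A = \sum_i a i * (f i)%:Z.
  by rewrite /div_deg big_sumType /= [X in _ + X]big1 ?addr0 // => j _; rewrite mul0r.
have bfE : (\sum_i b i * f i)%N%:Z = n%:Z * (\sum_i e i * f i)%N%:Z - div_deg A.
  rewrite dE -!natz !natr_sum mulr_sumr -sumrB; apply: eq_bigr => i _.
  by rewrite !natrM !natz bE PoszM mulrBl mulrA.
have Ln := dim_lower ps n.
move: key Ln sumle bfE; move: (\sum_i ((2 * _ * n).+1 - _))%N (\sum_i b i * f i)%N (\sum_i e i * f i)%N.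
move: (\sum_i delta i)%N (div_deg A) #|T| (size p).-1 => s1 dg N d s2 s3 s4 k1 k2 k3 k4.
nia.
Qed.

Lemma genus_attained : exists m (A : divisor F m) l, [/\ valid_divisor K A,
  has_dim K (fun z => z = 0) (LRR K A) l &
  div_deg A - l%:Z + 1 = 1 - #|T|%:Z + (\sum_i delta i)%N%:Z].
Proof.
pose p : {poly k} := 'X; have ps : (1 < size p)%N by rewrite size_polyX.
(* Completing the empty family yields all poles of h. *)
have P0 : poles p (fun (_ : void) (_ : F) => True) by split=> [[]|[]|[]].
have [s [O' [PO Hall]]] := poles_complete ps P0.
set O := (fun i : void + 'I_s => _) in PO Hall.
have [HO HOd Hh] := PO.
have /boolp.choice [t Ht] i := uniformizer_exists x_tr W_span W_pow (HO i).
have /boolp.choice [e He] i : exists e : nat, (0 < e)%N /\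
    O i ((ev p + (ev p)^-1) * t i ^+ e) /\ O i ((ev p + (ev p)^-1) * t i ^+ e)^-1.
  by have [e ? ?] := pole_order x_tr W_span W_pow (HO i) (Ht i) (Hh i); exists e.
have He2 i := proj2 (He i).
have /boolp.choice [f Hf] i : exists f, place_deg K (O i) f.
  by have [f _ ?] := pole_degree ps (HO i) (Hh i); exists f.
have sum_ef := poles_sum ps (conj PO Hall) Ht He2 Hf.
(* Large enough that no subtraction in the dimension formula is truncated. *)
pose n := (\sum_i delta i)%N.
pose A : divisor F s := fun j => (O (inr j), (n * e (inr j))%N%:Z, f (inr j)).
have LE : LRR K A = Lh p n.
  apply: boolp.funext => z; apply: boolp.propext; split.
    case=> [->|Hz] P HP; first by have [L0 _ _] := Lh_subsp p n; apply: L0.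
    have [z0|z0] := eqVneq z 0.
      by have [L0 _ _] := Lh_subsp p n; rewrite z0; apply: L0.
    have [u Hu] := uniformizer_exists x_tr W_span W_pow HP.
    have [v Hv] := uniformizer_ord x_tr W_span W_pow HP Hu z0.
    have ov : ord P z v by split=> //; exists u.
    have [H1 H2] := Hz P ((vring_place x_tr W_span W_pow P).1 HP) v ov.
    split=> [Ph|nh].
      rewrite -[z]mulr1 -(expr0z u) -oppr0; apply/(ord_ge 0 HP Hu ov).
      by apply: H2 => j /same_placeE E; subst P; exact: (Hh (inr j) Ph).
    have [[[]|j] /same_placeE E] := Hall P HP nh; subst P.
    have [He1 He1'] := He2 (inr j).
    apply/(order_pow ps n z HP (Ht (inr j)) He1 He1'); rewrite -[_%:Z]opprK.
    by apply/(ord_ge _ HP (Ht (inr j)) ov); apply: H1.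
  move=> Lz; have [->|z0] := eqVneq z 0; [by left|right] => P /(vring_place x_tr W_span W_pow) HP v ov.
  have [u Hu] := uniformizer_exists x_tr W_span W_pow HP; have [L1 L2] := Lz P HP.
  split=> [j /same_placeE E|nA].
    subst P; have [He1 He1'] := He2 (inr j).
    apply/(ord_ge _ HP (Ht (inr j)) ov); rewrite opprK.
    by apply/(order_pow ps n z HP (Ht (inr j)) He1 He1'); apply: L2; apply: Hh.
  apply/(ord_ge _ HP Hu ov); rewrite oppr0 expr0z mulr1; apply: L1.
  apply: boolp.contrapT => nh; have [[[]|j] E] := Hall P HP nh.
  exact: (nA j).
exists s, A, (\sum_i ((2 * (size p).-1 * n).+1 - delta i))%N; split.
- split=> [j|i j ij]; first by split; [apply/(vring_place x_tr W_span W_pow); apply: HO|exact: (Hf (inr j))].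
  by apply: (HOd (inr i) (inr j)); apply: contra ij => /eqP [->].
- by rewrite LE; apply: Lh_dim.
have dE : div_deg A = n%:Z * (\sum_i e i * f i)%N%:Z.
  rewrite /div_deg big_sumType /= [X in (X + _)%N]big1 ?add0n => [|[] //].
  rewrite -!natz natr_sum mulr_sumr; apply: eq_bigr => j _.
  by rewrite natrM !natz PoszM mulrA.
rewrite dE sum_ef; have := dim_large ps (leqnn n); rewrite -/n.
move: (\sum_i ((2 * _ * n).+1 - _))%N => s2; nia.
Qed.

Theorem reduced_basis_genus :
  is_genus (algebraic_over iota) (1 - #|T|%:Z + (\sum_i delta i)%N%:Z).
Proof.
rewrite algebraic_cstE; split; first exact: genus_upper.
by have [m [A [l [? ? ?]]]] := genus_attained; exists m, A, l.
Qed.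

End ReducedBasis.

(** * Existence of places *)

Lemma exp_mulV (F : fieldType) (z : F) i n : z != 0 -> (i <= n)%N ->
  z^-1 ^+ i * z ^+ n = z ^+ (n - i).
Proof. by move=> z0 le_in; rewrite -{1}(subnK le_in) exprD exprVn mulrC mulfK // expf_neq0. Qed.

Section Chevalley.
Variables (k F : fieldType) (iota : {rmorphism k -> F}).

Definition adjoin (R : F -> Prop) (z y : F) :=
  exists2 p : {poly F}, forall i, R p`_i & y = p.[z].

Lemma adjoin_algring R z : algring iota R -> algring iota (adjoin R z).
Proof.
move=> HR; split.
- move=> c; exists (iota c)%:P; rewrite ?hornerC // => i; rewrite coefC.
  by case: eqP => _; [apply: (algringC HR)|apply: (algring0 HR)].
- move=> _ _ [p Rp ->] [q Rq ->]; exists (p + q); rewrite ?hornerD // => i.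
  by rewrite coefD; apply: (algringD HR).
- move=> _ _ [p Rp ->] [q Rq ->]; exists (p * q); rewrite ?hornerM // => i.
  by rewrite coefM; apply: (algring_sum HR) => j _; apply: (algringM HR).
Qed.

Lemma adjoin_sub R z y : algring iota R -> R y -> adjoin R z y.
Proof.
move=> HR Ry; exists y%:P; rewrite ?hornerC // => i; rewrite coefC.
by case: eqP => _ //; apply: (algring0 HR).
Qed.

Lemma adjoin_gen R z : algring iota R -> adjoin R z z.
Proof.
move=> HR; exists 'X; rewrite ?hornerX // => i; rewrite coefX.
by case: eqP => _; [apply: (algring1 HR)|apply: (algring0 HR)].
Qed.

Variables (R0 : F -> Prop) (pi : F).
Hypothesis HR0 : algring iota R0.
Hypothesis R0pi : R0 pi.
Hypothesis pi_neq0 : pi != 0.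
Hypothesis pi_nunit : forall r, R0 r -> pi * r <> 1.

(** Saying that pi has no inverse in R, instead of naming a proper ideal, gives a condition that
    passes to unions of chains. *)
Definition proper_over (R : F -> Prop) :=
  [/\ algring iota R, forall z, R0 z -> R z & forall r, R r -> pi * r <> 1].

Lemma maximal_ring : exists2 R, proper_over R &
  forall R', proper_over R' -> (forall z, R z -> R' z) -> forall z, R' z -> R z.
Proof.
pose P (X : classical_sets.set F) := (forall z, ~ X z) \/ proper_over X.
have H0 : proper_over R0 by [].
have [|A [PA Amax]] := @classical_sets.Zorn_bigcup F P.
  move=> C CP Ctot.
  case: (boolp.pselect (exists2 G, C G & exists z, G z)) => [[G CG [g Gg]]|nex]; last first.
    by left=> z [X CX Xz]; apply: nex; exists X => //; exists z.
  have good X z : C X -> X z -> proper_over X by move=> /CP [nX|//] /nX.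
  have GG := good _ _ CG Gg.
  have comm X Y a b : C X -> X a -> C Y -> Y b -> exists2 Z, C Z & [/\ Z a, Z b & proper_over Z].
    move=> CX Xa CY Yb; case: (Ctot X Y CX CY) => s.
      by exists Y => //; split=> //; [apply: s|apply: good Yb].
    by exists X => //; split=> //; [apply: s|apply: good Xa].
  right; split.
  - split.
    + by move=> c; exists G => //; case: GG => /algringC.
    + move=> a b [X CX Xa] [Y CY Yb]; have [Z CZ [Za Zb [HZ _ _]]] := comm X Y a b CX Xa CY Yb.
      by exists Z => //; apply: (algringD HZ).
    + move=> a b [X CX Xa] [Y CY Yb]; have [Z CZ [Za Zb [HZ _ _]]] := comm X Y a b CX Xa CY Yb.
      by exists Z => //; apply: (algringM HZ).
  - by move=> z R0z; exists G => //; case: GG => _ + _; apply.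
  - by move=> r [X CX Xr]; have [_ _] := good _ _ CX Xr; apply.
have GA : proper_over A.
  case: PA => // nA; case: (Amax R0); last by right.
  by split=> [z /nA //|s]; apply: (nA (iota 0)); apply: s; apply: (algringC HR0).
exists A => // R' HR' AR' z R'z; apply: boolp.contrapT => nAz.
by apply: (Amax R'); [split=> // s; apply: nAz; apply: s|right].
Qed.

(** Chevalley's extension theorem. If neither z nor 1/z lay in the maximal ring, pi would become
    invertible after adjoining either; two such relations can be played against each other until
    their degrees drop to 0. *)
Lemma valuation_ring_exists : exists2 O, vring iota O & (forall z, R0 z -> O z) /\ maxideal O pi.
Proof.
have [O [RO R0O Opi] Omax] := maximal_ring.
have Oadj z : ~ O z -> exists2 p : {poly F}, forall i, O p`_i & pi * p.[z] = 1.
  move=> nO; apply: boolp.contrapT => nex; apply: nO.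
  apply: (Omax (adjoin O z)); last exact: adjoin_gen.
    split; first exact: adjoin_algring.
      by move=> y /R0O; apply: adjoin_sub.
    by move=> _ [p Op ->] pr; apply: nex; exists p.
  by move=> y; apply: adjoin_sub.
(* pi lies in the Jacobson radical. If u = 1 - pi b had no inverse in O, the relation for 1/u times
   a power of u would put that power in pi O, yet every power of u has the form 1 - pi c. *)
have Ounit b : O b -> O (1 - pi * b)^-1 /\ 1 - pi * b != 0.
  move=> Ob; set u := 1 - pi * b.
  have u0 : u != 0 by rewrite subr_eq0; apply/eqP => /esym; apply: Opi.
  have Ou : O u.
    by apply: (algringB RO); [apply: (algring1 RO)|apply: (algringM RO) => //; apply: R0O].
  split=> //; apply: boolp.contrapT => /Oadj [p Op pp].
  have E : u ^+ size p = pi * \sum_(i < size p) p`_i * u ^+ (size p - i).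
    rewrite -[LHS]mul1r -pp horner_coef -mulrA mulr_suml; congr (_ * _); apply: eq_bigr => i _.
    rewrite -mulrA; congr (_ * _).
    by rewrite exp_mulV // ltnW.
  have [c Oc Ec] : exists2 c, O c & u ^+ size p = 1 - pi * c.
    elim: (size p) => [|n [c Oc Ec]].
      by exists 0; rewrite ?expr0 ?mulr0 ?subr0 //; apply: (algring0 RO).
    exists (b + c * u); first by apply: (algringD RO) => //; apply: (algringM RO).
    by rewrite exprSr Ec /u; ring.
  apply: (Opi (c + \sum_(i < size p) p`_i * u ^+ (size p - i))).
    apply: (algringD RO) => //; apply: (algring_sum RO) => i _; apply: (algringM RO) => //.
    exact: (algringX RO).
  by rewrite mulrDr -E Ec addrC subrK.
have key N : forall n m z (p q : {poly F}), (n + m < N)%N -> z != 0 ->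
    (size p <= n.+1)%N -> (size q <= m.+1)%N ->
    (forall i, O p`_i) -> (forall i, O q`_i) -> pi * p.[z] = 1 -> pi * q.[z^-1] = 1 -> False.
  elim: N => // N IH n m z p q nmN z0.
  wlog mn : n m z p q nmN z0 / (m <= n)%N.
    move=> H sp sq Op Oq pp qq; case: (leqP m n) => mn; first exact: (H n m z p q).
    by apply: (H m n z^-1 q p); rewrite ?invrK ?invr_eq0 1?addnC // ltnW.
  move=> sp sq Op Oq pp qq.
  case: n nmN mn sp => [|n] nmN mn sp.
    apply: (Opi p`_0) => //; move: pp; rewrite (size1_polyC sp) hornerC coefC eqxx.
    by [].
  have [Ou u0] := Ounit q`_0 (Oq 0%N).
  set u := 1 - pi * q`_0 in Ou u0.
  (* The relation for 1/z reads u = pi (q_1/z + q_2/z^2 + ...), so z^(n+1) is pi/u times a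
     combination of lower powers; substituting it removes the leading term of p. *)
  pose p' := \poly_(i < n.+1) (p`_i + pi * p`_n.+1 / u * q`_(n.+1 - i)).
  apply: (IH n m z p' q) => //.
  - exact: size_poly.
  - move=> i; rewrite coef_poly; case: ltnP => _; last exact: (algring0 RO).
    apply: (algringD RO) => //; apply: (algringM RO) => //; apply: (algringM RO) => //.
    by apply: (algringM RO) => //; apply: R0O.
  - rewrite -[RHS]pp; congr (_ * _).
    have Eq : \sum_(i < n.+1) q`_(n.+1 - i) * z ^+ i = z ^+ n.+1 * (q.[z^-1] - q`_0).
      rewrite (@horner_coef_wide _ n.+2); last by apply: leq_trans sq _.
      rewrite [X in _ * (X - _)]big_ord_recl expr0 mulr1 addrAC subrr add0r mulr_sumr.
      rewrite (reindex_inj rev_ord_inj) /=; apply: eq_bigr => i _.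
      rewrite subSS /bump leq0n add1n mulrCA [z ^+ _ * _]mulrC exp_mulV //.
      by have -> : (n.+1 - (n - i) = i.+1)%N by have := ltn_ord i; lia.
    rewrite horner_poly (horner_coef_wide _ sp) [RHS]big_ord_recr /=.
    rewrite (eq_bigr (fun i : 'I_n.+1 =>
      p`_i * z ^+ i + pi * p`_n.+1 / u * (q`_(n.+1 - i) * z ^+ i))); last first.
      by move=> i _; rewrite mulrDl -[X in _ + X]mulrA.
    rewrite big_split /= -mulr_sumr Eq; congr (_ + _).
    have -> : q.[z^-1] - q`_0 = u / pi.
      by rewrite /u mulrBl mul1r mulrAC mulfV // mul1r -{1}[pi^-1]mulr1 -qq mulKf.
    by field; rewrite ?u0 ?pi_neq0.
have Oinv z : O z \/ O z^-1.
  case: (boolp.pselect (O z)) => [|nz]; [by left|right]; apply: boolp.contrapT => nzi.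
  have z0 : z != 0 by apply/eqP => E; apply: nz; rewrite E; apply: (algring0 RO).
  have [p Op pp] := Oadj _ nz; have [q Oq qq] := Oadj _ nzi.
  apply: (key (size p + size q).+1 (size p) (size q) z p q) => //.
have npi : ~ O pi^-1 by move=> /Opi; apply; rewrite mulfV.
exists O; first by split=> //; exists pi^-1.
by split=> //; split; [apply: R0O|right].
Qed.
End Chevalley.

Section Existence.
Variables (k F : fieldType) (iota : {rmorphism k -> F}) (x : F).
Hypothesis x_tr : transcendental_over iota x.

Lemma ev_algring y : algring iota (fun z => exists p, z = ev iota y p).
Proof.
split.
- by move=> c; exists c%:P; rewrite evC.
- by move=> _ _ [p ->] [q ->]; exists (p + q); rewrite rmorphD.
- by move=> _ _ [p ->] [q ->]; exists (p * q); rewrite rmorphM.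
Qed.

Lemma place_over (p : {poly k}) : (1 < size p)%N ->
  exists O, [/\ vring iota O, O x & maxideal O (ev iota x p)].
Proof.
move=> sp; have p0 : p != 0 by rewrite -size_poly_gt0 ltnW.
have [|||O HO [OR Op]] := @valuation_ring_exists _ _ iota (fun z => exists p, z = ev iota x p) (ev iota x p) (ev_algring x).
- by exists p.
- by rewrite (ev_eq0 x_tr).
- move=> _ [q ->]; rewrite -rmorphM => /eqP; rewrite -(rmorph1 (ev iota x)) -subr_eq0 -rmorphB (ev_eq0 x_tr).
  rewrite subr_eq0 => /eqP/(congr1 (fun q : {poly k} => size q)).
  have [->|q0] := eqVneq q 0; first by rewrite mulr0 size_poly0 size_poly1.
  rewrite size_mul // size_poly1; move: sp; rewrite -size_poly_gt0 in q0.
  by move: (size p) (size q) q0 => a b; clear; lia.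
by exists O; split=> //; apply: OR; exists 'X; rewrite evX.
Qed.

Lemma place_infinity : exists O, vring iota O /\ ~ O x.
Proof.
have x0 : x != 0 by rewrite -(evX iota x) (ev_eq0 x_tr) polyX_eq0.
have [|||O HO [OR Op]] := @valuation_ring_exists _ _ iota (fun z => exists p, z = ev iota x^-1 p) x^-1 (ev_algring x^-1).
- by exists 'X; rewrite evX.
- by rewrite invr_eq0.
- move=> _ [q ->] E; pose n := size q.
  (* Multiplied by x^(n+1), the relation equates x^(n+1) with a polynomial in x of degree at most
     n. *)
  have : ev iota x ('X^(n.+1) - \poly_(i < n.+1) q`_(n - i)) = 0.
    rewrite rmorphB rmorphXn /= evX (@evE _ _ _ _ _ n.+1 (size_poly _ _)).
    rewrite -[x ^+ n.+1]mulr1 -E (@evE _ _ _ _ q n.+1) ?leqnSn // exprSr -mulrA mulVKf //.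
    apply/eqP; rewrite subr_eq0 mulr_sumr [X in _ == X](reindex_inj rev_ord_inj) /=; apply/eqP.
    apply: eq_bigr => i _; rewrite coef_poly subSS ltnS leq_subr subKn -1?ltnS // mulrCA; congr (_ * _).
    by rewrite mulrC exp_mulV // -ltnS.
  move/eqP; rewrite (ev_eq0 x_tr) => /eqP/(congr1 (fun q : {poly k} => q`_n.+1)).
  by rewrite coefB coefXn eqxx coef_poly ltnn subr0 coef0 => /eqP; rewrite oner_eq0.
exists O; split=> // Ox; case: Op => _ [/eqP|]; first by rewrite invr_eq0 (negbTE x0).
by rewrite invrK.
Qed.
End Existence.

(** * Rational functions, separable polynomials and reciprocals *)

Local Notation "p %:F" := (@FracField.tofrac _ p) (at level 1, format "p %:F") : ring_scope.

Section FractionEval.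
Variables (R : idomainType) (F : fieldType) (f : {rmorphism R -> F}).
Hypothesis f_eq0 : forall a, (f a == 0) = (a == 0).

Lemma fractionP (z : {fraction R}) : exists ab : R * R, ab.2 != 0 /\ z = ab.1%:F / ab.2%:F.
Proof.
suff [a [b [b0 E]]] : exists a b : R, b != 0 /\ z * b%:F = a%:F.
  by exists (a, b); split; rewrite //= -E mulfK // tofrac_eq0.
elim/quotW: z => r; exists \n_r, \d_r; split; first exact: denom_ratioP.
rewrite -[LHS]/(FracField.mul _ _) !piE; apply/eqmodP.
rewrite /= FracField.equivfE /FracField.mulf.
by rewrite !numden_Ratio ?(oner_eq0, mulf_neq0, denom_ratioP) // !mulr1 mulrC.
Qed.

Lemma tofrac_div_eq (a b c d : R) : b != 0 -> d != 0 -> (a%:F / b%:F == c%:F / d%:F) = (a * d == c * b).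
Proof.
by move=> b0 d0; rewrite eqr_div ?tofrac_eq0 // -!tofracM tofrac_eq.
Qed.

(** A representative is chosen for each fraction; injectivity of [f] makes the quotient of the
    images independent of the choice. *)
Lemma fraction_morphism : exists phi : {rmorphism {fraction R} -> F}, forall a, phi a%:F = f a.
Proof.
pose num z := (sval (boolp.cid (fractionP z))).1.
pose den z := (sval (boolp.cid (fractionP z))).2.
have den0 z : den z != 0 by case: (svalP (boolp.cid (fractionP z))).
have zE z : z = (num z)%:F / (den z)%:F by case: (svalP (boolp.cid (fractionP z))).
pose phi z := f (num z) / f (den z).
have phiE a b : b != 0 -> phi (a%:F / b%:F) = f a / f b.
  move=> b0; have := zE (a%:F / b%:F); set z := _ / _ => /eqP.
  rewrite tofrac_div_eq // => /eqP E; apply/eqP.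
  by rewrite eqr_div ?f_eq0 // -!rmorphM E.
have phiF a : phi a%:F = f a by rewrite -[a%:F]divr1 -tofrac1 phiE ?oner_eq0 // rmorph1 divr1.
have phiB : zmod_morphism phi.
  move=> y z; rewrite {1}(zE y) {1}(zE z) -mulNr addf_div ?tofrac_eq0 //.
  rewrite -tofracN -!tofracM -tofracD phiE ?mulf_neq0 //.
  by rewrite rmorphD !rmorphM rmorphN /phi -mulNr addf_div ?f_eq0.
have phiM : monoid_morphism phi.
  split; first by rewrite -tofrac1 phiF rmorph1.
  move=> y z; rewrite {1}(zE y) {1}(zE z) mulf_div -!tofracM phiE ?mulf_neq0 //.
  by rewrite !rmorphM /phi mulf_div.
pose A := GRing.isZmodMorphism.Build _ _ phi phiB.
pose B := GRing.isMonoidMorphism.Build _ _ phi phiM.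
pose phi' : {rmorphism {fraction R} -> F} := HB.pack phi A B.
by exists phi'.
Qed.
End FractionEval.

Section Polynomials.
Variable k : fieldType.
Implicit Types f g A B P : {poly k}.

(** In the squarefree f the cofactor of gcd(f, A) is coprime to A, yet divides A^n; so it is
    constant. *)
Lemma separable_dvdp_exp f A n : separable_poly f -> f %| A ^+ n -> f %| A.
Proof.
move=> sf fA; have f0 := separable_poly_neq0 sf.
have gf : gcdp f A %| f by apply: dvdp_gcdl.
have fE := divpK gf; set f' := f %/ gcdp f A in fE.
have f'0 : f' != 0 by apply: contraNneq f0 => E; rewrite -fE E mul0r.
have cop : coprimep f' (gcdp f A) by apply: (separable_coprime sf); rewrite fE.
have cA : coprimep f' A.
  apply/coprimepP => u uf' uA.
  have uf : u %| f by rewrite -fE dvdp_mulr.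
  have ug : u %| gcdp f A by rewrite dvdp_gcd uf.
  by have /coprimepP/(_ u uf' ug) := cop.
have : f' %| A ^+ n by apply: dvdp_trans fA; rewrite -fE dvdp_mulr.
move/coprimep_dvdl/(_ (coprimep_expr n cA)).
rewrite coprimepp => /eqP s1.
have : f %= gcdp f A.
  rewrite -{1}fE; have /size_poly1P [c c0 ->] : size f' == 1 by rewrite s1.
  by rewrite mul_polyC eqp_scale.
by move/eqp_dvdl->; apply: dvdp_gcdr.
Qed.

(** The part of f prime to B drops out, so B^(n+1) divides g^n for g = gcd(f, B); as deg g <= deg B,
    this forces deg B = 0. *)
Lemma separable_exp_bound f B n : separable_poly f -> B ^+ n.+1 %| f ^+ n -> B != 0 -> size B = 1%N.
Proof.
move=> sf Bf B0; have f0 := separable_poly_neq0 sf.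
have gf : gcdp f B %| f by apply: dvdp_gcdl.
have fE := divpK gf; set f' := f %/ gcdp f B in fE.
have cop : coprimep f' (gcdp f B) by apply: (separable_coprime sf); rewrite fE.
have cB : coprimep f' B.
  apply/coprimepP => u uf' uA.
  have uf : u %| f by rewrite -fE dvdp_mulr.
  have ug : u %| gcdp f B by rewrite dvdp_gcd uf.
  by have /coprimepP/(_ u uf' ug) := cop.
have : B ^+ n.+1 %| gcdp f B ^+ n.
  move: Bf; rewrite -{1}fE exprMn Gauss_dvdpr //.
  by rewrite coprimep_sym; apply: coprimep_expl; apply: coprimep_expr.
have g0 : gcdp f B != 0 by rewrite gcdp_eq0 (negbTE f0).
move/dvdp_leq; rewrite expf_neq0 // => /(_ isT).
have : (size (gcdp f B) <= size B)%N by apply: dvdp_leq; rewrite ?dvdp_gcdr.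
have := size_exp B n.+1; have := size_exp (gcdp f B) n.
have : (0 < size B)%N by rewrite size_poly_gt0.
have : (0 < size (gcdp f B))%N by rewrite size_poly_gt0.
have : (0 < size (B ^+ n.+1))%N by rewrite size_poly_gt0 expf_neq0.
have : (0 < size (gcdp f B ^+ n))%N by rewrite size_poly_gt0 expf_neq0.
move: (size (B ^+ _)) (size (gcdp f B ^+ n)) (size B) (size (gcdp f B)); clear; nia.
Qed.

(** The f-adic exponent modulo n-th powers, for all irreducible factors of f at once. If a < b, then
    f divides A and not B, and f^n in A^n outweighs f^(b-a), so f would have to divide P2. *)
Lemma separable_valuation f A B P1 P2 n a b : separable_poly f -> (1 < size f)%N ->
  coprimep A B -> coprimep f P1 -> coprimep f P2 -> (a < n)%N -> (b < n)%N ->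
  A ^+ n * f ^+ a * P1 = B ^+ n * f ^+ b * P2 -> a = b.
Proof.
move=> sf f1 cAB c1 c2; have f0 := separable_poly_neq0 sf.
wlog ab : a b A B P1 P2 cAB c1 c2 / (a <= b)%N.
  move=> H an bn E; case/orP: (leq_total a b) => ab; first exact: (H a b A B P1 P2).
  by apply/esym; apply: (H b a B A P2 P1) => //; rewrite coprimep_sym.
move=> an bn; rewrite -(subnK ab) exprD => E.
case: (posnP (b - a)) => [ba|ba]; first lia.
have {}E : A ^+ n * P1 = B ^+ n * f ^+ (b - a) * P2.
  apply: (mulfI (expf_neq0 a f0)).
  rewrite mulrA [f ^+ a * _]mulrC E; ring.
have fA : f %| A.
  apply: (separable_dvdp_exp (n := n) sf); rewrite -(Gauss_dvdpl _ c1) E.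
  by rewrite dvdp_mulr // dvdp_mull // dvdp_exp.
have /dvdpP [A' AE] := fA.
have cB : coprimep f (B ^+ n).
  by apply: coprimep_expr; apply: coprimep_dvdr fA _.
have E2 : f ^+ (n - (b - a)) * (A' ^+ n * P1) = B ^+ n * P2.
  have E3 : f ^+ (b - a) * f ^+ (n - (b - a)) = f ^+ n by rewrite -exprD subnKC //; lia.
  apply: (mulfI (expf_neq0 (b - a) f0)) => /=.
  rewrite [LHS]mulrA E3 [LHS]mulrA -exprMn [f * A']mulrC -AE E.
  by ring.
have : f %| B ^+ n * P2 by rewrite -E2 dvdp_mulr // dvdp_exp // subn_gt0; lia.
rewrite (Gauss_dvdpr _ cB) => fP2.
have : coprimep f f by apply: coprimep_dvdl fP2 _.
by rewrite coprimepp => /eqP fs; rewrite fs in f1.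
Qed.

End Polynomials.

Section Reciprocal.
Variable k : fieldType.
Implicit Types f : {poly k}.

Lemma coef_recip f i : (i < size f)%N -> (recip f)`_i = f`_((size f).-1 - i).
Proof. by move=> lt_i; rewrite /recip coef_Poly nth_rev // -subn1 -subnDA add1n. Qed.

Lemma size_recip f : f.[0] != 0 -> size (recip f) = size f.
Proof.
rewrite horner_coef0 => f0; rewrite /recip.
have sf : (0 < size f)%N by rewrite size_poly_gt0; apply: contraNneq f0 => ->; rewrite coef0.
rewrite (@PolyK _ 0) ?size_rev //.
by rewrite -nth_last size_rev nth_rev ?prednK // subnn.
Qed.

Lemma recip0 f : f != 0 -> (recip f).[0] != 0.
Proof.
move=> f0; rewrite horner_coef0 coef_recip ?size_poly_gt0 // subn0 -lead_coefE.
by rewrite lead_coef_eq0.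
Qed.

(** X^n f(1/X) for deg f <= n. Unlike [recip], it is linear in f and applies to Bezout coefficients
    and derivatives. *)
Definition revn n f : {poly k} := \poly_(i < n.+1) f`_(n - i).

Lemma recip_revn f : f.[0] != 0 -> recip f = revn (size f).-1 f.
Proof.
move=> f0; have sf : (0 < size f)%N by rewrite size_poly_gt0; apply: contraNneq f0 => ->; rewrite horner0.
apply/polyP => i; rewrite coef_poly prednK //; case: ltnP => id; first by rewrite coef_recip.
by rewrite nth_default // size_recip.
Qed.

Section Inverse.
Variables (F : fieldType) (iota : {rmorphism k -> F}) (x : F).

Lemma ev_revn n f : x != 0 -> (size f <= n.+1)%N -> ev iota x (revn n f) = x ^+ n * ev iota x^-1 f.
Proof.
move=> x0 sf.
rewrite (evE _ _ (size_poly _ _)) (evE _ _ sf) mulr_sumr [LHS](reindex_inj rev_ord_inj) /=.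
apply: eq_bigr => i _; rewrite coef_poly subSS ltnS leq_subr subKn -1?ltnS // mulrCA; congr (_ * _).
by rewrite mulrC exp_mulV // -ltnS.
Qed.

Lemma ev_recip f : x != 0 -> f.[0] != 0 -> ev iota x (recip f) = x ^+ (size f).-1 * ev iota x^-1 f.
Proof. by move=> x0 f0; rewrite recip_revn // ev_revn // leqSpred. Qed.

Hypothesis x_tr : transcendental_over iota x.

(** Reversing a Bezout identity for f and its derivative writes a power of X as a combination of
    [recip f] and its derivative, while [recip f] does not vanish at 0. Polynomial identities are
    checked at the transcendental x. *)
Lemma separable_recip f : f.[0] != 0 -> separable_poly f -> separable_poly (recip f).
Proof.
move=> f00 sf; have f0 := separable_poly_neq0 sf.
have x0 : x != 0 by rewrite -(evX iota x) (ev_eq0 x_tr) polyX_eq0.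
have [d sd] : exists d, size f = d.+1 by exists (size f).-1; rewrite prednK // size_poly_gt0.
have recE : recip f = revn d f by rewrite recip_revn // sd.
have derE : revn d ('X * f^`()) = (recip f) *+ d - 'X * (recip f)^`().
  rewrite recE; apply/polyP => i; rewrite coefB coefMn coefXM coef_deriv !coef_poly.
  have H j : ('X * f^`())`_j = f`_j *+ j.
    by rewrite coefXM; case: j => [|j]; rewrite ?mulr0n //= coef_deriv.
  rewrite H; case: i => [|i] /=; first by rewrite subn0 subr0.
  case: ltnP => id; last by rewrite !mul0rn subrr.
  by rewrite -mulrnBr ?subKn // ltnW.
have sX : (size ('X * f^`())%R <= d.+1)%N.
  have [->|g0] := eqVneq f^`() 0; first by rewrite mulr0 size_poly0.
  have := lt_size_deriv f0; rewrite sd => sd'.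
  by rewrite mulrC size_mulX.
have sf' : (size f^`() <= d.+1)%N by rewrite -sd ltnW // lt_size_deriv.
have derE2 : revn d f^`() = 'X * revn d ('X * f^`()).
  have inj (p q : {poly k}) : ev iota x p = ev iota x q -> p = q.
    by move=> E; apply/eqP; rewrite -subr_eq0 -(ev_eq0 x_tr) rmorphB /= E subrr.
  by apply: inj; rewrite rmorphM /= !ev_revn // evX rmorphM /= evX mulrCA mulVKf.
have [[u v] /= uv] : exists uv : {poly k} * {poly k}, uv.1 * f + uv.2 * f^`() = 1.
  by apply/Bezout_eq1_coprimepP; move: sf; rewrite separable_poly.unlock.
pose n := maxn (size u) (size v).
have su : (size u <= n.+1)%N by rewrite leqW // leq_maxl.
have sv : (size v <= n.+1)%N by rewrite leqW // leq_maxr.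
have key : revn n u * recip f + revn n v * ('X * ((recip f) *+ d - 'X * (recip f)^`())) = 'X^(n + d).
  rewrite -derE -derE2 recE; apply/eqP; rewrite -subr_eq0 -(ev_eq0 x_tr) rmorphB rmorphD !rmorphM /=.
  rewrite !ev_revn ?sd // rmorphXn /= evX subr_eq0; apply/eqP.
  have := congr1 (ev iota x^-1) uv; rewrite rmorphD !rmorphM rmorph1 /= => uv1.
  by rewrite mulrACA [X in _ + X]mulrACA -mulrDr uv1 mulr1 exprD.
rewrite separable_poly.unlock; apply/coprimepP => w w1 w2.
have wX : w %| 'X^(n + d).
  rewrite -key dvdp_add //; first exact: dvdp_mull.
  apply: dvdp_mull; apply: dvdp_mull; rewrite dvdp_sub //; last exact: dvdp_mull.
  by rewrite -mulr_natr dvdp_mulr.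
have cX : coprimep (recip f) 'X^(n + d).
  by apply: coprimep_expr; rewrite coprimepX; apply: recip0.
by have /coprimepP/(_ w w1 wX) := cX.
Qed.
End Inverse.
End Reciprocal.

Section FiniteField.
Variable k : finFieldType.

Lemma finField_prim_root m : (0 < m)%N -> (m %| #|k|.-1)%N -> exists z : k, m.-primitive_root z.
Proof.
move=> m0 mk; have k1 := finRing_gt1 k; have n0 : (0 < #|k|.-1)%N by rewrite -subn1 subn_gt0.
have : has (#|k|.-1).-primitive_root (enum (predC1 (0 : k))).
  apply: has_prim_root => //; last by rewrite -cardE cardC1.
    apply/allP => z; rewrite mem_enum inE => z0; apply/unity_rootP.
    by apply: (mulfI z0); rewrite -exprS prednK 1?ltnW // expf_card mulr1.
  exact: enum_uniq.
by case/hasP => z _ Hz; exists (z ^+ (#|k|.-1 %/ m)); apply: dvdn_prim_root Hz _ mk.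
Qed.

(** X^|k| - X already has all its roots in k. *)
Lemma finField_unity_root (F : fieldType) (iota : {rmorphism k -> F}) (z : F) :
  z ^+ #|k|.-1 = 1 -> exists c, z = iota c.
Proof.
move=> z1; have k1 := finRing_gt1 k.
have zk : z ^+ #|k| = z by rewrite -[#|k|]prednK 1?ltnW // exprS z1 mulr1.
have := congr1 (fun p : {poly k} => (map_poly iota p).[z]) (finField_genPoly k).
rewrite rmorphB /= map_polyXn map_polyX hornerD hornerN hornerXn hornerX zk subrr rmorph_prod horner_prod.
move=> /esym/eqP; case/prodf_eq0 => c _.
by rewrite /= map_polyXsubC hornerXsubC subr_eq0 => /eqP ->; exists c.
Qed.
Lemma card_expD (F : fieldType) (iota : {rmorphism k -> F}) (a b : F) :
  (a + b) ^+ #|k| = a ^+ #|k| + b ^+ #|k|.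
Proof.
have [p pr pk] := finPcharP k; apply: exprDn_pchar.
have /pcharf_eq/eq_pnat-> := rmorph_pchar iota pk.
by have -> : #|k| = (p ^ logn p #|k|)%N := card_pprimeChar pk; rewrite pnatX pnat_id.
Qed.

Lemma card_exp_sum (F : fieldType) (iota : {rmorphism k -> F}) (I : finType) (a : I -> F) :
  (\sum_i a i) ^+ #|k| = \sum_i a i ^+ #|k|.
Proof.
apply: (big_morph (fun z => z ^+ #|k|)); first exact: card_expD iota.
by rewrite expr0n -[(#|k| == 0)%N]negbK -lt0n (ltnW (finRing_gt1 k)).
Qed.
Lemma ev_frobenius (F : fieldType) (iota : {rmorphism k -> F}) (z : F) (p : {poly k}) :
  ev iota z p ^+ #|k| = ev iota (z ^+ #|k|) p.
Proof.
rewrite !(evE _ _ (leqnn _)) (card_exp_sum iota); apply: eq_bigr => i _.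
by rewrite exprMn -rmorphXn expf_card exprAC.
Qed.
End FiniteField.

(** * Kummer extensions with two generators *)

Section Kummer.
Variables (k : finFieldType) (F : fieldType) (iota : {rmorphism k -> F}) (x y1 y2 : F).
(** [g1] and [g2] stand for the reciprocals. Only separability of the product and, later, equality
    of degrees enter, so the section applies equally to polynomials mapped into an extension of the
    constants. *)
Variables (m1 m2 s1 s2 : nat) (f1 g1 f2 g2 : {poly k}).
Hypothesis x_tr : transcendental_over iota x.
Hypotheses (m1_gt0 : (0 < m1)%N) (m2_gt0 : (0 < m2)%N).
Hypotheses (m1_dvd : (m1 %| #|k|.-1)%N) (m2_dvd : (m2 %| #|k|.-1)%N).
Hypothesis S_sep : separable_poly ('X * (f1 * g1) * (f2 * g2)).
Hypotheses (f1_size : (1 < size f1)%N) (f2_size : (1 < size f2)%N).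
Local Notation ev := (ev iota x).
Local Notation vring := (vring iota).
Hypothesis y1_eq : y1 ^+ m1 * ev g1 = x ^+ s1 * ev f1.
Hypothesis y2_eq : y2 ^+ m2 * ev g2 = x ^+ s2 * ev f2.
Hypothesis F_gen : generated_by iota [:: x; y1; y2].
(* [L] is a field of fractions of k[x], with its embedding [phi] in [F]. *)
Variables (L : fieldType) (emb : {rmorphism {poly k} -> L}).
Local Notation "p %:F" := (emb p) (at level 1, format "p %:F") : ring_scope.
Hypothesis emb_fraction : forall z, exists ab : {poly k} * {poly k}, ab.2 != 0 /\ z = ab.1%:F / ab.2%:F.
Variable phi : {rmorphism L -> F}.
Hypothesis phi_ev : forall a, phi a%:F = ev a.

Let N := (m1 * m2)%N.
Local Notation I := ('I_m1 * 'I_m2)%type.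
Implicit Types (i j : I).

Definition mono (i : I) := y1 ^+ i.1 * y2 ^+ i.2.

Lemma factors_neq0 : [/\ f1 != 0, g1 != 0, f2 != 0 & g2 != 0].
Proof.
have := separable_poly_neq0 S_sep; rewrite !mulf_eq0 !negb_or.
by move=> /andP [/andP [_ /andP [-> ->]] /andP [-> ->]].
Qed.

Lemma emb_eq0 (a : {poly k}) : (a%:F == 0) = (a == 0).
Proof. by rewrite -(fmorph_eq0 phi) phi_ev (ev_eq0 x_tr). Qed.

Lemma emb_neq0 (a : {poly k}) : a != 0 -> a%:F != 0. Proof. by rewrite emb_eq0. Qed.

Lemma frac_eq (a b c d : {poly k}) : b != 0 -> d != 0 -> (a%:F / b%:F == c%:F / d%:F) = (a * d == c * b).
Proof.
move=> b0 d0; rewrite eqr_div ?emb_eq0 // -!rmorphM -subr_eq0 -rmorphB.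
by rewrite emb_eq0 subr_eq0.
Qed.

Lemma phi_X : phi 'X%:F = x. Proof. by rewrite phi_ev evX. Qed.

Definition radicand1 : L := ('X^s1 * f1)%:F / g1%:F.
Definition radicand2 : L := ('X^s2 * f2)%:F / g2%:F.

Lemma radicand1_neq0 : radicand1 != 0.
Proof. by have [? ? ? ?] := factors_neq0; rewrite mulf_neq0 ?invr_neq0 ?emb_neq0 // mulf_neq0 // expf_neq0 // polyX_eq0. Qed.

Lemma radicand2_neq0 : radicand2 != 0.
Proof. by have [? ? ? ?] := factors_neq0; rewrite mulf_neq0 ?invr_neq0 ?emb_neq0 // mulf_neq0 // expf_neq0 // polyX_eq0. Qed.

Lemma y1_pow : y1 ^+ m1 = phi radicand1.
Proof.
have [_ g0 _ _] := factors_neq0.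
rewrite /radicand1 rmorphM fmorphV /= !phi_ev rmorphM rmorphXn /= evX -y1_eq mulfK //.
by rewrite (ev_eq0 x_tr).
Qed.

Lemma y2_pow : y2 ^+ m2 = phi radicand2.
Proof.
have [_ _ _ g0] := factors_neq0.
rewrite /radicand2 rmorphM fmorphV /= !phi_ev rmorphM rmorphXn /= evX -y2_eq mulfK //.
by rewrite (ev_eq0 x_tr).
Qed.

Lemma y1_neq0 : y1 != 0.
Proof. by apply: contraTneq isT => y0; have := fmorph_eq0 phi radicand1; rewrite -y1_pow y0 expr0n eqn0Ngt m1_gt0 eqxx (negbTE radicand1_neq0). Qed.

Lemma y2_neq0 : y2 != 0.
Proof. by apply: contraTneq isT => y0; have := fmorph_eq0 phi radicand2; rewrite -y2_pow y0 expr0n eqn0Ngt m2_gt0 eqxx (negbTE radicand2_neq0). Qed.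

Lemma mono_neq0 i : mono i != 0.
Proof. by rewrite mulf_neq0 // expf_neq0 ?y1_neq0 ?y2_neq0. Qed.

Lemma factors_coprime : [/\ separable_poly f1, separable_poly f2,
  [/\ coprimep f1 'X, coprimep f1 g1, coprimep f1 f2 & coprimep f1 g2] &
  [/\ coprimep f2 'X, coprimep f2 g2, coprimep f2 f1 & coprimep f2 g1]].
Proof.
have cop (u v w : {poly k}) : u * v * w = 'X * (f1 * g1) * (f2 * g2) -> coprimep u v.
  by move=> E; apply: (separable_coprime S_sep); rewrite -E dvdp_mulr.
split.
- apply: dvdp_separable S_sep; rewrite (_ : _ * _ = f1 * ('X * g1 * (f2 * g2))); last by ring.
  exact: dvdp_mulr.
- apply: dvdp_separable S_sep; rewrite (_ : _ * _ = f2 * ('X * (f1 * g1) * g2)); last by ring.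
  exact: dvdp_mulr.
- split.
  + by apply: (@cop _ _ (g1 * (f2 * g2))); ring.
  + by apply: (@cop _ _ ('X * (f2 * g2))); ring.
  + by apply: (@cop _ _ ('X * g1 * g2)); ring.
  + by apply: (@cop _ _ ('X * g1 * f2)); ring.
- split.
  + by apply: (@cop _ _ (f1 * g1 * g2)); ring.
  + by apply: (@cop _ _ ('X * (f1 * g1))); ring.
  + by apply: (@cop _ _ ('X * g1 * g2)); ring.
  + by apply: (@cop _ _ ('X * f1 * g2)); ring.
Qed.

Lemma mono_pow i : mono i ^+ N = phi (radicand1 ^+ (i.1 * m2) * radicand2 ^+ (i.2 * m1)).
Proof.
rewrite /mono exprMn -!exprM rmorphM !rmorphXn /= -y1_pow -y2_pow -!exprM.
by rewrite /N; congr (_ ^+ _ * _ ^+ _); lia.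
Qed.

Lemma frac_mulr (a b g : {poly k}) : g != 0 -> (a * g)%:F / (b * g)%:F = a%:F / b%:F.
Proof. by move=> /emb_neq0 g0; rewrite !rmorphM -mulf_div (divff g0) mulr1. Qed.

Lemma fraction_coprimeP (c : L) : c != 0 -> exists A B : {poly k}, [/\ A != 0, B != 0, coprimep A B & c = A%:F / B%:F].
Proof.
move=> c0; have [[a b] /= [b0 cE]] := emb_fraction c.
have a0 : a != 0 by apply: contraNneq c0 => a0; rewrite cE a0 rmorph0 mul0r.
pose g := gcdp a b; have g0 : g != 0 by rewrite gcdp_eq0 (negbTE a0).
have aE := divpK (dvdp_gcdl a b); have bE := divpK (dvdp_gcdr a b).
exists (a %/ g), (b %/ g); split.
- by apply: contraNneq a0 => E; rewrite -aE -/g E mul0r.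
- by apply: contraNneq b0 => E; rewrite -bE -/g E mul0r.
- by apply: coprimep_div_gcd; rewrite a0.
- rewrite cE; transitivity ((a %/ g * g)%:F / (b %/ g * g)%:F); first by rewrite /g aE bE.
  exact: frac_mulr.
Qed.

(** In N-th powers the exponents of f1 and f2 are multiples of m2 and m1 below N, so
    [separable_valuation] recovers them modulo N-th powers of k(x). *)
Lemma mono_ratio i j c : phi c * mono i = mono j -> i = j.
Proof.
move=> E; have [f10 g10 f20 g20] := factors_neq0.
have c0 : c != 0 by apply: contraTneq isT => c0; have := mono_neq0 j; rewrite -E c0 rmorph0 mul0r eqxx.
have [A [B [A0 B0 cAB cE]]] := fraction_coprimeP c0.
have := congr1 (fun z => z ^+ N) E; rewrite exprMn !mono_pow -rmorphXn -rmorphM => /fmorph_inj.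
rewrite cE /radicand1 /radicand2 !expr_div_n !mulf_div -!rmorphXn -!rmorphM => /eqP.
rewrite frac_eq ?mulf_neq0 ?expf_neq0 // => /eqP.
rewrite !exprMn -!exprM.
set a1 := (i.1 * m2)%N; set a2 := (i.2 * m1)%N; set b1 := (j.1 * m2)%N; set b2 := (j.2 * m1)%N.
move=> E2.
have [sf1 sf2 [c11 c12 c13 c14] [c21 c22 c23 c24]] := factors_coprime.
have lt1 (n : 'I_m1) : (n * m2 < N)%N by rewrite ltn_pmul2r.
have lt2 (n : 'I_m2) : (n * m1 < N)%N by rewrite /N mulnC ltn_pmul2l.
have a1b1 : a1 = b1.
  apply: (@separable_valuation _ f1 A B
    ('X^(s1 * a1) * ('X^(s2 * a2) * f2 ^+ a2) * (g1 ^+ b1 * g2 ^+ b2))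
    ('X^(s1 * b1) * ('X^(s2 * b2) * f2 ^+ b2) * (g1 ^+ a1 * g2 ^+ a2)) N) => //.
  - by rewrite !coprimepMr !coprimep_expr.
  - by rewrite !coprimepMr !coprimep_expr.
  - exact: lt1.
  - exact: lt1.
  - transitivity (A ^+ N * ('X^(s1 * a1) * f1 ^+ a1 * ('X^(s2 * a2) * f2 ^+ a2)) * (g1 ^+ b1 * g2 ^+ b2)); first by ring.
    by rewrite E2; ring.
have a2b2 : a2 = b2.
  apply: (@separable_valuation _ f2 A B
    ('X^(s1 * a1) * ('X^(s2 * a2) * f1 ^+ a1) * (g1 ^+ b1 * g2 ^+ b2))
    ('X^(s1 * b1) * ('X^(s2 * b2) * f1 ^+ b1) * (g1 ^+ a1 * g2 ^+ a2)) N) => //.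
  - by rewrite !coprimepMr !coprimep_expr.
  - by rewrite !coprimepMr !coprimep_expr.
  - exact: lt2.
  - exact: lt2.
  - transitivity (A ^+ N * ('X^(s1 * a1) * f1 ^+ a1 * ('X^(s2 * a2) * f2 ^+ a2)) * (g1 ^+ b1 * g2 ^+ b2)); first by ring.
    by rewrite E2; ring.
have e1 : i.1 = j.1 by apply/ord_inj/eqP; rewrite -(eqn_pmul2r m2_gt0); apply/eqP.
have e2 : i.2 = j.2 by apply/ord_inj/eqP; rewrite -(eqn_pmul2r m1_gt0); apply/eqP.
by rewrite [i]surjective_pairing [j]surjective_pairing e1 e2.
Qed.

(* With q = #|k|, the (q-1)-st power of a monomial lies in k(x). Raising a relation to the q-th power therefore
   multiplies its terms by elements of k(x), which produces a shorter relation. *)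
Lemma mono_free (c : I -> L) : \sum_i phi (c i) * mono i = 0 -> forall i, c i = 0.
Proof.
have [n] := ubnP #|[pred i | c i != 0]|; elim: n c => // n IH c.
rewrite ltnS => le_n Hc; apply: boolp.contrapT => /boolp.existsNP [i0 /eqP ci0].
pose q1 := #|k|.-1.
have k1 := finRing_gt1 k.
have Hh i : exists h, (phi (c i) * mono i) ^+ q1 = phi h.
  exists (c i ^+ q1 * (radicand1 ^+ (i.1 * (q1 %/ m1)) * radicand2 ^+ (i.2 * (q1 %/ m2)))).
  rewrite exprMn rmorphM rmorphXn; congr (_ * _).
  rewrite /mono exprMn -!exprM rmorphM !rmorphXn /= -y1_pow -y2_pow -!exprM.
  by congr (_ ^+ _ * _ ^+ _); rewrite mulnCA -[in RHS](mulnC (_ %/ _)%N) divnK.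
have [h Hh'] := boolp.choice Hh.
have Hq : \sum_i phi (c i * h i) * mono i = 0.
  have := congr1 (fun z => z ^+ #|k|) Hc; rewrite (card_exp_sum iota) expr0n.
  have -> : (#|k| == 0)%N = false by apply/negbTE; rewrite -lt0n ltnW.
  rewrite mulr0n => E; transitivity (\sum_i (phi (c i) * mono i) ^+ #|k|); last exact: E.
  have kq : #|k| = q1.+1 by rewrite prednK // ltnW.
  by apply: eq_bigr => i _; rewrite kq exprS Hh' rmorphM /= mulrAC.
(* Subtracting h_i0 times the relation from its q-th power cancels the term at i0. *)
have H0 i : c i * (h i - h i0) = 0.
  move: i; apply: IH.
    apply: leq_trans le_n; apply: proper_card; apply/properP; split.
      by apply/subsetP => i; rewrite !inE; apply: contraNneq => ->; rewrite mul0r.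
    by exists i0; rewrite !inE // subrr mulr0 eqxx.
  transitivity (\sum_i phi (c i * h i) * mono i - phi (h i0) * \sum_i phi (c i) * mono i).
    rewrite mulr_sumr -sumrB; apply: eq_bigr => i _.
    by rewrite mulrBr rmorphB !rmorphM /=; ring.
  by rewrite Hq Hc mulr0 subrr.
have cE i : i != i0 -> c i = 0.
  move=> ii0; apply/eqP/negPn/negP => ci.
  have /eqP := H0 i; rewrite mulf_eq0 (negbTE ci) subr_eq0 /= => /eqP hh.
  have gi0 : phi (c i0) * mono i0 != 0 by rewrite mulf_neq0 ?fmorph_eq0 ?mono_neq0.
  (* Two terms with equal (q-1)-st powers differ by a constant, which [mono_ratio] excludes. *)
  have [d Hd] : exists d, phi (c i) * mono i / (phi (c i0) * mono i0) = iota d.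
    apply: finField_unity_root; rewrite expr_div_n !Hh' hh divff // -Hh'.
    exact: expf_neq0.
  case/eqP: ii0; apply: (@mono_ratio _ _ (c i / (d%:P%:F * c i0))).
  have d0 : iota d != 0.
    by rewrite -Hd mulf_neq0 ?invr_neq0 // mulf_neq0 ?fmorph_eq0 ?mono_neq0.
  rewrite fmorph_div rmorphM /= phi_ev evC -Hd.
  have := mono_neq0 i; have := mono_neq0 i0.
  move: gi0; rewrite mulf_eq0 negb_or fmorph_eq0 => /andP [H1 _] H2 H3.
  field.
  by rewrite !fmorph_eq0 H2 H3 ci0 ci.
have := Hc; rewrite (bigD1 i0) //= big1 ?addr0 => [/eqP|i ii0]; last by rewrite cE // rmorph0 mul0r.
by rewrite mulf_eq0 fmorph_eq0 (negbTE ci0) (negbTE (mono_neq0 i0)).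
Qed.

Lemma mono_mod (a b : nat) : exists2 c : L, c != 0 &
  exists i, [/\ nat_of_ord i.1 = (a %% m1)%N, nat_of_ord i.2 = (b %% m2)%N & y1 ^+ a * y2 ^+ b = phi c * mono i].
Proof.
exists (radicand1 ^+ (a %/ m1) * radicand2 ^+ (b %/ m2)).
  by rewrite mulf_neq0 // expf_neq0 ?radicand1_neq0 ?radicand2_neq0.
exists (Ordinal (ltn_pmod a m1_gt0), Ordinal (ltn_pmod b m2_gt0)); split=> //=.
rewrite /mono /= rmorphM !rmorphXn /= -y1_pow -y2_pow -!exprM {1}(divn_eq a m1) {1}(divn_eq b m2) !exprD.
by rewrite mulrACA ![(m1 * _)%N]mulnC ![(m2 * _)%N]mulnC.
Qed.

Definition kspan (z : F) := exists c : I -> L, z = \sum_i phi (c i) * mono i.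

Lemma kspanD a b : kspan a -> kspan b -> kspan (a + b).
Proof.
move=> [c ->] [d ->]; exists (fun i => c i + d i); rewrite -big_split /=.
by apply: eq_bigr => i _; rewrite rmorphD mulrDl.
Qed.

Lemma kspan_mono c (a b : nat) : kspan (phi c * (y1 ^+ a * y2 ^+ b)).
Proof.
have [d _ [i [_ _ ->]]] := mono_mod a b.
exists (fun j => if j == i then c * d else 0); rewrite (bigD1 i) //= eqxx big1 ?addr0.
  by rewrite rmorphM mulrA.
by move=> j /negbTE->; rewrite rmorph0 mul0r.
Qed.

Lemma kspan_phi c : kspan (phi c).
Proof. by have := kspan_mono c 0 0; rewrite !expr0 !mulr1. Qed.

Lemma kspan_sum (J : finType) (f : J -> F) : (forall l, kspan (f l)) -> kspan (\sum_l f l).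
Proof.
move=> Hf; elim/big_rec: _ => [|l z _]; last exact: kspanD.
by rewrite -(rmorph0 phi); apply: kspan_phi.
Qed.

Lemma mono_mul i j : mono i * mono j = y1 ^+ (i.1 + j.1) * y2 ^+ (i.2 + j.2).
Proof. by rewrite /mono mulrACA -!exprD. Qed.

Lemma kspanM a b : kspan a -> kspan b -> kspan (a * b).
Proof.
move=> [c ->] [d ->]; rewrite mulr_suml; apply: kspan_sum => i.
rewrite mulr_sumr; apply: kspan_sum => j.
by rewrite mulrACA -rmorphM mono_mul; apply: kspan_mono.
Qed.

Lemma kspanX a n : kspan a -> kspan (a ^+ n).
Proof.
move=> Ha; elim: n => [|n IH]; last by rewrite exprS; apply: kspanM.
by rewrite expr0 -(rmorph1 phi); apply: kspan_phi.
Qed.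

Lemma algebraic_phi z : algebraicOver phi z.
Proof.
apply: F_gen z.
- move=> c; rewrite -(evC iota x c) -phi_ev; exact: algebraic_id.
- have root_alg y m (u : L) : (0 < m)%N -> y ^+ m = phi u -> algebraicOver phi y.
    move=> m0 yu; exists ('X^m - u%:P); first by rewrite -size_poly_eq0 size_XnsubC.
    by rewrite rmorphB /= map_polyXn map_polyC rootE hornerD hornerN hornerXn hornerC yu subrr.
  move=> z; rewrite !inE => /or3P [/eqP->|/eqP->|/eqP->].
  + by rewrite -phi_X; apply: algebraic_id.
  + exact: root_alg m1_gt0 y1_pow.
  + exact: root_alg m2_gt0 y2_pow.
- exact: algebraic_add.
- exact: algebraic_opp.
- exact: algebraic_mul.
- exact: algebraic_inv.
Qed.

(** An algebraic equation for a, stripped of its factors X, has nonzero constant term and expresses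
    1/a as a polynomial in a. *)
Lemma kspanV a : kspan a -> kspan a^-1.
Proof.
have [->|a0] := eqVneq a 0; first by rewrite invr0.
move=> Ha; have [p] := algebraic_phi a.
have [n] := ubnP (size p); elim: n p => // n IH p; rewrite ltnS => sp p0 ra.
have [p00|p00] := eqVneq p`_0 0.
  have /factor_theorem [q pE] : root p 0 by rewrite rootE horner_coef0 p00.
  rewrite subr0 in pE.
  have q0 : q != 0 by apply: contraNneq p0 => E; rewrite pE E mul0r.
  apply: (IH q) => //; first by move: sp; rewrite pE size_mulX.
  by move: ra; rewrite pE rmorphM /= map_polyX rootM rootX (negbTE a0) orbF.
have [d sd] : exists d, size p = d.+1 by exists (size p).-1; rewrite prednK // size_poly_gt0.
have : (map_poly phi p).[a] / a = 0 by rewrite (rootP ra) mul0r.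
rewrite (@horner_coef_wide _ d.+1) ?size_map_poly ?sd // big_ord_recl /= expr0 mulr1 mulrDl coef_map /= => /eqP.
rewrite addr_eq0 => /eqP E.
have -> : a^-1 = phi (- (p`_0)^-1) * \sum_(i < d) phi p`_i.+1 * a ^+ i.
  apply: (mulfI (x := phi p`_0)); first by rewrite fmorph_eq0.
  rewrite E mulrA -rmorphM mulrN mulfV // rmorphN1 mulN1r mulr_suml; congr (- _).
  by apply: eq_bigr => l _; rewrite coef_map /bump leq0n add1n exprSr mulrA mulfK.
apply: kspanM; first exact: kspan_phi.
apply: kspan_sum => l; apply: kspanM; first exact: kspan_phi.
exact: kspanX.
Qed.

(** With [mono_free] this gives [F : k(x)] = m1 m2. *)
Lemma kspan_all z : kspan z.
Proof.
apply: F_gen z.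
- by move=> c; rewrite -(evC iota x c) -phi_ev; apply: kspan_phi.
- move=> z; rewrite !inE => /or3P [/eqP->|/eqP->|/eqP->].
  + by rewrite -phi_X; apply: kspan_phi.
  + by have := kspan_mono 1 1 0; rewrite rmorph1 mul1r expr0 mulr1.
  + by have := kspan_mono 1 0 1; rewrite rmorph1 !mul1r.
- exact: kspanD.
- by move=> a Ha; rewrite -mulN1r -(rmorphN1 phi); apply: kspanM => //; apply: kspan_phi.
- exact: kspanM.
- exact: kspanV.
Qed.

Definition coord z : I -> L := sval (boolp.cid (kspan_all z)).

Lemma coordE z : z = \sum_i phi (coord z i) * mono i.
Proof. exact: (svalP (boolp.cid (kspan_all z))). Qed.

Lemma mono_uniq (c d : I -> L) : \sum_i phi (c i) * mono i = \sum_i phi (d i) * mono i -> c =1 d.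
Proof.
move=> E i; apply/eqP; rewrite -subr_eq0; apply/eqP; move: i; apply: mono_free.
under eq_bigr => i _ do rewrite rmorphB mulrBl.
by rewrite sumrB E subrr.
Qed.

(** * The diagonal action of the Galois group *)

Section Galois.
Variables z1 z2 : k.
Hypotheses (z1_root : z1 ^+ m1 = 1) (z2_root : z2 ^+ m2 = 1).

Definition chi i := z1 ^+ i.1 * z2 ^+ i.2.

Definition gal z := \sum_i phi (coord z i) * (iota (chi i) * mono i).

Lemma galE (c : I -> L) : gal (\sum_i phi (c i) * mono i) = \sum_i phi (c i) * (iota (chi i) * mono i).
Proof.
by apply: eq_bigr => i _; rewrite (mono_uniq (esym (coordE (\sum_i phi (c i) * mono i)))).
Qed.

Lemma galD a b : gal (a + b) = gal a + gal b.
Proof.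
rewrite [in LHS](coordE a) [in LHS](coordE b) -big_split /=.
under eq_bigr => i _ do rewrite -mulrDl -rmorphD.
by rewrite galE -big_split /=; apply: eq_bigr => i _; rewrite rmorphD mulrDl.
Qed.

(** Reducing exponents modulo m1 and m2 changes a monomial by a factor in k(x) and leaves the
    character unchanged; multiplicativity of [gal] rests on this. *)
Lemma gal_mono c (a b : nat) :
  gal (phi c * (y1 ^+ a * y2 ^+ b)) = phi c * (iota (z1 ^+ a * z2 ^+ b) * (y1 ^+ a * y2 ^+ b)).
Proof.
have [d _ [i [i1 i2 ->]]] := mono_mod a b.
have -> : phi c * (phi d * mono i) = \sum_j phi (if j == i then c * d else 0) * mono j.
  rewrite (bigD1 i) //= eqxx big1 ?addr0; first by rewrite rmorphM mulrA.
  by move=> j /negbTE->; rewrite rmorph0 mul0r.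
rewrite galE (bigD1 i) //= eqxx big1 ?addr0; last by move=> j /negbTE->; rewrite rmorph0 mul0r.
rewrite /chi i1 i2 !expr_mod // !rmorphM; ring.
Qed.

Lemma gal_phi c : gal (phi c) = phi c.
Proof. by have := gal_mono c 0 0; rewrite !expr0 !mulr1 rmorph1 !mulr1. Qed.

Lemma gal0 : gal 0 = 0. Proof. by rewrite -{1}(rmorph0 phi) gal_phi rmorph0. Qed.
Lemma gal1 : gal 1 = 1. Proof. by rewrite -{1}(rmorph1 phi) gal_phi rmorph1. Qed.

Lemma gal_sum (J : finType) (f : J -> F) : gal (\sum_l f l) = \sum_l gal (f l).
Proof. exact: (big_morph gal galD gal0). Qed.

Lemma galM a b : gal (a * b) = gal a * gal b.
Proof.
rewrite (coordE a) (coordE b) !galE mulr_suml gal_sum mulr_suml; apply: eq_bigr => i _.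
rewrite mulr_sumr gal_sum mulr_sumr; apply: eq_bigr => j _.
rewrite mulrACA -rmorphM mono_mul gal_mono -mono_mul !exprD /chi !rmorphM /=; ring.
Qed.

Lemma galV a : gal a^-1 = (gal a)^-1.
Proof.
have [->|a0] := eqVneq a 0; first by rewrite invr0 gal0 invr0.
have E : gal a * gal a^-1 = 1 by rewrite -galM mulfV // gal1.
have ga0 : gal a != 0 by apply: contraTneq isT => g0; have := oner_eq0 F; rewrite -E g0 mul0r eqxx.
by apply: (mulfI ga0); rewrite E mulfV.
Qed.

Lemma gal_ev p : gal (ev p) = ev p. Proof. by rewrite -phi_ev gal_phi. Qed.
Lemma gal_x : gal x = x. Proof. by rewrite -phi_X gal_phi. Qed.
Lemma gal_cst c : gal (iota c) = iota c. Proof. by rewrite -(evC iota x c) gal_ev. Qed.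
Lemma gal_y1 : gal y1 = iota z1 * y1.
Proof. by have := gal_mono 1 1 0; rewrite rmorph1 !mul1r !mulr1. Qed.
Lemma gal_y2 : gal y2 = iota z2 * y2.
Proof. by have := gal_mono 1 0 1; rewrite rmorph1 !mul1r. Qed.

End Galois.

Lemma mono_pow_ev i : exists (a b : {poly k}), b != 0 /\ mono i ^+ N * ev b = ev a.
Proof.
have [[a b] /= [b0 E]] := emb_fraction (radicand1 ^+ (i.1 * m2) * radicand2 ^+ (i.2 * m1)).
exists a, b; split=> //; rewrite mono_pow E rmorphM fmorphV /= !phi_ev mulfVK //.
by rewrite (ev_eq0 x_tr).
Qed.

Lemma N_gt0 : (0 < N)%N. Proof. by rewrite muln_gt0 m1_gt0. Qed.

Lemma mono_pow_ex i : exists n (a b : {poly k}), [/\ (0 < n)%N, b != 0 & mono i ^+ n * ev b = ev a].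
Proof. by have [a [b [b0 E]]] := mono_pow_ev i; exists N, a, b; split=> //; apply: N_gt0. Qed.

Lemma phi_common_den (c : I -> L) : exists (b : {poly k}) (a : I -> {poly k}),
  b != 0 /\ forall i, phi (c i) * ev b = ev (a i).
Proof.
have /boolp.choice [ab Hab] i := emb_fraction (c i).
exists (\prod_i (ab i).2), (fun i => (ab i).1 * \prod_(j | j != i) (ab j).2); split.
  by apply/prodf_neq0 => i _; case: (Hab i).
move=> i; have [b0 ->] := Hab i; rewrite (bigD1 i) //= !rmorphM fmorphV /= !phi_ev mulrA mulfVK //.
by rewrite (ev_eq0 x_tr).
Qed.

Lemma mono_span z : exists (b : {poly k}) (a : I -> {poly k}), b != 0 /\ z * ev b = \sum_i ev (a i) * mono i.
Proof.
have [b [a [b0 Hab]]] := phi_common_den (coord z); exists b, a; split=> //.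
rewrite {1}(coordE z) mulr_suml; apply: eq_bigr => i _.
by rewrite -Hab mulrAC.
Qed.

(** The conjugate ring is again proper because O has a pole already in k(x), which [gal] fixes. *)
Lemma vring_gal z1 z2 O : z1 ^+ m1 = 1 -> z2 ^+ m2 = 1 -> vring O -> vring (fun z => O (gal z1 z2 z)).
Proof.
move=> r1 r2 HO; have RO := vring_ring HO; split.
- split=> [c|a b|a b]; first by rewrite gal_cst //; apply: (algringC RO).
    by rewrite galD; apply: (algringD RO).
  by rewrite galM //; apply: (algringM RO).
- by move=> z; rewrite galV //; case: HO.
have [h [d [[A [B [B0 _ _ hB]]] nh]]] := vring_pole x_tr mono_span mono_pow_ex HO.
exists h; suff -> : gal z1 z2 h = h by [].
have -> : h = ev A * (ev B)^-1 by rewrite -hB mulfK // (ev_eq0 x_tr).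
by rewrite galM // galV // !gal_ev.
Qed.

(** Instead of averaging over the group, the components j other than i are removed one at a time:
    for a conjugation whose character separates i from j, subtracting chi(j) kills j and multiplies
    i by a nonzero constant. *)
Lemma component (B : F -> Prop) (c : I -> L) : subsp iota B ->
  (forall z1 z2 z, z1 ^+ m1 = 1 -> z2 ^+ m2 = 1 -> B z -> B (gal z1 z2 z)) ->
  B (\sum_i phi (c i) * mono i) -> forall i, B (phi (c i) * mono i).
Proof.
move=> sB galB Bc i; have [B0 BD BZ] := sB.
have [w1 Hw1] := finField_prim_root m1_gt0 m1_dvd.
have [w2 Hw2] := finField_prim_root m2_gt0 m2_dvd.
have H (s : seq I) : i \notin s -> exists kap : I -> k,
   [/\ kap i != 0, forall j, j \in s -> kap j = 0 & B (\sum_l phi (c l) * (iota (kap l) * mono l))].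
  elim: s => [_|j s IH].
    exists (fun=> 1); split; rewrite ?oner_eq0 //.
    by under eq_bigr => l _ do rewrite rmorph1 mul1r.
  rewrite in_cons negb_or => /andP [ij /IH [kap [ki ks Bk]]].
  have [z1 [z2 [r1 r2 sep]]] : exists z1 z2, [/\ z1 ^+ m1 = 1, z2 ^+ m2 = 1 & chi z1 z2 i != chi z1 z2 j].
    have [e1|n1] := eqVneq i.1 j.1.
      exists 1, w2; rewrite expr1n (prim_expr_order Hw2) /chi !expr1n !mul1r; split=> //.
      rewrite (eq_prim_root_expr Hw2) !modn_small //; apply: contra ij => /eqP e2.
      by rewrite [i]surjective_pairing [j]surjective_pairing e1 (ord_inj e2).
    exists w1, 1; rewrite expr1n (prim_expr_order Hw1) /chi !expr1n !mulr1; split=> //.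
    by rewrite (eq_prim_root_expr Hw1) !modn_small //; apply: contra n1 => /eqP/ord_inj->.
  exists (fun l => (chi z1 z2 l - chi z1 z2 j) * kap l); split.
  - by rewrite mulf_neq0 // subr_eq0.
  - by move=> l; rewrite in_cons => /orP [/eqP->|/ks->]; rewrite ?subrr ?mul0r ?mulr0.
  have := galB z1 z2 _ r1 r2 Bk.
  have E : \sum_l phi (c l) * (iota (kap l) * mono l) = \sum_l phi (c l * (kap l)%:P%:F) * mono l.
    by apply: eq_bigr => l _; rewrite rmorphM /= phi_ev evC mulrA.
  rewrite {1}E galE => Bg.
  have := subspB sB Bg (BZ (chi z1 z2 j) _ Bk); congr B.
  rewrite mulr_sumr -sumrB; apply: eq_bigr => l _.
  by rewrite (rmorphM phi) (rmorphM iota (_ - _)) (rmorphB iota) /= phi_ev evC; ring.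
have [|kap [ki ks Bk]] := H (rem i (enum {: I})).
  by rewrite mem_rem_uniq ?enum_uniq // inE eqxx.
have {ks} ks j : j != i -> kap j = 0 by move=> ji; apply: ks; rewrite mem_rem_uniq ?enum_uniq // inE ji mem_enum.
have := BZ (kap i)^-1 _ Bk; rewrite (bigD1 i) //= big1 ?addr0; last first.
  by move=> j /ks->; rewrite rmorph0 mul0r mulr0.
by rewrite mulrCA [iota _ * (iota _ * _)]mulrA -rmorphM mulVf // rmorph1 mul1r.
Qed.

(** A nonconstant reduced denominator vanishes at some place, where regularity would make the
    numerator vanish too, against Bezout. *)
Lemma finite_polynomial (a b : {poly k}) : b != 0 ->
  (forall O, vring O -> O x -> O (ev a / ev b)) -> b %| a.
Proof.
move=> b0 Hab; pose g := gcdp a b; have g0 : g != 0 by rewrite gcdp_eq0 (negbTE b0) andbF.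
have aE : a %/ g * g = a by rewrite divpK // dvdp_gcdl.
have bE : b %/ g * g = b by rewrite divpK // dvdp_gcdr.
have b'0 : b %/ g != 0 by apply: contraNneq b0 => E; rewrite -bE E mul0r.
have cop : coprimep (a %/ g) (b %/ g) by apply: coprimep_div_gcd; rewrite b0 orbT.
have [sb|sb] := leqP (size (b %/ g)) 1.
  have /size_poly1P [c c0 bc] : size (b %/ g) == 1 by rewrite eqn_leq sb size_poly_gt0.
  by rewrite -bE bc mul_polyC dvdpZl // dvdp_gcdl.
have [O [HO Ox mb]] := place_over x_tr sb; have RO := vring_ring HO.
have ma : maxideal O (ev (a %/ g)).
  have := maxidealMl HO (Hab O HO Ox) mb; congr (maxideal O).
  rewrite -[in ev a]aE -[in X in _ / X]bE !rmorphM /= -mulf_div divff ?(ev_eq0 x_tr) // mulr1.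
  by rewrite mulfVK // (ev_eq0 x_tr).
have [[u v] /= uv] := Bezout_eq1_coprimepP _ _ cop.
case: (maxideal_1 HO); rewrite -(rmorph1 ev) -uv rmorphD !rmorphM /=.
by apply: (maxidealD HO); apply: (maxidealMl HO) => //; apply: ev_ring.
Qed.

Lemma infinite_degree O (p : {poly k}) n : vring O -> ~ O x -> p != 0 -> O (ev p / x ^+ n) -> (size p <= n.+1)%N.
Proof.
move=> HO nx p0 Op; have [_ Op'] := ev_inf x_tr HO nx p0.
rewrite leqNgt; apply/negP => lt; apply: nx.
apply: (@vring_X _ _ iota O HO _ ((size p).-1 - n)); first lia.
have := algringM (vring_ring HO) Op' Op; congr O.
have evp0 : ev p != 0 by rewrite (ev_eq0 x_tr).
have -> : (size p).-1 = ((size p).-1 - n + n)%N by rewrite subnK //; lia.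
rewrite addnK exprD; move: ((size p).-1 - n)%N => m.
by field; rewrite evp0 expf_neq0 // (x_neq0 x_tr).
Qed.

Hypotheses (g1_size : size g1 = size f1) (g2_size : size g2 = size f2).

(* [wbasis i ^+ N] is the polynomial [wnorm i], whose roots have multiplicity less than N. Hence the
   [wbasis i] form an integral basis over k[x], and it is reduced at infinity, where [wbasis i] has a
   pole of order [wdelta i] (measured by the order of x and rounded up). *)
Definition xexp i := (i.1 * s1 * m2 + i.2 * s2 * m1)%N.
(** At a zero of g1 the monomial has a pole of order i.1/m1 < 1 in units of g1, so one factor clears
    it exactly when i.1 > 0; likewise for g2. *)
Definition den i : {poly k} := g1 ^+ (0 < i.1)%N * g2 ^+ (0 < i.2)%N.
Definition scal i : L := (den i)%:F / 'X%:F ^+ (xexp i %/ N).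
Definition wbasis i := phi (scal i) * mono i.
Definition wnorm i : {poly k} := 'X^(xexp i %% N) *
  (f1 ^+ (i.1 * m2) * g1 ^+ (N * (0 < i.1) - i.1 * m2)) *
  (f2 ^+ (i.2 * m1) * g2 ^+ (N * (0 < i.2) - i.2 * m1)).
Definition wdelta i := ((size f1).-1 * (0 < i.1) + (size f2).-1 * (0 < i.2) + (0 < xexp i %% N))%N.

Lemma X_neq0 : 'X%:F != 0. Proof. by rewrite emb_eq0 polyX_eq0. Qed.

Lemma scal_neq0 i : scal i != 0.
Proof.
have [_ g10 _ g20] := factors_neq0.
by rewrite mulf_neq0 ?invr_neq0 ?expf_neq0 ?X_neq0 // emb_neq0 // mulf_neq0 // expf_neq0.
Qed.

Lemma exp1_lt i : (i.1 * m2 < N)%N. Proof. by rewrite ltn_pmul2r. Qed.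
Lemma exp2_lt i : (i.2 * m1 < N)%N. Proof. by rewrite /N mulnC ltn_pmul2l. Qed.

Lemma exp1_le i : (i.1 * m2 <= N * (0 < i.1))%N.
Proof. by have := exp1_lt i; case: (nat_of_ord i.1) => [|n] /= H; rewrite ?mul0n // muln1 ltnW. Qed.

Lemma exp2_le i : (i.2 * m1 <= N * (0 < i.2))%N.
Proof. by have := exp2_lt i; case: (nat_of_ord i.2) => [|n] /= H; rewrite ?mul0n // muln1 ltnW. Qed.

Lemma wnorm_identity (E : fieldType) (X F1 G1 F2 G2 : E) n p1 p2 e1 e2 a b q r t1 t2 :
  X != 0 -> G1 != 0 -> G2 != 0 -> (n * p1 = e1 + a)%N -> (n * p2 = e2 + b)%N ->
  (t1 * a + t2 * b = q * n + r)%N ->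
  (G1 ^+ p1 * G2 ^+ p2 / X ^+ q) ^+ n * ((X ^+ t1 * F1 / G1) ^+ a * (X ^+ t2 * F2 / G2) ^+ b) =
  X ^+ r * (F1 ^+ a * G1 ^+ e1) * (F2 ^+ b * G2 ^+ e2).
Proof.
move=> X0 G10 G20 E1 E2 E3; rewrite !exprMn !exprVn -!exprM [(p1 * n)%N]mulnC [(p2 * n)%N]mulnC E1 E2.
have EX : X ^+ (t1 * a) * X ^+ (t2 * b) = X ^+ (q * n) * X ^+ r by rewrite -!exprD E3.
rewrite !exprD.
transitivity (X ^+ (t1 * a) * X ^+ (t2 * b) / X ^+ (q * n) * (F1 ^+ a * G1 ^+ e1) * (F2 ^+ b * G2 ^+ e2)).
  by field; rewrite !expf_neq0.
by rewrite EX; field; rewrite expf_neq0.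
Qed.

Lemma wbasis_pow i : wbasis i ^+ N = ev (wnorm i).
Proof.
have [_ g10 _ g20] := factors_neq0.
rewrite exprMn mono_pow -rmorphXn -rmorphM -phi_ev; congr (phi _).
rewrite /scal /den /wnorm /radicand1 /radicand2 !rmorphM !rmorphXn /=.
apply: wnorm_identity; rewrite ?X_neq0 ?emb_neq0 //.
- by rewrite subnK // exp1_le.
- by rewrite subnK // exp2_le.
- by rewrite -(divn_eq (xexp i) N) /xexp; lia.
Qed.

Lemma size_mul_pred (p q : {poly k}) : p != 0 -> q != 0 -> (size (p * q)%R).-1 = ((size p).-1 + (size q).-1)%N.
Proof. by move=> p0 q0; rewrite size_mul //; move: p0 q0; rewrite -!size_poly_gt0; move: (size p) (size q); clear; lia. Qed.

Lemma wnorm_neq0 i : wnorm i != 0.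
Proof. by have [? ? ? ?] := factors_neq0; rewrite !mulf_neq0 ?expf_neq0 // polyX_eq0. Qed.

Lemma wnorm_degree i : (size (wnorm i)).-1 =
  (xexp i %% N + N * ((size f1).-1 * (0 < i.1) + (size f2).-1 * (0 < i.2)))%N.
Proof.
have [f10 g10 f20 g20] := factors_neq0.
have X0 : 'X^(xexp i %% N) != 0 :> {poly k} by rewrite expf_neq0 // polyX_eq0.
have A0 a b : f1 ^+ a * g1 ^+ b != 0 by rewrite mulf_neq0 ?expf_neq0.
have B0 a b : f2 ^+ a * g2 ^+ b != 0 by rewrite mulf_neq0 ?expf_neq0.
rewrite /wnorm (size_mul_pred (mulf_neq0 X0 (A0 _ _)) (B0 _ _)) (size_mul_pred X0 (A0 _ _)).
rewrite !(size_mul_pred (expf_neq0 _ _) (expf_neq0 _ _)) // !size_exp g1_size g2_size size_polyX mul1n.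
rewrite -addnA; congr (_ + _)%N; rewrite -!mulnDr !subnKC ?exp1_le ?exp2_le //.
by rewrite mulnDr; congr (_ + _)%N; rewrite mulnCA.
Qed.

Lemma wnorm_size i : (size (wnorm i) <= (N * wdelta i).+1)%N.
Proof.
have s0 : (0 < size (wnorm i))%N by rewrite size_poly_gt0 wnorm_neq0.
have Hr : (xexp i %% N <= N * (0 < xexp i %% N))%N.
  by have := ltn_pmod (xexp i) N_gt0; case: (xexp i %% N)%N => // n H; rewrite muln1 ltnW.
by rewrite -(prednK s0) wnorm_degree ltnS /wdelta [X in (_ <= X)%N]mulnDr addnC leq_add2l.
Qed.

(** Root multiplicities below N, in the form required by [separable_exp_bound]. *)
Lemma wnorm_dvd i : wnorm i %| ('X * (f1 * g1) * (f2 * g2)) ^+ N.-1.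
Proof.
have := N_gt0; have := exp1_lt i; have := exp2_lt i; have := ltn_pmod (xexp i) N_gt0.
have H1 : (N * (0 < i.1) - i.1 * m2 <= N.-1)%N.
  have := N_gt0; have := m2_gt0; case: (nat_of_ord i.1) => [|n] /=; first by rewrite muln0.
  rewrite muln1 mulSn; move: N (n * m2)%N => u v; lia.
have H2 : (N * (0 < i.2) - i.2 * m1 <= N.-1)%N.
  have := N_gt0; have := m1_gt0; case: (nat_of_ord i.2) => [|n] /=; first by rewrite muln0.
  rewrite muln1 mulSn; move: N (n * m1)%N => u v; lia.
move=> H3 H4 H5 H6; rewrite !exprMn /wnorm.
have le_pred a : (a < N)%N -> (a <= N.-1)%N by move: H6; case: N.
by rewrite !dvdp_mul ?dvdp_exp2l ?H1 ?H2 ?le_pred.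
Qed.

Lemma wbasis_fin O i : vring O -> O x -> O (wbasis i).
Proof.
move=> HO Ox; apply: (vring_X HO N_gt0); rewrite wbasis_pow.
by apply: ev_ring => //; apply: vring_ring HO.
Qed.

Lemma wbasis_inf O i : vring O -> ~ O x -> O (wbasis i / x ^+ wdelta i).
Proof.
move=> HO nx; apply: (vring_X HO N_gt0); rewrite expr_div_n wbasis_pow -exprM mulnC.
by apply: (ev_inf_le x_tr HO nx); apply: wnorm_size.
Qed.

Lemma wbasisE (c : I -> L) : \sum_i phi (c i) * wbasis i = \sum_i phi (c i * scal i) * mono i.
Proof. by apply: eq_bigr => i _; rewrite rmorphM mulrA. Qed.

Lemma wbasis_evE (a : I -> {poly k}) : \sum_i ev (a i) * wbasis i = \sum_i phi ((a i)%:F * scal i) * mono i.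
Proof. by rewrite -wbasisE; apply: eq_bigr => i _; rewrite phi_ev. Qed.

Lemma wbasis_free (a : I -> {poly k}) : \sum_i ev (a i) * wbasis i = 0 -> forall i, a i = 0.
Proof.
rewrite wbasis_evE => /mono_free H i; have /eqP := H i.
by rewrite mulf_eq0 (negbTE (scal_neq0 i)) orbF emb_eq0 => /eqP.
Qed.

Lemma wbasis_coord z : exists c : I -> L, z = \sum_i phi (c i) * wbasis i.
Proof.
exists (fun i => coord z i / scal i); rewrite wbasisE {1}(coordE z); apply: eq_bigr => i _.
by rewrite mulfVK // scal_neq0.
Qed.

Lemma wbasis_span z : exists (b : {poly k}) (a : I -> {poly k}), b != 0 /\ z * ev b = \sum_i ev (a i) * wbasis i.
Proof.
have [c ->] := wbasis_coord z.
have [b [a [b0 Hab]]] := phi_common_den c; exists b, a; split=> //.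
by rewrite mulr_suml; apply: eq_bigr => i _; rewrite -Hab mulrAC.
Qed.

Lemma wbasis_pow_ex i : exists n (a b : {poly k}), [/\ (0 < n)%N, b != 0 & wbasis i ^+ n * ev b = ev a].
Proof.
exists N, (wnorm i), 1; rewrite oner_eq0 rmorph1 mulr1 wbasis_pow; split=> //; exact: N_gt0.
Qed.

Lemma wbasis_component (B : F -> Prop) (c : I -> L) : subsp iota B ->
  (forall z1 z2 z, z1 ^+ m1 = 1 -> z2 ^+ m2 = 1 -> B z -> B (gal z1 z2 z)) ->
  B (\sum_i phi (c i) * wbasis i) -> forall i, B (phi (c i) * wbasis i).
Proof.
move=> sB gB; rewrite wbasisE => Bc i; rewrite mulrA -rmorphM.
exact: (component sB gB Bc i).
Qed.

(** By the Galois action each component A/B times [wbasis i] is regular. Its N-th power shows that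
    B^N divides [wnorm i], whose multiplicities are below N, so B is constant. *)
Lemma wbasis_reg z : (forall O, vring O -> O x -> O z) -> exists a : I -> {poly k}, z = \sum_i ev (a i) * wbasis i.
Proof.
move=> Hz; have [c zE] := wbasis_coord z.
have Hc i : forall O, vring O -> O x -> O (phi (c i) * wbasis i).
  apply: (wbasis_component (B := fun z => forall O, vring O -> O x -> O z)); last by rewrite -zE.
    split=> [O HO _|a b Ha Hb O HO Ox|d a Ha O HO Ox]; have RO := vring_ring HO.
    - exact: (algring0 RO).
    - by apply: (algringD RO); [apply: Ha|apply: Hb].
    - by apply: (algringM RO); [apply: (algringC RO)|apply: Ha].
  move=> z1 z2 y r1 r2 Hy O HO Ox; apply: (Hy _ (vring_gal r1 r2 HO)).
  by rewrite gal_x.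
have /boolp.choice [a Ha] i : exists a : {poly k}, phi (c i) = ev a.
  have [->|c0] := eqVneq (c i) 0; first by exists 0; rewrite !rmorph0.
  have [A [B [A0 B0 cAB cE]]] := fraction_coprimeP c0.
  have BN0 : B ^+ N != 0 by rewrite expf_neq0.
  have BP : B ^+ N %| A ^+ N * wnorm i.
    apply: finite_polynomial => // O HO Ox.
    have := algringX (vring_ring HO) N (Hc i O HO Ox).
    rewrite exprMn wbasis_pow cE (rmorphM phi) fmorphV /= !phi_ev; move: (wnorm i) => P.
    rewrite expr_div_n rmorphM !rmorphXn /=.
    by congr O; rewrite mulrAC.
  have BS : B ^+ N.-1.+1 %| ('X * (f1 * g1) * (f2 * g2)) ^+ N.-1.
    rewrite prednK ?N_gt0 //; apply: dvdp_trans (wnorm_dvd i); rewrite -(Gauss_dvdpr _ (q := A ^+ N)) //.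
    by rewrite coprimep_sym; apply: coprimep_expl; apply: coprimep_expr.
  have /eqP/size_poly1P [b b0 Bb] := separable_exp_bound S_sep BS B0.
  exists (b^-1%:P * A); rewrite cE Bb rmorphM fmorphV /= !phi_ev rmorphM /= !evC fmorphV mulrC //.
by exists a; rewrite zE; apply: eq_bigr => i _; rewrite Ha.
Qed.

(** Rounding up: v - 1 + e + r/M <= n, and a positive r makes v - 1 + e < n. *)
Lemma degree_arith u v e r M n : (0 < M)%N -> (0 < v)%N -> (0 < u)%N ->
  u.-1 = (v.-1 * M + (r + M * e))%N -> (u <= (n * M).+1)%N -> (v <= n.+1 - (e + (0 < r)))%N.
Proof.
move=> M0 v0 u0 uE le; have [r0|r0] := posnP r; first by rewrite addn0; nia.
by rewrite addn1; nia.
Qed.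

Lemma wbasis_deg (a : I -> {poly k}) n :
  (forall O, vring O -> ~ O x -> O ((\sum_i ev (a i) * wbasis i) / x ^+ n)) ->
  forall i, (size (a i) <= n.+1 - wdelta i)%N.
Proof.
move=> Ha i.
have {Ha} Hc : forall O, vring O -> ~ O x -> O (phi (a i)%:F * wbasis i / x ^+ n).
  apply: (wbasis_component (B := fun z => forall O, vring O -> ~ O x -> O (z / x ^+ n)) (c := fun i => (a i)%:F)).
  - split=> [O HO _|b c Hb Hc O HO nx|d b Hb O HO nx]; have RO := vring_ring HO.
    + by rewrite mul0r; apply: (algring0 RO).
    + by rewrite mulrDl; apply: (algringD RO); [apply: Hb|apply: Hc].
    + by rewrite -mulrA; apply: (algringM RO); [apply: (algringC RO)|apply: Hb].
  - move=> z1 z2 z r1 r2 Hz O HO nx.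
    have := Hz _ (vring_gal r1 r2 HO); rewrite (gal_x r1 r2) => /(_ nx).
    have xn : x ^+ n = ev 'X^n by rewrite rmorphXn /= evX.
    by rewrite xn (galM r1 r2) (galV r1 r2) (gal_ev r1 r2).
  - move=> O HO nx; have := Ha O HO nx; congr (O (_ / _)).
    by apply: eq_bigr => j _; rewrite phi_ev.
have [->|a0] := eqVneq (a i) 0; first by rewrite size_poly0.
have [O [HO nx]] := place_infinity x_tr.
have := algringX (vring_ring HO) N (Hc O HO nx).
rewrite expr_div_n exprMn wbasis_pow phi_ev -rmorphXn -rmorphM -exprM => /infinite_degree H.
have {H} := H HO nx _; rewrite mulf_neq0 ?expf_neq0 ?wnorm_neq0 // => /(_ isT).
have aN0 : a i ^+ N != 0 by rewrite expf_neq0.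
have u0 : (0 < size (a i ^+ N * wnorm i)%R)%N by rewrite size_poly_gt0 mulf_neq0 ?wnorm_neq0.
have uE := size_mul_pred aN0 (wnorm_neq0 i); rewrite size_exp wnorm_degree in uE.
by apply: (degree_arith N_gt0 _ u0 uE); rewrite size_poly_gt0.
Qed.

Definition izero : I := (Ordinal m1_gt0, Ordinal m2_gt0).

Lemma wbasis_one : wbasis izero = 1.
Proof.
rewrite /wbasis /scal /den /mono /xexp /= !mul0n div0n !expr0 !mulr1 rmorph1 divr1.
by rewrite rmorph1.
Qed.

Lemma wdelta_pos i : i != izero -> (0 < wdelta i)%N.
Proof.
move=> ii; have [i1|i1] := posnP i.1.
  have [i2|i2] := posnP i.2.
    by case/eqP: ii; rewrite [i]surjective_pairing; congr (_, _); apply: ord_inj.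
  rewrite /wdelta i2; move: f2_size; lia.
rewrite /wdelta i1; move: f1_size; lia.
Qed.

Theorem kummer_genus : is_genus (algebraic_over iota) (1 - N%:Z + (\sum_i wdelta i)%N%:Z).
Proof.
have -> : N = #|{: I}| by rewrite card_prod !card_ord.
exact: (reduced_basis_genus x_tr wbasis_span wbasis_pow_ex wbasis_fin wbasis_inf wbasis_free wbasis_reg wbasis_deg
  wbasis_one wdelta_pos).
Qed.

(** * Places of degree one over x = alpha *)

Section RationalFiber.
Variables (alpha b1 b2 : k).
Hypotheses (b1_neq0 : b1 != 0) (b2_neq0 : b2 != 0).
Hypotheses (g1_alpha : g1.[alpha] != 0) (g2_alpha : g2.[alpha] != 0).
Hypothesis b1_eq : b1 ^+ m1 * g1.[alpha] = alpha ^+ s1 * f1.[alpha].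
Hypothesis b2_eq : b2 ^+ m2 * g2.[alpha] = alpha ^+ s2 * f2.[alpha].

Lemma ev_residue O (p : {poly k}) : vring O -> O x -> maxideal O (x - iota alpha) ->
  maxideal O (ev p - iota p.[alpha]).
Proof.
move=> HO Ox mx; have /factor_theorem [q pE] : root (p - p.[alpha]%:P) alpha.
  by rewrite rootE hornerD hornerN hornerC subrr.
have -> : ev p - iota p.[alpha] = ev q * (x - iota alpha).
  by rewrite -(evC iota x p.[alpha]) -rmorphB pE rmorphM rmorphB /= evX evC.
by apply: (maxidealMl HO) => //; apply: ev_ring => //; apply: vring_ring HO.
Qed.

(* The residue of [y] is a root of [Y ^+ m - b ^+ m], which splits over k. *)
Lemma root_residue O y (b z : k) m s (f g : {poly k}) : vring O -> O x -> maxideal O (x - iota alpha) ->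
  (0 < m)%N -> m.-primitive_root z -> b != 0 -> g.[alpha] != 0 ->
  y ^+ m * ev g = x ^+ s * ev f -> b ^+ m * g.[alpha] = alpha ^+ s * f.[alpha] ->
  exists l : nat, maxideal O (y - iota (b * z ^+ l)).
Proof.
move=> HO Ox mx m0 Hz b0 ga yE bE; have RO := vring_ring HO.
have ib0 : iota b != 0 by rewrite fmorph_eq0.
have ig0 : iota g.[alpha] != 0 by rewrite fmorph_eq0.
have [Og eg0] : O (ev g)^-1 /\ ev g != 0.
  have [H1 H2] := unit_cstD HO ga (ev_residue g HO Ox mx).
  by move: H1 H2; rewrite addrC subrK.
have my : maxideal O (y ^+ m - iota b ^+ m).
  have H1 := ev_residue ('X^s * f) HO Ox mx; have H2 := ev_residue g HO Ox mx.
  have -> : y ^+ m - iota b ^+ m = ((ev ('X^s * f) - iota ('X^s * f).[alpha]) -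
      iota b ^+ m * (ev g - iota g.[alpha])) * (ev g)^-1.
    apply: (mulIf eg0); rewrite mulfVK // mulrBl yE hornerM hornerXn -bE !rmorphM !rmorphXn /= evX.
    by ring.
  apply: (maxidealMr HO) => //; apply: (maxidealB HO) => //; apply: (maxidealMl HO) => //.
  by apply: (algringX RO); apply: (algringC RO).
have mY : maxideal O (\prod_(0 <= l < m) (y / iota b - iota (z ^+ l))).
  have := congr1 (fun p : {poly k} => (map_poly iota p).[y / iota b]) (factor_Xn_sub_1 Hz).
  rewrite rmorph_prod /= horner_prod rmorphB /= map_polyXn rmorph1 hornerD hornerXn hornerN hornerC.
  under eq_bigr => l _ do rewrite map_polyXsubC hornerXsubC.
  move=> ->; rewrite expr_div_n.
  have -> : y ^+ m / iota b ^+ m - 1 = (y ^+ m - iota b ^+ m) * iota (b ^- m).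
    by rewrite mulrBl fmorphV rmorphXn mulfV // expf_neq0.
  by apply: (maxidealMr HO) => //; apply: (algringC RO).
have Oy : O (y / iota b).
  apply: (vring_X HO m0); rewrite expr_div_n -rmorphXn -fmorphV; apply: (algringM RO); last exact: (algringC RO).
  rewrite -[y ^+ m](subrK (iota b ^+ m)); apply: (algringD RO); first by case: my.
  by apply: (algringX RO); apply: (algringC RO).
have [l _ ml] : exists2 l, l \in index_iota 0 m & maxideal O (y / iota b - iota (z ^+ l)).
  apply: (maxideal_prod HO) mY => l.
  by apply: (algringB RO) => //; apply: (algringC RO).
exists l; have -> : y - iota (b * z ^+ l) = iota b * (y / iota b - iota (z ^+ l)).
  by rewrite mulrBr mulrCA mulfV // mulr1 rmorphM.
by apply: (maxidealMl HO) => //; apply: (algringC RO).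
Qed.

Lemma maxideal_gal z1 z2 O z : z1 ^+ m1 = 1 -> z2 ^+ m2 = 1 -> maxideal O (gal z1 z2 z) ->
  maxideal (fun z => O (gal z1 z2 z)) z.
Proof.
move=> r1 r2 [Oz Hz]; split=> //; have [z0|z0] := eqVneq z 0; [by left|right].
rewrite galV //; case: Hz => [gz0|//].
have : gal z1 z2 z * gal z1 z2 z^-1 = 1 by rewrite -galM // mulfV // gal1.
by rewrite gz0 mul0r => /esym/eqP; rewrite oner_eq0.
Qed.

(** The conjugates of one place over alpha are told apart by the residues of y1 and y2, which
    conjugation multiplies by distinct pairs of roots of unity. *)
Lemma gal_fiber : exists O : I -> F -> Prop,
  [/\ forall i, vring (O i), forall i, maxideal (O i) (x - iota alpha) &
      forall i j, i != j -> ~ same_place (O i) (O j)].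
Proof.
have [w1 Hw1] := finField_prim_root m1_gt0 m1_dvd.
have [w2 Hw2] := finField_prim_root m2_gt0 m2_dvd.
have sX : (1 < size ('X - alpha%:P)%R)%N by rewrite size_XsubC.
have [O [HO Ox mx]] := place_over x_tr sX; have RO := vring_ring HO.
rewrite rmorphB /= evX evC in mx.
have [l1 ml1] := root_residue HO Ox mx m1_gt0 Hw1 b1_neq0 g1_alpha y1_eq b1_eq.
have [l2 ml2] := root_residue HO Ox mx m2_gt0 Hw2 b2_neq0 g2_alpha y2_eq b2_eq.
have r1 (n : nat) : (w1 ^+ n) ^+ m1 = 1 by rewrite exprAC (prim_expr_order Hw1) expr1n.
have r2 (n : nat) : (w2 ^+ n) ^+ m2 = 1 by rewrite exprAC (prim_expr_order Hw2) expr1n.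
pose P i := fun z => O (gal (w1 ^+ i.1) (w2 ^+ i.2) z).
have HP i : vring (P i) by apply: vring_gal.
have H1 i : maxideal (P i) (y1 - iota (w1 ^+ i.1 * (b1 * w1 ^+ l1))).
  apply: maxideal_gal => //; rewrite -mulN1r -(rmorphN1 iota) -rmorphM galD gal_y1 // gal_cst //.
  have -> : iota (w1 ^+ i.1) * y1 + iota (- 1 * (w1 ^+ i.1 * (b1 * w1 ^+ l1))) =
     iota (w1 ^+ i.1) * (y1 - iota (b1 * w1 ^+ l1)) by rewrite !rmorphM rmorphN1; ring.
  by apply: (maxidealMl HO) => //; apply: (algringC RO).
have H2 i : maxideal (P i) (y2 - iota (w2 ^+ i.2 * (b2 * w2 ^+ l2))).
  apply: maxideal_gal => //; rewrite -mulN1r -(rmorphN1 iota) -rmorphM galD gal_y2 // gal_cst //.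
  have -> : iota (w2 ^+ i.2) * y2 + iota (- 1 * (w2 ^+ i.2 * (b2 * w2 ^+ l2))) =
     iota (w2 ^+ i.2) * (y2 - iota (b2 * w2 ^+ l2)) by rewrite !rmorphM rmorphN1; ring.
  by apply: (maxidealMl HO) => //; apply: (algringC RO).
have res_uniq i (y : F) (c d : k) : maxideal (P i) (y - iota c) -> maxideal (P i) (y - iota d) -> c = d.
  move=> Hc Hd; apply/eqP; rewrite -subr_eq0; apply/eqP; apply: (maxideal_cst (HP i)).
  have -> : iota (c - d) = (y - iota d) - (y - iota c) by rewrite rmorphB; ring.
  exact: (maxidealB (HP i) Hd Hc).
have w10 : w1 != 0 by rewrite (prim_root_eq0 Hw1) -lt0n.
have w20 : w2 != 0 by rewrite (prim_root_eq0 Hw2) -lt0n.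
exists P; split=> // [i|i j ij /same_placeE E].
  apply: maxideal_gal => //; rewrite -mulN1r -(rmorphN1 iota) -rmorphM galD gal_x // gal_cst // rmorphM rmorphN1.
  by rewrite mulN1r.
case/eqP: ij; rewrite [i]surjective_pairing [j]surjective_pairing; congr (_, _); apply: ord_inj; apply/eqP.
  have := H1 i; rewrite E => /res_uniq/(_ (H1 j))/mulIf.
  rewrite mulf_neq0 ?expf_neq0 // => /(_ isT)/eqP; rewrite (eq_prim_root_expr Hw1).
  by rewrite !modn_small.
have := H2 i; rewrite E => /res_uniq/(_ (H2 j))/mulIf.
rewrite mulf_neq0 ?expf_neq0 // => /(_ isT)/eqP; rewrite (eq_prim_root_expr Hw2).
by rewrite !modn_small.
Qed.

Lemma rational_fiber : exists O : I -> F -> Prop,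
  [/\ forall i, rational_place (cst iota) (O i), forall i, maxideal (O i) (x - iota alpha) &
      forall i j, i != j -> ~ same_place (O i) (O j)].
Proof.
have [O [HO mO HOd]] := gal_fiber; exists O; split=> // i0; split.
  by apply/(vring_place x_tr mono_span mono_pow_ex).
have xa : x - iota alpha = ev ('X - alpha%:P) by rewrite rmorphB /= evX evC.
have xa0 : x - iota alpha != 0 by rewrite xa (ev_eq0 x_tr) polyXsubC_eq0.
pose h := (x - iota alpha)^-1; have h0 : h != 0 by rewrite invr_eq0.
have nh i : ~ O i h by apply/(maxidealVP (HO i) xa0).
have Hh : ratx iota x h 1.
  exists 1, ('X - alpha%:P); rewrite polyXsubC_eq0 size_poly1 size_XsubC rmorph1 -xa.
  by split=> //; rewrite mulVf.
have /boolp.choice [t Ht] i := uniformizer_exists x_tr mono_span mono_pow_ex (HO i).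
have /boolp.choice [e He] i : exists e : nat, (0 < e)%N /\ O i (h * t i ^+ e) /\ O i (h * t i ^+ e)^-1.
  by have [e ? ?] := pole_order x_tr mono_span mono_pow_ex (HO i) (Ht i) (nh i); exists e.
split.
  have [v [sv [Ov Hv]]] := lind_indep (lind1 (HO i0)) (S := O i0) (fun=> algring1 (vring_ring (HO i0))).
  by exists v; rewrite sv card_ord.
move=> v Ov /indep_lind Hv.
(* [h] has degree 1, so the sum of the e f is at most N. Counting a single residue at each of the
   other N - 1 places leaves room for just one at [i0]. *)
pose f i := if i == i0 then size v else 1%N.
have Hom i : exists om : 'I_(f i) -> F, (forall b, O i (om b)) /\ lind iota (maxideal (O i)) om.
  rewrite /f; case: eqP => [->|_]; last first.
    by exists (fun=> 1); split; [move=> _; apply: algring1 (vring_ring (HO i))|apply: lind1].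
  by exists (fun b => v`_b); split=> // b; apply: Ov; rewrite mem_nth.
pose om i := sval (boolp.cid (Hom i)).
have Hom' i : (forall b, O i (om i b)) /\ lind iota (maxideal (O i)) (om i) := svalP (boolp.cid (Hom i)).
have := sum_ef_le x_tr mono_span mono_pow_ex HO HOd (omega := om) Ht Hh h0 (fun i => proj2 (He i))
  (fun i => proj1 (Hom' i)) (fun i => proj2 (Hom' i)).
rewrite muln1 (bigD1 i0) //= /f eqxx.
have -> : #|{: I}| = #|predC1 i0|.+1 by rewrite cardC1 prednK //; apply/card_gt0P; exists i0.
have H : (#|predC1 i0| <= \sum_(i | i != i0) e i * (if i == i0 then size v else 1))%N.
  rewrite -sum1_card; under eq_bigl => i do rewrite inE.
  by apply: leq_sum => i /negbTE->; rewrite muln1; case: (He i).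
have [e0 _] := He i0; move: e0 H; move: (e i0) (size v) => a b; move: #|_| (\sum_(i | _) _)%N => u w; clear; nia.
Qed.
End RationalFiber.

End Kummer.

(** * Counting *)

Section Counting.
Local Open Scope nat_scope.

Lemma sum_pair_nat (I J : finType) (G : I * J -> nat) :
  \sum_u G u = \sum_i \sum_j G (i, j).
Proof. by rewrite pair_bigA; apply: eq_bigr => -[]. Qed.

Lemma periodic_sum (f : nat -> nat) n e : (forall a, f (n + a) = f a) ->
  \sum_(a < e * n) f a = e * \sum_(a < n) f a.
Proof.
move=> Hf; elim: e => [|e IH]; first by rewrite !mul0n big_ord0.
rewrite !mulSn big_split_ord /= -IH; congr (_ + _).
by apply: eq_bigr => i _; rewrite Hf.
Qed.

Lemma count_linear_coprime n s t : 0 < n -> coprime n s -> \sum_(a < n) (n %| a * s + t) = 1.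
Proof.
move=> n0 cns.
pose g (a : 'I_n) : 'I_n := Ordinal (ltn_pmod (a * s + t) n0).
have injg : injective g.
  move=> a b /(congr1 val) /= /eqP; rewrite eqn_modDr => E; apply: ord_inj.
  wlog ab : a b E / a <= b.
    by move=> H; case/orP: (leq_total a b) => ab; [apply: H|apply/esym; apply: H; rewrite // eq_sym].
  move: E; rewrite eq_sym eqn_mod_dvd ?leq_mul2r ?ab ?orbT // -mulnBl Gauss_dvdl // => d.
  have ba : b - a < n by apply: leq_ltn_trans (leq_subr _ _) (ltn_ord b).
  have [E0|p] := posnP (b - a); first by apply/eqP; rewrite eqn_leq ab /= -subn_eq0 E0.
  by have := dvdn_leq p d; rewrite leqNgt ba.
have -> : \sum_(a < n) (n %| a * s + t) = \sum_(a < n) (g a == 0 :> nat) by [].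
rewrite -(reindex_inj injg (P := predT) (F := fun w : 'I_n => nat_of_bool (w == 0 :> nat))) /=.
rewrite (bigD1 (Ordinal n0)) //= big1 // => i /negbTE i0.
by rewrite -[0]/(nat_of_ord (Ordinal n0)) (inj_eq (@ord_inj _)) i0.
Qed.

Lemma count_linear n s t : 0 < n ->
  \sum_(a < n) (n %| a * s + t) = gcdn n s * (gcdn n s %| t).
Proof.
move=> n0; set e := gcdn n s; have e0 : 0 < e by rewrite gcdn_gt0 n0.
have [/dvdnP [t' tE]|nt] := boolP (e %| t); last first.
  rewrite muln0; apply: big1 => a _; apply/eqP; rewrite eqb0; apply: contra nt => d.
  have := dvdn_trans (dvdn_gcdl n s) d; rewrite dvdn_addr // dvdn_mull //; exact: dvdn_gcdr.
rewrite muln1.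
have nE : n = e * (n %/ e) by rewrite mulnC divnK // dvdn_gcdl.
have sE : s = e * (s %/ e) by rewrite mulnC divnK // dvdn_gcdr.
set n' := n %/ e in nE; set s' := s %/ e in sE.
have n'0 : 0 < n' by move: n0; rewrite {1}nE muln_gt0 => /andP [].
have cop : coprime n' s'.
  by rewrite /coprime -(eqn_pmul2l e0) muln_gcdr -nE -sE muln1.
have -> : \sum_(a < n) (n %| a * s + t) = \sum_(a < n) (n' %| a * s' + t').
  apply: eq_bigr => a _; rewrite {1}nE {1}sE tE mulnCA [t' * e]mulnC -mulnDr dvdn_pmul2l //.
have := @periodic_sum (fun a => n' %| a * s' + t') n' e.
rewrite -nE => ->; first by rewrite count_linear_coprime ?muln1.
by move=> a; rewrite mulnDl -addnA dvdn_addr // dvdn_mulr.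
Qed.

(** For fixed b there are e = gcd(m1, s1) or no solutions a, according to whether e m2 divides b s2
    m1. By periodicity the factor e is absorbed by letting b run over e m2 values, and
    [count_linear] applies again. *)
Lemma count_kernel m1 m2 s1 s2 : 0 < m1 -> 0 < m2 ->
  \sum_(i : 'I_m1 * 'I_m2) (m1 * m2 %| i.1 * s1 * m2 + i.2 * s2 * m1) =
  gcdn (gcdn (m1 * m2) (s1 * m2)) (s2 * m1).
Proof.
move=> m10 m20; set e := gcdn m1 s1; have e0 : 0 < e by rewrite gcdn_gt0 m10.
rewrite sum_pair_nat exchange_big /=.
have inner (b : nat) : \sum_(a < m1) (m1 * m2 %| a * s1 * m2 + b * s2 * m1) = e * (e * m2 %| b * (s2 * m1) + 0).
  rewrite addn0 mulnA; have [/dvdnP [t tE]|nt] := boolP (m2 %| b * s2 * m1).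
    rewrite tE dvdn_pmul2r // -count_linear //; apply: eq_bigr => a _.
    by rewrite -mulnDl dvdn_pmul2r.
  have -> : (e * m2 %| b * s2 * m1) = false.
    by apply: contraNF nt; apply: dvdn_trans; apply: dvdn_mull.
  rewrite muln0; apply: big1 => a _; apply/eqP; rewrite eqb0; apply: contra nt => d.
  have := dvdn_trans (dvdn_mull m1 (dvdnn m2)) d; rewrite dvdn_addr //; exact: dvdn_mull.
under eq_bigr => b _ do rewrite inner.
rewrite -big_distrr /=.
have := @periodic_sum (fun b => e * m2 %| b * (s2 * m1) + 0) m2 e; cbv beta => <-.
  by rewrite count_linear ?muln_gt0 ?e0 // dvdn0 muln1 muln_gcdl.
move=> a; rewrite !addn0 mulnDl dvdn_addr // mulnCA dvdn_mull // mulnC dvdn_mul //.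
exact: dvdn_gcdl.
Qed.

Lemma count_pos n : 0 < n -> \sum_(a < n) (0 < a) = n.-1.
Proof.
case: n => // n _; rewrite big_ord_recl /= add0n.
by transitivity (\sum_(i < n) 1); [apply: eq_bigr|rewrite sum1_card card_ord].
Qed.

(** Written additively: the rounding term of [wdelta] and the indicator in [count_kernel] add up to
    1 at each index. *)
Lemma sum_wdelta (k : finFieldType) m1 m2 s1 s2 (f1 f2 : {poly k}) : 0 < m1 -> 0 < m2 ->
  \sum_(i : 'I_m1 * 'I_m2) wdelta s1 s2 f1 f2 i + gcdn (gcdn (m1 * m2) (s1 * m2)) (s2 * m1) =
  (size f1).-1 * m1.-1 * m2 + (size f2).-1 * m2.-1 * m1 + m1 * m2.
Proof.
move=> m10 m20; rewrite -count_kernel // -big_split /=.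
under eq_bigr => i _ do rewrite /wdelta -addnA.
rewrite big_split /=; congr (_ + _).
  rewrite big_split /= !sum_pair_nat /=; congr (_ + _).
    under eq_bigr => i _ do rewrite sum_nat_const card_ord.
    rewrite -big_distrr /= -big_distrr /= count_pos //; lia.
  rewrite sum_nat_const card_ord -big_distrr /= count_pos //; lia.
transitivity (\sum_(i : 'I_m1 * 'I_m2) 1); last by rewrite sum1_card card_prod !card_ord.
apply: eq_bigr => i _; rewrite /xexp /dvdn lt0n.
by case: (_ == 0).
Qed.

End Counting.

(** * The curve *)

Lemma fiber_value (k k2 : finFieldType) (j : {rmorphism k -> k2}) (f : {poly k}) (m s : nat) (alpha tau : k2) :
  (0 < m)%N -> (m %| #|k|.-1)%N -> f.[0] != 0 -> coprimep f ('X^(#|k|.+1) - 1) ->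
  alpha ^+ #|k|.+1 = 1 -> tau ^+ m = alpha ->
  exists b : k2, [/\ b != 0, (map_poly j (recip f)).[alpha] != 0 &
    b ^+ m * (map_poly j (recip f)).[alpha] = alpha ^+ s * (map_poly j f).[alpha]].
Proof.
move=> m0 mk f0 cf a1 ta; rewrite -!/(ev j alpha _).
have a0 : alpha != 0 by apply: contraTneq isT => E; have := oner_eq0 k2; rewrite -a1 E expr0n mulr0n eqxx.
have t0 : tau != 0 by apply: contraNneq a0 => E; rewrite -ta E expr0n eqn0Ngt m0.
have v0 : ev j alpha f != 0.
  apply: (@coprimep_root _ (map_poly j ('X^(#|k|.+1) - 1))).
    by rewrite coprimep_sym coprimep_map.
  by rewrite rmorphB /= map_polyXn rmorph1 rootE hornerD hornerN hornerXn hornerC a1 subrr.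
(* 1/alpha = alpha^q, and the q-th power map commutes with f because its coefficients lie in F_q. *)
have gE : ev j alpha (recip f) = alpha ^+ (size f).-1 * ev j alpha f ^+ #|k|.
  rewrite ev_recip // ev_frobenius; congr (_ * ev j _ _).
  by apply: (mulfI a0); rewrite mulfV // -exprS a1.
have g0 : ev j alpha (recip f) != 0 by rewrite gE mulf_neq0 // expf_neq0.
(* The quotient is alpha^(s-d) f(alpha)^(1-q): tau supplies the root of the first factor, and m
   divides q - 1. *)
exists (tau ^+ s / tau ^+ (size f).-1 / ev j alpha f ^+ (#|k|.-1 %/ m)); split=> //.
  by rewrite !mulf_neq0 ?invr_neq0 ?expf_neq0.
rewrite !expr_div_n -!exprM divnK // ![(_ * m)%N]mulnC !exprM ta gE.
have -> : ev j alpha f ^+ #|k| = ev j alpha f * ev j alpha f ^+ #|k|.-1.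
  by rewrite -exprS prednK // ltnW // finRing_gt1.
by field; rewrite !expf_neq0.
Qed.

Lemma embedding_exists (k F : fieldType) (iota : {rmorphism k -> F}) (x : F) : transcendental_over iota x ->
  exists (L : fieldType) (emb : {rmorphism {poly k} -> L}) (phi : {rmorphism L -> F}),
    (forall z, exists ab : {poly k} * {poly k}, ab.2 != 0 /\ z = emb ab.1 / emb ab.2) /\
    (forall a, phi (emb a) = ev iota x a).
Proof.
move=> x_tr; have [phi phiE] := fraction_morphism (ev_eq0 x_tr).
exists {fraction {poly k}}, (@FracField.tofrac {poly k}), phi; split=> //.
exact: fractionP.
Qed.

Lemma separable_support (k : fieldType) (f1 f2 : {poly k}) (F : fieldType) (iota : {rmorphism k -> F}) (x : F) :
  transcendental_over iota x ->
  separable_poly f1 -> separable_poly f2 -> f1.[0] != 0 -> f2.[0] != 0 ->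
  coprimep f1 (recip f1) -> coprimep f2 (recip f2) -> coprimep (f1 * recip f1) (f2 * recip f2) ->
  separable_poly ('X * (f1 * recip f1) * (f2 * recip f2)).
Proof.
move=> x_tr s1 s2 h1 h2 c1 c2 c12.
have sX : separable_poly ('X : {poly k}).
  by rewrite separable_poly.unlock derivX coprimep1.
have cX (f : {poly k}) : f.[0] != 0 -> separable_poly f -> coprimep 'X (f * recip f).
  move=> f0 sf; rewrite coprimepMr ![coprimep 'X _]coprimep_sym !coprimepX f0 /=.
  exact: recip0 (separable_poly_neq0 sf).
rewrite !separable_mul coprimepMl c12 !cX // sX s1 s2 c1 c2 !(separable_recip x_tr) //.
Qed.

Theorem theorem6p3 (q : nat) (Fq : finFieldType) (hq : #|Fq| = q)
  (m1 m2 s1 s2 : nat) (f1 f2 : {poly Fq})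
  (hm1 : (2 <= m1)%N) (hm2 : (2 <= m2)%N)
  (hm1q : (m1 %| q.-1)%N) (hm2q : (m2 %| q.-1)%N)
  (hs1 : (s1 < m1)%N) (hs2 : (s2 < m2)%N)
  (hsep1 : separable_poly f1) (hsep2 : separable_poly f2)
  (hd1 : (1 < size f1)%N) (hd2 : (1 < size f2)%N)
  (h01 : f1.[0] != 0) (h02 : f2.[0] != 0)
  (hc1 : coprimep f1 (recip f1)) (hc2 : coprimep f2 (recip f2))
  (hc12 : coprimep (f1 * recip f1) (f2 * recip f2)) :
  (* genus of F_q(X), relative to its full constant field *)
  (forall (F : fieldType) (iota : {rmorphism Fq -> F}) (x y1 y2 : F),
     transcendental_over iota x ->
     y1 ^+ m1 * (map_poly iota (recip f1)).[x] = x ^+ s1 * (map_poly iota f1).[x] ->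
     y2 ^+ m2 * (map_poly iota (recip f2)).[x] = x ^+ s2 * (map_poly iota f2).[x] ->
     generated_by iota [:: x; y1; y2] ->
     is_genus (algebraic_over iota)
       ((m1 * m2 * ((size f1).-1 + (size f2).-1))%:Z - ((size f1).-1 * m2)%:Z
        - ((size f2).-1 * m1)%:Z + 1
        - (gcdn (gcdn (m1 * m2) (s1 * m2)) (s2 * m1))%:Z)) /\
  (* rational places of F_{q^2}(X) *)
  (forall (Fq2 : finFieldType) (j : {rmorphism Fq -> Fq2}), #|Fq2| = (q ^ 2)%N ->
   forall (F : fieldType) (iota : {rmorphism Fq2 -> F}) (x y1 y2 : F),
     transcendental_over iota x ->
     y1 ^+ m1 * (map_poly iota (map_poly j (recip f1))).[x]
       = x ^+ s1 * (map_poly iota (map_poly j f1)).[x] ->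
     y2 ^+ m2 * (map_poly iota (map_poly j (recip f2))).[x]
       = x ^+ s2 * (map_poly iota (map_poly j f2)).[x] ->
     generated_by iota [:: x; y1; y2] ->
     (forall z, algebraic_over iota z -> exists c, z = iota c) ->
     has_dim (ratfield iota x) (fun z => z = 0) (fun _ => True) (m1 * m2) ->
     coprimep f1 ('X^(q.+1) - 1) -> coprimep f2 ('X^(q.+1) - 1) ->
     exists O : 'I_(m1 * m2 * q.+1) -> (F -> Prop),
       (forall i, rational_place (fun z => exists c, z = iota c) (O i)) /\
       (forall i i', i != i' -> ~ same_place (O i) (O i'))).
Proof.
have m10 : (0 < m1)%N by rewrite ltnW.
have m20 : (0 < m2)%N by rewrite ltnW.
split.
  move=> F iota x y1 y2 x_tr E1 E2 gen.
  have S_sep := separable_support x_tr hsep1 hsep2 h01 h02 hc1 hc2 hc12.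
  have [L [emb [phi [embP phiE]]]] := embedding_exists x_tr.
  rewrite -hq in hm1q hm2q.
  have := kummer_genus x_tr m10 m20 hm1q hm2q S_sep hd1 hd2 E1 E2 gen embP phiE
    (size_recip h01) (size_recip h02).
  congr is_genus; have := sum_wdelta s1 s2 f1 f2 m10 m20.
  move: (\sum_i wdelta _ _ _ _ i)%N (gcdn _ _) (size f1).-1 (size f2).-1 => S K a b.
  by case: (m1) m10 => // m _; case: (m2) m20 => // m' _ /=; nia.
move=> Fq2 j card2 F iota x y1 y2 x_tr E1 E2 gen _ _ c1 c2.
have q1 : (1 < q)%N by rewrite -hq finRing_gt1.
(* Separability of the support is proved over F_q, where the reciprocals live, and then carried to
   F_(q^2) along [j]. *)
have jx_tr : transcendental_over (iota \o j) x.
  move=> p; rewrite map_poly_comp => /x_tr/eqP; rewrite map_poly_eq0 => /eqP; exact.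
have := separable_support jx_tr hsep1 hsep2 h01 h02 hc1 hc2 hc12.
rewrite -(separable_map j) !rmorphM /= map_polyX => S_sep.
have [L [emb [phi [embP phiE]]]] := embedding_exists x_tr.
have q2E : #|Fq2|.-1 = (q.-1 * q.+1)%N by rewrite card2 -mulnn; case: (q) q1 => // n _; lia.
have hm1q2 : (m1 %| #|Fq2|.-1)%N by rewrite q2E dvdn_mulr.
have hm2q2 : (m2 %| #|Fq2|.-1)%N by rewrite q2E dvdn_mulr.
have q2_gt0 : (0 < #|Fq2|.-1)%N by rewrite q2E muln_gt0 -subn1 subn_gt0 q1.
have [theta Htheta] := finField_prim_root q2_gt0 (dvdnn #|Fq2|.-1).
(* With theta a generator of the multiplicative group, these are the roots of X^(q+1) - 1. As m
   divides q - 1, each is visibly an m-th power. *)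
pose alpha (l : 'I_q.+1) := theta ^+ (q.-1 * l).
have alpha1 l : alpha l ^+ q.+1 = 1.
  by rewrite /alpha -exprM mulnAC -q2E exprM (prim_expr_order Htheta) expr1n.
have alpha_inj : injective alpha.
  move=> l l' /eqP; rewrite (eq_prim_root_expr Htheta) q2E !modn_small ?ltn_pmul2l // -?subn1 ?subn_gt0 //.
  by rewrite eqn_pmul2l ?subn_gt0 // => /eqP/ord_inj.
have tau m (l : 'I_q.+1) : (m %| q.-1)%N -> (theta ^+ (q.-1 %/ m * l)) ^+ m = alpha l.
  by move=> mq; rewrite -exprM mulnAC divnK.
have sj1 : (1 < size (map_poly j f1))%N by rewrite size_map_poly.
have sj2 : (1 < size (map_poly j f2))%N by rewrite size_map_poly.
have fib l : exists O : 'I_m1 * 'I_m2 -> F -> Prop,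
  [/\ forall i, rational_place (cst iota) (O i), forall i, maxideal (O i) (x - iota (alpha l)) &
      forall i i', i != i' -> ~ same_place (O i) (O i')].
  have al := alpha1 l; rewrite -hq in hm1q hm2q c1 c2 al.
  have t1 : (theta ^+ (q.-1 %/ m1 * l)) ^+ m1 = alpha l by apply: tau; rewrite -hq.
  have t2 : (theta ^+ (q.-1 %/ m2 * l)) ^+ m2 = alpha l by apply: tau; rewrite -hq.
  have [b1 [b10 g10 b1E]] := fiber_value j s1 m10 hm1q h01 c1 al t1.
  have [b2 [b20 g20 b2E]] := fiber_value j s2 m20 hm2q h02 c2 al t2.
  exact: (rational_fiber x_tr m10 m20 hm1q2 hm2q2 S_sep sj1 sj2 E1 E2 gen embP phiE b10 b20 g10 g20 b1E b2E).
have [O HO] := boolp.choice fib.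
have cE : (m1 * m2 * q.+1)%N = #|{: 'I_q.+1 * ('I_m1 * 'I_m2)}|.
  by rewrite !card_prod !card_ord mulnC.
pose u (i : 'I_(m1 * m2 * q.+1)) : 'I_q.+1 * ('I_m1 * 'I_m2) := enum_val (cast_ord cE i).
exists (fun i => O (u i).1 (u i).2); split=> [i|i i' ii' E].
  by have [H _ _] := HO (u i).1; apply: H.
have [R1 M1 D1] := HO (u i).1; have [R2 M2 D2] := HO (u i').1.
(* Places over the same alpha differ by [fib]; over different ones the residue of x differs. *)
have [e1|n1] := eqVneq (u i).1 (u i').1.
  have n2 : (u i).2 != (u i').2.
    apply: contra ii' => /eqP e2; apply/eqP/(cast_ord_inj (eq_n := cE))/enum_val_inj.
    by rewrite -/(u i) -/(u i') [u i]surjective_pairing [u i']surjective_pairing e1 e2.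
  by move: E; rewrite e1; apply: D2.
have HO1 : vring iota (O (u i).1 (u i).2) by apply: place_vring; case: (R1 (u i).2).
have H1 := M1 (u i).2; have H2 := M2 (u i').2; rewrite -(same_placeE E) in H2.
case/eqP: n1; apply/alpha_inj/eqP; rewrite -subr_eq0; apply/eqP/(maxideal_cst HO1).
have -> : iota (alpha (u i).1 - alpha (u i').1) =
   (x - iota (alpha (u i').1)) - (x - iota (alpha (u i).1)) by rewrite rmorphB; ring.
exact: (maxidealB HO1).
Qed.
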